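(* For semi-density matrices $\sigma$, $\rho$ on $n$ qubits, with $\rho$ elementary, $\mathbf{H}(\rho)+\mathbf{H}(\sigma/\langle\rho,\mathbf{H}(\rho)\rangle)<^{+}\mathbf{H}(\sigma\otimes\rho)$.
   Context: $U$ is a fixed universal prefix Turing machine and $\mathbf{m}(x/y)=\sum_p 2^{-\|p\|}[U_y(p)=x]$ the universal probability. A pure state or (semi-)density matrix is elementary if its real and imaginary parts have rational entries, so it can be encoded as a string. For $x$ a string, the universal semi-density matrix on $n$ qubits is $\boldsymbol{\mu}_{/x}=\sum_{\text{elementary }|\phi\rangle\in\mathcal{Q}_n}\mathbf{m}(|\phi\rangle/x,n)\,|\phi\rangle\langle\phi|$ (on $\sigma\otimes\rho$, the universal matrix on $2n$ qubits is used). The Gács entropy is $\mathbf{H}(\sigma/x)=\lceil-\log\mathrm{Tr}\,\boldsymbol{\mu}_{/x}\sigma\rceil$, with empty $x$ omitted. $\langle\rho,\mathbf{H}(\rho)\rangle$ denotes the string encoding the pair of elementary $\rho$ and the natural number $\mathbf{H}(\rho)$. $f<^{+}g$ means $f<g+O(1)$. *)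

(* Defs.v *)
From HB Require Import structures.
From mathcomp Require Import all_boot all_order all_algebra.
From mathcomp Require Import complex mxtens.
From mathcomp Require Import all_classical all_reals all_analysis.

Set Implicit Arguments.
Unset Strict Implicit.
Unset Printing Implicit Defensive.

Import Order.TTheory GRing.Theory Num.Theory.
Local Open Scope classical_set_scope.
Local Open Scope ring_scope.

(** * Turing machines *)

Definition bitstr := seq bool.

(** Tape alphabet: 0, 1 and the blank [None]. *)
Definition symb := option bool.

Inductive move := MoveL | Stay | MoveR.

(** [(l, r)] is the two-way infinite tape reading ... l_1 l_0 r_0 r_1 ... with
    blanks beyond both lists; the head scans [r_0]. *)
Definition tape := (seq symb * seq symb)%type.

Definition tape_read (t : tape) : symb := head None t.2.
Definition tape_write (s : symb) (t : tape) : tape := (t.1, s :: behead t.2).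
Definition tape_move (d : move) (t : tape) : tape :=
  match d with
  | MoveL => (behead t.1, head None t.1 :: t.2)
  | Stay => t
  | MoveR => (tape_read t :: t.1, behead t.2)
  end.
Definition tape_word (t : tape) : bitstr := pmap id (rev t.1 ++ t.2).

(** Deterministic machines with a program tape (0), an auxiliary input tape (1),
    an output tape (2) and [tm_work] further work tapes. The machine halts when
    [tm_delta] returns [None]. *)
Record TM := MkTM {
  tm_work : nat;
  tm_state : finType;
  tm_start : tm_state;
  tm_delta : tm_state -> {ffun 'I_tm_work.+3 -> symb} ->
             option (tm_state * ('I_tm_work.+3 -> symb * move)) }.

Definition tm_config (M : TM) : Type :=
  (tm_state M * ('I_(tm_work M).+3 -> tape))%type.

Definition tm_init (M : TM) (p y : bitstr) : tm_config M :=
  (tm_start M,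
   fun i : 'I_(tm_work M).+3 =>
     ([::], [seq Some b | b <- nth [::] [:: p; y] i])).

Definition tm_step (M : TM) (c : tm_config M) : option (tm_config M) :=
  if tm_delta c.1 [ffun i => tape_read (c.2 i)] is Some (q, act)
  then Some (q, fun i => tape_move (act i).2 (tape_write (act i).1 (c.2 i)))
  else None.

Definition tm_output (M : TM) (c : tm_config M) : bitstr :=
  tape_word (c.2 (@Ordinal (tm_work M).+3 2 isT)).

(** [tm_eval M y p x] is M_y(p) = x: on program [p] and auxiliary input [y] the
    machine halts with output [x]. *)
Definition tm_eval (M : TM) (y p x : bitstr) : Prop :=
  exists (t : nat) (c : tm_config M),
    [/\ iter t (obind (@tm_step M)) (Some (tm_init M p y)) = Some c,
        tm_step c = None & tm_output c = x].

Definition prefix_machine (M : TM) : Prop :=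
  forall y p s x x', tm_eval M y p x -> tm_eval M y (p ++ s) x' -> s = [::].

Definition universal_prefix_machine (U : TM) : Prop :=
  prefix_machine U /\
  forall T, prefix_machine T ->
    exists t : bitstr, forall y p x, tm_eval U y (t ++ p) x <-> tm_eval T y p x.

(** * Encodings

    Any other computable injective encodings change the entropies below only by
    an additive constant. The codes of numbers and matrices are self-delimiting;
    [code_pair x y] is injective for arbitrary strings [x] and [y]. *)

Definition code_nat (n : nat) : bitstr := rcons (nseq n true) false.
Definition code_int (z : int) : bitstr := (z < 0) :: code_nat `|z|%N.
Definition code_rat (q : rat) : bitstr := code_int (numq q) ++ code_int (denq q).
Definition code_ratC (z : rat[i]) : bitstr :=
  code_rat (complex.Re z) ++ code_rat (complex.Im z).
Definition code_mx (p q : nat) (A : 'M[rat[i]]_(p, q)) : bitstr :=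
  code_nat p ++ code_nat q ++
  flatten [seq code_ratC (A i j) | i <- enum 'I_p, j <- enum 'I_q].
Definition code_pair (x y : bitstr) : bitstr := code_nat (size x) ++ x ++ y.

Section Entropy.
Variable R : realType.
Local Notation C := R[i].

(** * Quantum states on n qubits, as vectors and matrices over C^(2^n) *)

(** Elementary vectors and matrices are those with entries in Q(i); they are
    represented over [rat[i]], and [elem] embeds them into the complex ones. *)
Definition elem (p q : nat) (A : 'M[rat[i]]_(p, q)) : 'M[C]_(p, q) :=
  map_mx (fun z => Complex (ratr (complex.Re z)) (ratr (complex.Im z))) A.

Definition adjmx (p q : nat) (A : 'M[C]_(p, q)) : 'M[C]_(q, p) :=
  map_mx (@conjc R) A^T.

Definition pure_state (n : nat) (phi : 'cV[C]_(2 ^ n)) : Prop :=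
  adjmx phi *m phi = 1%:M.

(** In the partial order of C, [0 <= z] entails that [z] is real, so a positive
    semidefinite [A] is Hermitian. *)
Definition psd (d : nat) (A : 'M[C]_d) : Prop :=
  forall v : 'cV[C]_d, 0 <= (adjmx v *m A *m v) 0 0.

Definition semi_density (n : nat) (A : 'M[C]_(2 ^ n)) : Prop :=
  psd A /\ \tr A <= 1.

Definition qtens (m n : nat) (A : 'M[C]_(2 ^ m)) (B : 'M[C]_(2 ^ n)) :
    'M[C]_(2 ^ (m + n)) :=
  castmx (esym (expnD 2 m n), esym (expnD 2 m n)) (tensmx A B).

(** * Universal probability, universal semi-density matrix, Gacs entropy *)

Definition univ_prob (U : TM) (x y : bitstr) : R :=
  fine (\esum_(p in [set p | tm_eval U y p x]) (2 ^- size p)%:E).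

(** Sum of an absolutely summable real family, as the difference of the sums of
    its positive and negative parts. *)
Definition rsum (T : choiceType) (D : set T) (f : T -> R) : R :=
  fine (\esum_(i in D) (Num.max (f i) 0)%:E) -
  fine (\esum_(i in D) (Num.max (- f i) 0)%:E).

Definition csum (T : choiceType) (D : set T) (f : T -> C) : C :=
  Complex (rsum D (fun i => complex.Re (f i)))
          (rsum D (fun i => complex.Im (f i))).

Definition univ_matrix (U : TM) (x : bitstr) (n : nat) : 'M[C]_(2 ^ n) :=
  \matrix_(i, j)
    csum [set phi : 'cV[rat[i]]_(2 ^ n) | pure_state (elem phi)]
      (fun phi =>
        ((univ_prob U (code_mx phi) (code_pair x (code_nat n)))%:C%C *:
           (elem phi *m adjmx (elem phi))) i j).

(** The value is [+oo] exactly when the trace vanishes, that is, for [A = 0]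
    when [U] is universal. *)
Definition gacs (U : TM) (n : nat) (A : 'M[C]_(2 ^ n)) (x : bitstr) : \bar R :=
  let t := complex.Re (\tr (univ_matrix U x n *m A)) in
  if t <= 0 then +oo%E
  else ((Num.ceil (- (ln t / ln 2)))%:~R)%:E.

(** The code of an entropy value; the infinite one gets the empty string, which
    is the code of no natural number. *)
Definition code_entropy (h : \bar R) : bitstr :=
  if h is r%:E then code_nat (Num.truncn r) else [::].

End Entropy.

(* Main.v *)
Require Import Defs.
From HB Require Import structures.
From mathcomp Require Import all_boot all_order all_algebra.
From mathcomp Require Import complex mxtens.
From mathcomp Require Import all_classical all_reals all_analysis.
From mathcomp Require Import zify ring lra.

(** Write t(A/x) for the trace of the universal matrix given x against A: the sum
    of 2^-|p| <phi|A|phi> over the programs p that output an elementary pure state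
    phi. Suppose that positive semidefinite matrices A(x, phi) with entries in Q(i)
    are computable from x and phi, with 2^-|p| tr A(x, phi) summing to at most 1
    over the programs p for phi. Elimination followed by a splitting of each vector
    into two multiples of rational unit vectors bounds A(x, phi) by a computable
    combination of elementary pure states of total weight O(tr A(x, phi)), and the
    coding theorem then bounds the sum of the 2^-|p| A(x, phi) by a constant times
    the universal matrix given x.

    For phi on 2n qubits, the partial traces of |phi><phi| give
    t(1 (x) rho) <= c t(rho) = O(2^-H(rho)). Hence the matrices
    2^H(rho) tr_2(|phi><phi| (1 (x) rho)), computable from <rho, H(rho)> and phi,
    have bounded total trace, and so
    2^H(rho) t(sigma (x) rho) <= c' t(sigma/<rho, H(rho)>). The theorem is the
    logarithm of this inequality. *)

Set Implicit Arguments.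
Unset Strict Implicit.
Unset Printing Implicit Defensive.

Import Order.TTheory GRing.Theory Num.Theory.

(** [U] simulates only concrete Turing machines, so every map that enters the coding theorem must be
    shown computable. This is done for functions between encodable types, which a counter language
    compiles to Turing machines.

    The elimination itself is never computed. The machine enumerates candidate decompositions and
    checks each in exact rational arithmetic; elimination only proves that some candidate passes. So
    the decomposition must have rational entries, while a rational vector may have an irrational
    norm: this is why each vector is split in two.

    The requests are computed uniformly from the condition, but their total is at most 1 only at
    good conditions such as [<rho, h>] with [h = H(rho)]; a wrong [h] may make it infinite. Code
    words are therefore assigned along partial sums: the decoder is then prefix-free at every
    condition, and the bound on the total serves only to find the code words.

    If the trace against [rho] vanishes, [H(rho)] is infinite and there is no factor [2^H(rho)].
    Then the trace against [sigma (x) rho] vanishes too, and the right-hand side is infinite. *)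

Local Notation gq := (rat[i]%C).

(** * Counter programs *)

Definition regs := nat -> nat.
Definition upd (s : regs) r v : regs := fun i => if i == r then v else s i.

(* The remaining contents of the two input tapes and the word written so far. *)
Definition channels := ((seq bool * seq bool) * seq bool)%type.

Inductive cmd :=
  | Inc of nat
  | Dec of nat
  | Seq of cmd & cmd
  | If of nat & cmd & cmd
  | Loop of nat & cmd
  | Read of bool & nat
  | Write of bool.

Definition chan_in (i : bool) (io : channels) : seq bool :=
  if i then io.1.2 else io.1.1.
Definition chan_drop (i : bool) (io : channels) : channels :=
  if i then ((io.1.1, behead io.1.2), io.2) else ((behead io.1.1, io.1.2), io.2).
Definition chan_write (b : bool) (io : channels) : channels :=
  (io.1, rcons io.2 b).

Definition cstate := (regs * channels)%type.

(** A run that never ends has no derivation. [Read] adds to its two registers instead of overwriting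
    them, so that each primitive is a single step of the machine built below. *)
Inductive exec : cmd -> cstate -> cstate -> Prop :=
  | ExInc r s io : exec (Inc r) (s, io) (upd s r (s r).+1, io)
  | ExDec r s io : exec (Dec r) (s, io) (upd s r (s r).-1, io)
  | ExSeq c1 c2 s1 s2 s3 : exec c1 s1 s2 -> exec c2 s2 s3 -> exec (Seq c1 c2) s1 s3
  | ExIfT r c1 c2 s s' : s.1 r != 0 -> exec c1 s s' -> exec (If r c1 c2) s s'
  | ExIfF r c1 c2 s s' : s.1 r = 0 -> exec c2 s s' -> exec (If r c1 c2) s s'
  | ExLoop0 r c s : s.1 r = 0 -> exec (Loop r c) s s
  | ExLoopS r c s1 s2 s3 : s1.1 r != 0 -> exec c s1 s2 -> exec (Loop r c) s2 s3 ->
      exec (Loop r c) s1 s3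
  | ExRead i r s io : exec (Read i r) (s, io)
      (upd (upd s r (s r + (chan_in i io != [::]))) r.+1
         (s r.+1 + head false (chan_in i io)), chan_drop i io)
  | ExWrite b s io : exec (Write b) (s, io) (s, chan_write b io).

Lemma exec_eq c s io s' t' : exec c (s, io) t' -> t' = s' -> exec c (s, io) s'.
Proof. by move=> h <-. Qed.

Ltac upd_tac :=
  rewrite /upd /=; try apply: funext => ?;
  repeat match goal with
  | |- context [if ?a == ?b then _ else _] => case: (eqVneq a b) => ?; subst => //=
  | h : is_true (?a != ?a) |- _ => by rewrite eqxx in h
  end; try by lia.

Definition skip := Seq (Inc 0) (Dec 0).

Lemma upd_id s r : upd s r (s r) = s.
Proof. by apply: funext => i; rewrite /upd; case: eqP => [->|]. Qed.

Lemma upd_upd s r v w : upd (upd s r v) r w = upd s r w.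
Proof. by apply: funext => i; rewrite /upd; case: eqP. Qed.

Lemma exec_skip s io : exec skip (s, io) (s, io).
Proof.
apply: ExSeq; first exact: ExInc.
by apply: (exec_eq (ExDec _ _ _)); congr (_, _); upd_tac.
Qed.

Definition drain r a := Loop r (Seq (Dec r) (Inc a)).
Definition drain2 r a b := Loop r (Seq (Dec r) (Seq (Inc a) (Inc b))).
Definition clear r := Loop r (Dec r).

Lemma exec_clear r s io : exec (clear r) (s, io) (upd s r 0, io).
Proof.
have [n sr] : exists n, s r = n by exists (s r).
elim: n s sr => [|n IH] s sr.
  by rewrite -[s in (s, _)](upd_id s r) sr; apply: ExLoop0; rewrite /upd /= eqxx.
apply: ExLoopS; [by rewrite /= sr|exact: ExDec|].
by apply: (exec_eq (IH _ _)); rewrite ?upd_upd // /upd eqxx sr.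
Qed.

Lemma exec_drain r a s io : r != a ->
  exec (drain r a) (s, io) (upd (upd s a (s a + s r)) r 0, io).
Proof.
move=> ra.
have [n sr] : exists n, s r = n by exists (s r).
elim: n s sr => [|n IH] s sr.
  apply: exec_eq; first by apply: ExLoop0 => /=.
  by congr (_, _); rewrite sr addn0 upd_id -sr upd_id.
apply: ExLoopS; [by rewrite /= sr|apply: ExSeq; [exact: ExDec|exact: ExInc]|].
apply: (exec_eq (IH _ _)); first by upd_tac.
congr (_, _); upd_tac.
Qed.

Lemma exec_drain2 r a b s io : r != a -> r != b -> a != b ->
  exec (drain2 r a b) (s, io) (upd (upd (upd s a (s a + s r)) b (s b + s r)) r 0, io).
Proof.
move=> ra rb ab.
have [n sr] : exists n, s r = n by exists (s r).
elim: n s sr => [|n IH] s sr.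
  apply: exec_eq; first by apply: ExLoop0 => /=.
  by congr (_, _); rewrite sr !addn0 upd_id upd_id -sr upd_id.
apply: ExLoopS; [by rewrite /= sr| |].
  by apply: ExSeq; [exact: ExDec|apply: ExSeq; exact: ExInc].
apply: (exec_eq (IH _ _)); first by upd_tac.
congr (_, _); upd_tac.
Qed.

(** Cantor pairing: pairs are listed along the antidiagonals, [b] being the position on its
    antidiagonal. [unp_step] moves to the next pair, so unpairing is plain iteration. *)
Fixpoint tri n := if n is m.+1 then tri m + n else 0.
Definition pr a b := tri (a + b) + b.
Definition unp_step (x : nat * nat) :=
  if x.1 is a.+1 then (a, x.2.+1) else (x.2.+1, 0).
Definition unp n := iter n unp_step (0, 0).
Definition lft n := (unp n).1.
Definition rgt n := (unp n).2.

Lemma pr_step x : pr (unp_step x).1 (unp_step x).2 = (pr x.1 x.2).+1.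
Proof.
by case: x => [[|a] b]; rewrite /pr /= ?addn0 ?add0n ?addnS ?addSnnS //= ?addSn; lia.
Qed.

Lemma unpK n : pr (lft n) (rgt n) = n.
Proof. by elim: n => //= n IH; rewrite /lft /rgt /unp /= pr_step -[iter _ _ _]/(unp n) IH. Qed.

Lemma unp_pr a b : unp (pr a b) = (a, b).
Proof.
rewrite /unp /pr addnC iterD.
have diag n : iter (tri n) unp_step (0, 0) = (n, 0).
  elim: n => //= n IH; rewrite addnC iterD IH.
  have walk m : m <= n -> iter m unp_step (n, 0) = (n - m, m).
    elim: m => [|m IHm] mn; first by rewrite subn0.
    by rewrite /= IHm ?(ltnW mn) // /unp_step /= (_ : n - m = (n - m.+1).+1) //; lia.
  by rewrite iterS walk // subnn.
rewrite diag; elim: b a => [|b IH] a; first by rewrite addn0.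
by rewrite iterS addnS -addSn IH.
Qed.

Lemma lft_pr a b : lft (pr a b) = a. Proof. by rewrite /lft unp_pr. Qed.
Lemma rgt_pr a b : rgt (pr a b) = b. Proof. by rewrite /rgt unp_pr. Qed.

Lemma rgt_le n : rgt n <= n.
Proof. by rewrite -{2}[n]unpK /pr leq_addl. Qed.

(* [pr_cmd r] replaces registers [r], [r+1] by [pr], [0]; [unp_cmd r] undoes it.
   Both use [r+2] and above as scratch. *)
Definition pr_cmd r :=
  Seq (drain r r.+2)
  (Seq (drain2 r.+1 r r.+2)
  (Loop r.+2 (Seq (drain2 r.+2 r r.+1) (Seq (drain r.+1 r.+2) (Dec r.+2))))).

Lemma exec_pr r s io : s r.+2 = 0 ->
  exec (pr_cmd r) (s, io) (upd (upd s r.+1 0) r (pr (s r) (s r.+1)), io).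
Proof.
move=> s2; have ne1 : (r == r.+1) = false by lia.
have ne2 : (r == r.+2) = false by lia.
have ne3 : (r.+1 == r.+2) = false by lia.
apply: ExSeq; first by apply: exec_drain; rewrite ne2.
apply: ExSeq; first by apply: exec_drain2; lia.
(* Register [r] now holds [s r.+1] and [r.+2] the sum of both. Each round adds [r.+2] to [r] and
   then decrements it, which accumulates the triangular number. *)
set s1 := (X in exec _ (X, _) _).
have s1E : s1 = upd (upd (upd s r (s r.+1)) r.+1 0) r.+2 (s r + s r.+1).
  by rewrite /s1; upd_tac.
rewrite s1E /pr; move: (s r + s r.+1) => n; move: (s r.+1) => v {s1 s1E}.
rewrite addnC; elim: n v => [|n IH] v.
  apply: exec_eq; first by apply: ExLoop0; rewrite /= /upd eqxx.
  by congr (_, _); upd_tac.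
apply: ExLoopS; first by rewrite /= /upd eqxx.
  apply: ExSeq; first by apply: exec_drain2; lia.
  apply: ExSeq; first by apply: exec_drain; lia.
  exact: ExDec.
set s1 := (X in exec _ (X, _) _).
have -> : s1 = upd (upd (upd s r (v + n.+1)) r.+1 0) r.+2 n.
  by rewrite /s1; upd_tac.
by apply: (exec_eq (IH _)); congr (_, _); upd_tac; rewrite /=; lia.
Qed.

Definition unp_cmd r :=
  Seq (drain r r.+2)
  (Loop r.+2 (Seq (Dec r.+2)
     (If r (Seq (Dec r) (Inc r.+1)) (Seq (Inc r) (drain r.+1 r))))).

Lemma exec_unp r s io : s r.+1 = 0 -> s r.+2 = 0 ->
  exec (unp_cmd r) (s, io) (upd (upd s r (lft (s r))) r.+1 (rgt (s r)), io).
Proof.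
move=> s1 s2.
apply: ExSeq; first by apply: exec_drain; lia.
suff H n x : exec (Loop r.+2 (Seq (Dec r.+2)
     (If r (Seq (Dec r) (Inc r.+1)) (Seq (Inc r) (drain r.+1 r)))))
     (upd (upd (upd s r x.1) r.+1 x.2) r.+2 n, io)
     (upd (upd s r (iter n unp_step x).1) r.+1 (iter n unp_step x).2, io).
  set s' := (X in exec _ (X, _) _).
  have -> : s' = upd (upd (upd s r (0, 0).1) r.+1 (0, 0).2) r.+2 (s r).
    by rewrite /s'; upd_tac.
  exact: H.
elim: n x => [|n IH] x.
  apply: exec_eq; first by apply: ExLoop0; rewrite /= /upd eqxx.
  by congr (_, _); upd_tac.
rewrite iterSr; apply: ExLoopS; [by rewrite /= /upd eqxx| |exact: (IH (unp_step x))].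
apply: ExSeq; first exact: ExDec.
case: x => [[|a] b] /=.
  apply: ExIfF; first by upd_tac.
  apply: ExSeq; first exact: ExInc.
  apply: exec_eq; first by apply: exec_drain; lia.
  by congr (_, _); upd_tac.
apply: ExIfT; first by upd_tac.
apply: ExSeq; first exact: ExDec.
by apply: (exec_eq (ExInc _ _ _)); congr (_, _); upd_tac.
Qed.

(** * Computable functions on numbers *)

(** The base register is a parameter so that subprograms can run at an offset: the registers above
    it are scratch, zero before and after, and those below are preserved. *)
Definition computes (c : nat -> cmd) (f : nat -> nat) :=
  forall r s io, (forall i, r < i -> s i = 0) ->
    exec (c r) (s, io) (upd s r (f (s r)), io).

Definition computable (f : nat -> nat) := exists c, computes c f.

Lemma computable_ext f g : f =1 g -> computable f -> computable g.
Proof. by move=> /funext ->. Qed.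

Lemma computable_id : computable id.
Proof. by exists (fun=> skip) => r s io _; rewrite upd_id; exact: exec_skip. Qed.

Lemma computable_succ : computable succn.
Proof. by exists Inc => r s io _; exact: ExInc. Qed.

Lemma computable_pred : computable predn.
Proof. by exists Dec => r s io _; exact: ExDec. Qed.

Lemma computable_zero : computable (fun=> 0).
Proof. by exists clear => r s io _; exact: exec_clear. Qed.

Lemma computable_comp f g : computable f -> computable g -> computable (f \o g).
Proof.
move=> [cf hf] [cg hg]; exists (fun r => Seq (cg r) (cf r)) => r s io s0.
apply: ExSeq; first exact: hg.
apply: exec_eq; first by apply: hf => i ri; rewrite /upd gtn_eqF //; exact: s0.
by congr (_, _); upd_tac.
Qed.

Lemma computable_lft : computable lft.
Proof.
exists (fun r => Seq (unp_cmd r) (clear r.+1)) => r s io s0.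
have [s1 s2] : s r.+1 = 0 /\ s r.+2 = 0 by split; apply: s0; lia.
apply: ExSeq; first exact: exec_unp.
by apply: (exec_eq (exec_clear _ _ _)); congr (_, _); upd_tac.
Qed.

Lemma computable_rgt : computable rgt.
Proof.
exists (fun r => Seq (unp_cmd r) (Seq (clear r) (drain r.+1 r))) => r s io s0.
have [s1 s2] : s r.+1 = 0 /\ s r.+2 = 0 by split; apply: s0; lia.
apply: ExSeq; first exact: exec_unp.
apply: ExSeq; first exact: exec_clear.
apply: exec_eq; first by apply: exec_drain; lia.
by congr (_, _); upd_tac.
Qed.

Lemma computable_pr f g : computable f -> computable g ->
  computable (fun n => pr (f n) (g n)).
Proof.
move=> [cf hf] [cg hg].
exists (fun r => Seq (drain2 r r.+1 r.+2) (Seq (drain r.+2 r)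
   (Seq (cf r.+1) (Seq (drain2 r r.+2 r.+3) (Seq (drain r.+3 r) (Seq (cg r.+2)
   (Seq (clear r) (Seq (drain r.+1 r) (Seq (drain r.+2 r.+1) (pr_cmd r)))))))))) => r s io s0.
have [s1 s2 s3] : [/\ s r.+1 = 0, s r.+2 = 0 & s r.+3 = 0] by split; apply: s0; lia.
apply: ExSeq; first by apply: exec_drain2; lia.
apply: ExSeq; first by apply: exec_drain; lia.
set t := (X in exec _ (X, _) _).
have -> : t = upd s r.+1 (s r) by rewrite /t; upd_tac.
apply: ExSeq.
  by apply: hf => i ri; rewrite /upd gtn_eqF //; apply: s0; lia.
apply: ExSeq; first by apply: exec_drain2; lia.
apply: ExSeq; first by apply: exec_drain; lia.
set u := (X in exec _ (X, _) _).
have -> : u = upd (upd s r.+1 (f (s r))) r.+2 (s r) by rewrite /u; upd_tac.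
apply: ExSeq.
  by apply: hg => i ri; have := s0 i; upd_tac; move=> ->; lia.
apply: ExSeq; first exact: exec_clear.
apply: ExSeq; first by apply: exec_drain; lia.
apply: ExSeq; first by apply: exec_drain; lia.
set v := (X in exec _ (X, _) _).
have -> : v = upd (upd s r.+1 (g (s r))) r (f (s r)) by rewrite /v; upd_tac.
apply: exec_eq; first by apply: exec_pr; upd_tac.
by congr (_, _); upd_tac.
Qed.

Lemma computable_iter f : computable f ->
  computable (fun z => iter (lft z) f (rgt z)).
Proof.
move=> [cf hf].
exists (fun r => Seq (unp_cmd r) (Seq (Loop r (Seq (cf r.+1) (Dec r))) (drain r.+1 r))) => r s io s0.
have [s1 s2] : s r.+1 = 0 /\ s r.+2 = 0 by split; apply: s0; lia.
apply: ExSeq; first exact: exec_unp.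
move: (lft (s r)) (rgt (s r)) => n x.
apply: (@ExSeq _ _ _ (upd (upd s r 0) r.+1 (iter n f x), io)); last first.
  apply: exec_eq; first by apply: exec_drain; lia.
  by congr (_, _); upd_tac.
elim: n x => [|n IH] x.
  by apply: ExLoop0; upd_tac.
rewrite iterSr; apply: ExLoopS; last exact: (IH (f x)).
  by upd_tac.
apply: ExSeq.
  by apply: hf => i ri; have := s0 i; upd_tac; move=> ->; lia.
by apply: (exec_eq (ExDec _ _ _)); congr (_, _); upd_tac.
Qed.

(** * Computable functions between encodable types *)

Class Enc (A : Type) := { en : A -> nat; en_inj : injective en }.

(* [f] is computable on codes; [g] is arbitrary on numbers that code nothing. *)
Definition PR (A B : Type) {EA : Enc A} {EB : Enc B} (f : A -> B) :=
  exists2 g, computable g & forall a, g (en a) = en (f a).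

Create HintDb prdb discriminated.
#[global] Hint Constants Opaque : prdb.
Ltac prt := solve [eauto 200 with prdb nocore].

#[global] Instance Enc_nat : Enc nat := {| en := id; en_inj := @inj_id nat |}.

Definition en_bool (b : bool) : nat := b.
Lemma en_bool_inj : injective en_bool. Proof. by case; case. Qed.
#[global] Instance Enc_bool : Enc bool := {| en := en_bool; en_inj := en_bool_inj |}.

Section EncInstances.
Context {A B : Type} {EA : Enc A} {EB : Enc B}.

Definition en_prod (x : A * B) := pr (en x.1) (en x.2).
Lemma en_prod_inj : injective en_prod.
Proof.
move=> [a b] [c d] e; have := f_equal lft e; have := f_equal rgt e.
by rewrite /en_prod !lft_pr !rgt_pr /= => h1 h2; rewrite (en_inj h1) (en_inj h2).
Qed.
#[global] Instance Enc_prod : Enc (A * B) := {| en := en_prod; en_inj := en_prod_inj |}.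

Definition en_option (x : option A) := if x is Some a then (en a).+1 else 0.
Lemma en_option_inj : injective en_option.
Proof. by move=> [a|] [b|] //= [] h; rewrite (en_inj h). Qed.
#[global] Instance Enc_option : Enc (option A) :=
  {| en := en_option; en_inj := en_option_inj |}.

Fixpoint en_seq (s : seq A) := if s is a :: s' then (pr (en a) (en_seq s')).+1 else 0.
Lemma en_seq_inj : injective en_seq.
Proof.
elim=> [|a s IH] [|b t] //= [] e; have := f_equal lft e; have := f_equal rgt e.
by rewrite !lft_pr !rgt_pr => /IH -> h; rewrite (en_inj h).
Qed.
#[global] Instance Enc_seq : Enc (seq A) := {| en := en_seq; en_inj := en_seq_inj |}.

End EncInstances.

(** Lets the code of a list serve as the number of rounds when a fold is written as an iteration. *)
Lemma size_le_en (A : Type) {EA : Enc A} (s : seq A) : size s <= en s.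
Proof.
elim: s => //= a s IH; rewrite ltnS (leq_trans IH) //.
by rewrite -[X in X <= _](rgt_pr (en a)) rgt_le.
Qed.

Section Base.
Context {A : Type} {EA : Enc A}.

Lemma PR_ext (B : Type) {EB : Enc B} (f g : A -> B) : f =1 g -> PR f -> PR g.
Proof. by move=> /funext ->. Qed.

Lemma PR_id : PR (fun x : A => x).
Proof. by exists id => //; exact: computable_id. Qed.

Lemma PR_comp (B C : Type) {EB : Enc B} {EC : Enc C} (f : B -> C) (g : A -> B) :
  PR f -> PR g -> PR (fun x => f (g x)).
Proof.
move=> [cf hf ef] [cg hg eg]; exists (cf \o cg); first exact: computable_comp.
by move=> a /=; rewrite eg ef.
Qed.

Lemma PR_pair (B C : Type) {EB : Enc B} {EC : Enc C} (f : A -> B) (g : A -> C) :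
  PR f -> PR g -> PR (fun x => (f x, g x)).
Proof.
move=> [cf hf ef] [cg hg eg]; eexists; first exact: (computable_pr hf hg).
by move=> a /=; rewrite eg ef.
Qed.

Lemma PR_fst (B C : Type) {EB : Enc B} {EC : Enc C} (f : A -> B * C) :
  PR f -> PR (fun x => (f x).1).
Proof.
move=> [cf hf ef]; exists (lft \o cf); first exact: computable_comp computable_lft hf.
by move=> a; rewrite /= ef lft_pr.
Qed.

Lemma PR_snd (B C : Type) {EB : Enc B} {EC : Enc C} (f : A -> B * C) :
  PR f -> PR (fun x => (f x).2).
Proof.
move=> [cf hf ef]; exists (rgt \o cf); first exact: computable_comp computable_rgt hf.
by move=> a; rewrite /= ef rgt_pr.
Qed.

Lemma PR_const (B : Type) {EB : Enc B} (b : B) : PR (fun _ : A => b).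
Proof.
exists (fun=> en b) => //; elim: (en b) => [|n IH]; first exact: computable_zero.
exact: computable_comp computable_succ IH.
Qed.

Lemma PR_succ (f : A -> nat) : PR f -> PR (fun x => (f x).+1).
Proof.
move=> [cf hf ef]; exists (succn \o cf); first exact: computable_comp computable_succ hf.
by move=> a; rewrite /= ef.
Qed.

Lemma PR_pred (f : A -> nat) : PR f -> PR (fun x => (f x).-1).
Proof.
move=> [cf hf ef]; exists (predn \o cf); first exact: computable_comp computable_pred hf.
by move=> a; rewrite /= ef.
Qed.

Lemma PR_en (B : Type) {EB : Enc B} (f : A -> B) : PR f -> PR (fun x => en (f x)).
Proof. by []. Qed.

(** [computable_iter] iterates one fixed function, so the parameter travels with the value in a pair
    and is dropped at the end. *)
Lemma PR_iter (B : Type) {EB : Enc B} (n : A -> nat) (s : A -> B -> B) (b : A -> B) :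
  PR n -> PR (fun p => s p.1 p.2) -> PR b -> PR (fun x => iter (n x) (s x) (b x)).
Proof.
move=> [cn hn en_] [cs hs es] [cb hb eb].
have hF := computable_pr computable_lft hs.
have hG := computable_comp (computable_iter hF)
  (computable_pr hn (computable_pr computable_id hb)).
exists (rgt \o ((fun z => iter (lft z) (fun z => pr (lft z) (cs z)) (rgt z)) \o
   (fun m => pr (cn m) (pr m (cb m))))); first exact: computable_comp computable_rgt hG.
move=> a; rewrite /= lft_pr rgt_pr en_ eb.
have H m : iter m (fun z => pr (lft z) (cs z)) (pr (en a) (en (b a))) =
    pr (en a) (en (iter m (s a) (b a))).
  elim: m => [//|k IH]; rewrite !iterS IH lft_pr; congr pr.
  exact: (es (a, iter k (s a) (b a))).
by rewrite H rgt_pr.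
Qed.

Lemma PR_nat_of_bool (f : A -> bool) : PR f -> PR (fun x => nat_of_bool (f x)).
Proof. by move=> [c h e]; exists c. Qed.

End Base.

#[global] Hint Resolve PR_id PR_const PR_pair PR_fst PR_snd PR_succ PR_pred PR_iter
  PR_nat_of_bool PR_en : prdb.

Lemma PR_comp2 (A B C D : Type) {EA : Enc A} {EB : Enc B} {EC : Enc C} {ED : Enc D}
    (F : B -> C -> D) (f : A -> B) (g : A -> C) :
  PR (fun p => F p.1 p.2) -> PR f -> PR g -> PR (fun x => F (f x) (g x)).
Proof. by move=> hF hf hg; apply: (PR_comp hF (PR_pair hf hg)). Qed.

Lemma PR_comp3 (A B C D E : Type) {EA : Enc A} {EB : Enc B} {EC : Enc C} {ED : Enc D}
    {EE : Enc E} (F : B -> C -> D -> E) (f : A -> B) (g : A -> C) (h : A -> D) :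
  PR (fun p => F p.1.1 p.1.2 p.2) -> PR f -> PR g -> PR h ->
  PR (fun x => F (f x) (g x) (h x)).
Proof. by move=> hF hf hg hh; apply: (PR_comp hF (PR_pair (PR_pair hf hg) hh)). Qed.

#[global] Hint Extern 3 (PR _) =>
  match goal with
  | h : PR ?F |- PR (fun x => ?F (@?f x)) => apply (PR_comp h)
  | h : PR (fun p => ?F p.1 p.2) |- PR (fun x => ?F (@?f x) (@?g x)) =>
      apply (PR_comp2 h)
  | h : PR (fun p => ?F p.1.1 p.1.2 p.2) |- PR (fun x => ?F (@?f x) (@?g x) (@?k x)) =>
      apply (PR_comp3 h)
  end : prdb.

(* Structure projections and abbreviations in the codomain block the other hints. *)
#[global] Hint Extern 0 (@PR ?A ?B ?EA ?EB ?f) =>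
  let B' := eval hnf in B in
  tryif constr_eq B B' then fail else change (@PR A B' EA EB f) : prdb.

Section Ifs.
Context {A : Type} {EA : Enc A}.

Lemma PR_isS (f : A -> nat) : PR f -> PR (fun x => 0 < f x).
Proof.
move=> hf; apply: (PR_ext (f := fun x => iter (f x) (fun _ => true) false)).
  by move=> x; case: (f x).
by apply: PR_iter => //; exact: PR_const.
Qed.

Lemma PR_if (B : Type) {EB : Enc B} (c : A -> bool) (f g : A -> B) :
  PR c -> PR f -> PR g -> PR (fun x => if c x then f x else g x).
Proof.
move=> hc hf hg.
apply: (PR_ext (f := fun x => iter (c x) (fun _ => f x) (g x))).
  by move=> x; case: (c x).
by apply: PR_iter => //; prt.
Qed.

Lemma PR_computable (g : nat -> nat) (f : A -> nat) :
  computable g -> PR f -> PR (fun x => g (f x)).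
Proof. by move=> hg hf; apply: PR_comp => //; exists g. Qed.

End Ifs.
#[global] Hint Resolve PR_isS PR_if : prdb.

Lemma PR_nat (g : nat -> nat) : PR g <-> computable g.
Proof.
split=> [[c h e]|h]; last by exists g.
by apply: computable_ext h => n; rewrite e.
Qed.

Section Matches.
Context {A : Type} {EA : Enc A}.

Lemma PR_omatch (B C : Type) {EB : Enc B} {EC : Enc C} (f : A -> option B)
    (h : A -> B -> C) (g : A -> C) :
  PR f -> PR (fun p => h p.1 p.2) -> PR g ->
  PR (fun x => match f x with Some b => h x b | None => g x end).
Proof.
move=> [cf /PR_nat hf ef] [ch /PR_nat hh eh] [cg /PR_nat hg eg].
exists (fun z => if 0 < cf z then ch (pr z (cf z).-1) else cg z).
  apply/PR_nat; apply: PR_if => //; first exact: PR_isS.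
  apply: (PR_comp hh); case: hf => c hc ec; exists (fun z => pr z (c z).-1).
    by apply: computable_pr; [exact: computable_id|exact: computable_comp computable_pred hc].
  by move=> a; rewrite ec.
move=> a; rewrite ef; case: (f a) => [b|] //=; first exact: (eh (a, b)).
Qed.

Lemma PR_Some (B : Type) {EB : Enc B} (f : A -> B) : PR f -> PR (fun x => Some (f x)).
Proof.
by move=> hf; case: (PR_succ (PR_en hf)) => c hc ec; exists c.
Qed.

Lemma PR_cons (B : Type) {EB : Enc B} (f : A -> B) (g : A -> seq B) :
  PR f -> PR g -> PR (fun x => f x :: g x).
Proof.
by move=> hf hg; case: (PR_Some (PR_pair hf hg)) => c hc ec; exists c.
Qed.

Lemma PR_smatch (B C : Type) {EB : Enc B} {EC : Enc C} (f : A -> seq B)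
    (g : A -> C) (h : A -> B -> seq B -> C) :
  PR f -> PR g -> PR (fun p => h p.1.1 p.1.2 p.2) ->
  PR (fun x => match f x with [::] => g x | b :: s => h x b s end).
Proof.
move=> hf hg hh.
have hf' : PR (fun x => if f x is b :: s then Some (b, s) else None).
  by case: hf => c hc ec; exists c => // a; rewrite ec; case: (f a).
apply: (PR_ext (f := fun x => match (if f x is b :: s then Some (b, s) else None) with
  | Some p => h x p.1 p.2 | None => g x end)).
  by move=> x; case: (f x).
apply: PR_omatch => //.
by apply: (PR_comp3 hh); prt.
Qed.

Lemma PR_nmatch (C : Type) {EC : Enc C} (f : A -> nat)
    (g : A -> C) (h : A -> nat -> C) :
  PR f -> PR g -> PR (fun p => h p.1 p.2) ->
  PR (fun x => match f x with 0 => g x | n.+1 => h x n end).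
Proof.
move=> hf hg hh.
have hf' : PR (fun x => if f x is n.+1 then Some n else None).
  by case: hf => c hc ec; exists c => // a; rewrite ec; case: (f a).
apply: PR_ext (PR_omatch hf' hh hg) => x; by case: (f x).
Qed.

End Matches.
#[global] Hint Resolve PR_omatch PR_Some PR_cons PR_smatch PR_nmatch : prdb.

Section Arith.
Context {A : Type} {EA : Enc A}.
Implicit Types f g : A -> nat.
Implicit Types p q : A -> bool.

Lemma PR_andb p q : PR p -> PR q -> PR (fun x => p x && q x).
Proof. by move=> hp hq; exact (PR_if hp hq (PR_const false)). Qed.

Lemma PR_negb p : PR p -> PR (fun x => ~~ p x).
Proof. by move=> hp; exact (PR_if hp (PR_const false) (PR_const true)). Qed.

Lemma PR_addb p q : PR p -> PR q -> PR (fun x => p x (+) q x).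
Proof.
move=> hp hq; apply: (PR_ext _ (PR_if hp (PR_negb hq) hq)) => x.
by case: (p x).
Qed.

Lemma PR_addn f g : PR f -> PR g -> PR (fun x => f x + g x).
Proof.
move=> hf hg; apply: (PR_ext (f := fun x => iter (f x) succn (g x))); last by prt.
by move=> x; rewrite iter_succn addnC.
Qed.

Lemma PR_subn f g : PR f -> PR g -> PR (fun x => f x - g x).
Proof.
move=> hf hg; apply: (PR_ext (f := fun x => iter (g x) predn (f x))); last by prt.
by move=> x; rewrite iter_predn.
Qed.

End Arith.
#[global] Hint Resolve PR_andb PR_negb PR_addb PR_addn PR_subn : prdb.

Section Arith2.
Context {A : Type} {EA : Enc A}.
Implicit Types f g : A -> nat.

Lemma PR_muln f g : PR f -> PR g -> PR (fun x => f x * g x).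
Proof.
move=> hf hg.
apply: (PR_ext (f := fun x => iter (f x) (fun n => g x + n) 0)).
  by move=> x; elim: (f x) => //= n ->.
by prt.
Qed.

Lemma PR_leq f g : PR f -> PR g -> PR (fun x => f x <= g x).
Proof.
move=> hf hg; apply: (PR_ext (f := fun x => ~~ (0 < f x - g x))); last by prt.
by move=> x; rewrite lt0n negbK.
Qed.

Lemma PR_eqn f g : PR f -> PR g -> PR (fun x => f x == g x).
Proof.
move=> hf hg; apply: (PR_ext (f := fun x => (f x <= g x) && (g x <= f x))); last exact: PR_andb (PR_leq _ _) (PR_leq _ _).
by move=> x; rewrite -eqn_leq.
Qed.

Lemma PR_eq (T : eqType) {ET : Enc T} (f g : A -> T) :
  PR f -> PR g -> PR (fun x => f x == g x).
Proof.
move=> hf hg; apply: (PR_ext (f := fun x => en (f x) == en (g x))); last exact: PR_eqn (PR_en _) (PR_en _).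
by move=> x; rewrite (inj_eq en_inj).
Qed.

End Arith2.
#[global] Hint Resolve PR_muln PR_leq PR_eqn : prdb.

Lemma PR_expn (A : Type) {EA : Enc A} (f g : A -> nat) :
  PR f -> PR g -> PR (fun x => f x ^ g x).
Proof.
move=> hf hg.
apply: (PR_ext (f := fun x => iter (g x) (fun n => f x * n) 1)).
  by move=> x; elim: (g x) => //= n ->; rewrite expnS.
by prt.
Qed.
#[global] Hint Resolve PR_expn : prdb.

(** * Folds and functions on lists *)

Section SeqPR.
Context {A B C : Type} {EA : Enc A} {EB : Enc B} {EC : Enc C}.

(** Idle once the list is used up, so that any sufficiently large number of rounds gives the
    fold. *)
Definition fold_step (h : C -> B -> C) (p : seq B * C) :=
  if p.1 is b :: s then (s, h p.2 b) else p.

Lemma iter_fold_step h n p : size p.1 <= n ->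
  (iter n (fold_step h) p).2 = foldl h p.2 p.1.
Proof.
have nil m c : iter m (fold_step h) ([::], c) = ([::], c) by elim: m => //= m ->.
elim: n p => [|n IH] [[|b s] c] //= sn; first by rewrite nil.
by rewrite -iterS iterSr IH.
Qed.

Lemma PR_foldl (h : A -> C -> B -> C) (b : A -> C) (l : A -> seq B) :
  PR (fun p => h p.1.1 p.1.2 p.2) -> PR b -> PR l ->
  PR (fun x => foldl (h x) (b x) (l x)).
Proof.
move=> hh hb hl.
apply: (PR_ext (f := fun x => (iter (en (l x)) (fold_step (h x)) (l x, b x)).2)).
  by move=> x; rewrite iter_fold_step ?size_le_en.
rewrite /fold_step; prt.
Qed.

End SeqPR.
#[global] Hint Resolve PR_foldl : prdb.

Section SeqPR2.
Context {A B : Type} {EA : Enc A} {EB : Enc B}.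
Implicit Types f g : A -> seq B.

Lemma PR_rev f : PR f -> PR (fun x => rev (f x)).
Proof.
move=> hf; apply: (PR_ext (f := fun x => foldl (fun s b => b :: s) [::] (f x))); last by prt.
move=> x; rewrite -[RHS]cats0 -catrevE; elim: (f x) [::] => //= b s IH t; exact: IH.
Qed.

End SeqPR2.
#[global] Hint Resolve PR_rev : prdb.

Section SeqPR3.
Context {A B C : Type} {EA : Enc A} {EB : Enc B} {EC : Enc C}.
Implicit Types f g : A -> seq B.

Lemma PR_foldr (h : A -> B -> C -> C) (b : A -> C) f :
  PR (fun p => h p.1.1 p.1.2 p.2) -> PR b -> PR f ->
  PR (fun x => foldr (h x) (b x) (f x)).
Proof.
move=> hh hb hl.
apply: (PR_ext (f := fun x => foldl (fun c a => h x a c) (b x) (rev (f x)))); last by prt.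
by move=> x; rewrite foldl_rev.
Qed.

End SeqPR3.
#[global] Hint Resolve PR_foldr : prdb.

Section SeqPR4.
Context {A B C : Type} {EA : Enc A} {EB : Enc B} {EC : Enc C}.
Implicit Types f g : A -> seq B.

Lemma PR_map (h : A -> B -> C) f :
  PR (fun p => h p.1 p.2) -> PR f -> PR (fun x => [seq h x b | b <- f x]).
Proof.
move=> hh hf.
by apply: (PR_ext (f := fun x => foldr (fun b t => h x b :: t) [::] (f x))); last by prt.
Qed.

Lemma PR_cat f g : PR f -> PR g -> PR (fun x => f x ++ g x).
Proof.
move=> hf hg.
apply: (PR_ext (f := fun x => foldr cons (g x) (f x))); last by prt.
by move=> x; elim: (f x) => //= b s ->.
Qed.

Lemma PR_all (p : A -> B -> bool) f :
  PR (fun p' => p p'.1 p'.2) -> PR f -> PR (fun x => all (p x) (f x)).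
Proof.
move=> hp hf.
by apply: (PR_ext (f := fun x => foldr (fun b t => p x b && t) true (f x))); last by prt.
Qed.

Lemma PR_size f : PR f -> PR (fun x => size (f x)).
Proof.
move=> hf.
by apply: (PR_ext (f := fun x => foldr (fun b n => n.+1) 0 (f x))); last by prt.
Qed.

Lemma PR_behead f : PR f -> PR (fun x => behead (f x)).
Proof. by move=> hf; rewrite /behead; prt. Qed.

Lemma PR_head (d : A -> B) f : PR d -> PR f -> PR (fun x => head (d x) (f x)).
Proof. by move=> hd hf; rewrite /head; prt. Qed.

Lemma PR_nseq (n : A -> nat) (b : A -> B) : PR n -> PR b -> PR (fun x => nseq (n x) (b x)).
Proof.
move=> hn hb.
by apply: (PR_ext (f := fun x => iter (n x) (fun s => b x :: s) [::])); last by prt.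
Qed.

End SeqPR4.
#[global] Hint Resolve PR_map PR_cat PR_all PR_size PR_behead PR_head PR_nseq : prdb.

Section SeqPR5.
Context {A B C : Type} {EA : Enc A} {EB : Enc B} {EC : Enc C}.
Implicit Types f g : A -> seq B.

Lemma PR_nth (d : A -> B) f (n : A -> nat) :
  PR d -> PR f -> PR n -> PR (fun x => nth (d x) (f x) (n x)).
Proof.
move=> hd hf hn.
apply: (PR_ext (f := fun x => head (d x) (iter (n x) behead (f x)))); last by prt.
move=> x; elim: (n x) (f x) => [|m IH] [|b s] //=; last by rewrite -iterS iterSr IH.
by rewrite -iterS iterSr /= IH nth_nil.
Qed.

Lemma PR_rcons f (b : A -> B) : PR f -> PR b -> PR (fun x => rcons (f x) (b x)).
Proof.
move=> hf hb; apply: (PR_ext (f := fun x => f x ++ [:: b x])); last by prt.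
by move=> x; rewrite cats1.
Qed.

Lemma PR_flatten (f : A -> seq (seq B)) : PR f -> PR (fun x => flatten (f x)).
Proof. by move=> hf; rewrite /flatten; prt. Qed.

End SeqPR5.
#[global] Hint Resolve PR_nth PR_rcons PR_flatten : prdb.

Lemma PR_iota (A : Type) {EA : Enc A} (m n : A -> nat) :
  PR m -> PR n -> PR (fun x => iota (m x) (n x)).
Proof.
move=> hm hn.
apply: (PR_ext (f := fun x => iter (n x) (fun s => rcons s (m x + size s)) [::])); last by prt.
move=> x; have -> : forall k, iter k (fun s => rcons s (m x + size s)) [::] = iota (m x) k => //.
by elim=> // k; rewrite iterS => ->; rewrite size_iota -addn1 iotaD cats1.
Qed.
#[global] Hint Resolve PR_iota : prdb.

(** A finite function becomes computable as a constant table; this is how an arbitrary [tm_delta]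
    will be simulated. *)
Definition lookup (K V : Type) {EK : Enc K} (tbl : seq (K * V)) (k : K) : option V :=
  foldr (fun kv r => if en k == en kv.1 then Some kv.2 else r) None tbl.

Lemma PR_lookup (A K V : Type) {EA : Enc A} {EK : Enc K} {EV : Enc V}
    (tbl : seq (K * V)) (k : A -> K) : PR k -> PR (fun x => lookup tbl (k x)).
Proof.
move=> hk; rewrite /lookup.
by have := PR_const (A := A) tbl; prt.
Qed.
#[global] Hint Resolve PR_lookup : prdb.

Lemma lookup_map (T : eqType) (K V : Type) {EK : Enc K} (key : T -> K) (v : T -> V) (s : seq T) t :
  injective key -> t \in s -> lookup [seq (key u, v u) | u <- s] (key t) = Some (v t).
Proof.
move=> ik; elim: s => //= u s IH; rewrite inE.
have -> : (en (key t) == en (key u)) = (t == u) by apply: (inj_eq (inj_comp en_inj ik)).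
by case: eqP => [-> //|_] /=.
Qed.

Lemma PR_eq_bits (A : Type) {EA : Enc A} (f g : A -> seq bool) :
  PR f -> PR g -> PR (fun x => f x == g x).
Proof. exact: PR_eq. Qed.
#[global] Hint Extern 2 (PR (fun _ => @eq_op ?T _ _)) =>
  let T := eval hnf in (Equality.sort T) in match T with seq _ => apply PR_eq_bits end : prdb.

Class PRadd {V : nmodType} {EV : Enc V} : Prop := pradd : PR (fun p : V * V => (p.1 + p.2)%R).

Section Sums.
Context {A : Type} {EA : Enc A} {V : nmodType} {EV : Enc V} {HV : @PRadd V EV}.

Lemma PR_addr (f g : A -> V) : PR f -> PR g -> PR (fun x => (f x + g x)%R).
Proof. by move=> hf hg; apply: (PR_comp2 HV). Qed.

End Sums.
Section Sums2.
Context {A : Type} {EA : Enc A} {V : nmodType} {EV : Enc V} {HV : @PRadd V EV}.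

#[local] Hint Resolve PR_addr : prdb.

Lemma PR_sum_seq (B : Type) {EB : Enc B} (l : A -> seq B) (F : A -> B -> V) :
  PR l -> PR (fun p => F p.1 p.2) -> PR (fun x => (\sum_(b <- l x) F x b)%R).
Proof.
move=> hl hF.
apply: (PR_ext (f := fun x => foldr (fun b v => (F x b + v)%R) 0%R (l x))); last first.
  by apply: PR_foldr; prt.
by move=> x; elim: (l x) => [|b s IH] /=; rewrite ?big_nil // big_cons IH.
Qed.

Lemma PR_sum_ord (n : A -> nat) (F : A -> nat -> V) :
  PR n -> PR (fun p => F p.1 p.2) -> PR (fun x => (\sum_(i < n x) F x i)%R).
Proof.
move=> hn hF; apply: (PR_ext (f := fun x => (\sum_(i <- iota 0 (n x)) F x i)%R)).
  by move=> x; rewrite -(big_mkord xpredT (F x)) /index_iota subn0.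
by apply: PR_sum_seq => //; prt.
Qed.

End Sums2.

Section DivPR.
Context {A : Type} {EA : Enc A}.
Implicit Types f g : A -> nat.

(** The counter grows while the next multiple of the divisor still fits. The quotient is at most
    [f x], so [f x] rounds suffice; divisor 0 leaves it at 0. *)
Lemma PR_divn f g : PR f -> PR g -> PR (fun x => f x %/ g x).
Proof.
move=> hf hg; pose s m d q := if (0 < d) && (q.+1 * d <= m) then q.+1 else q.
apply: (PR_ext (f := fun x => iter (f x) (s (f x) (g x)) 0)); last by rewrite /s; prt.
move=> x; move: (f x) (g x) => m d.
have H k : k <= m -> iter k (s m d) 0 = minn k (m %/ d).
  elim: k => [|k IH] km /=; first by rewrite min0n.
  rewrite IH ?(ltnW km) // /s; case: (posnP d) => [->|d0] /=; first by rewrite divn0 !minn0.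
  by rewrite -leq_divRL //; case: ifP; lia.
by rewrite H // (minn_idPr _) // leq_div.
Qed.

End DivPR.
#[global] Hint Resolve PR_divn : prdb.

Lemma PR_modn (A : Type) {EA : Enc A} (f g : A -> nat) :
  PR f -> PR g -> PR (fun x => f x %% g x).
Proof.
move=> hf hg; apply: (PR_ext (f := fun x => f x - f x %/ g x * g x)); last by prt.
by move=> x; rewrite {1}(divn_eq (f x) (g x)) addKn.
Qed.
#[global] Hint Resolve PR_modn : prdb.

(** Euclid's algorithm: the first component falls in every round until it is 0, so [f x] rounds
    suffice. *)
Lemma PR_gcdn (A : Type) {EA : Enc A} (f g : A -> nat) :
  PR f -> PR g -> PR (fun x => gcdn (f x) (g x)).
Proof.
move=> hf hg; pose s (p : nat * nat) := if p.1 == 0 then p else (p.2 %% p.1, p.1).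
apply: (PR_ext (f := fun x => (iter (f x) s (f x, g x)).2)); last by rewrite /s; prt.
move=> x; move: (f x) (g x) => m n.
suff H k p : p.1 <= k -> (iter k s p).2 = gcdn p.1 p.2 by rewrite H.
elim: k p => [|k IH] [a b] /= ak; first by rewrite (_ : a = 0) ?gcd0n //; lia.
rewrite -iterS iterSr {2}/s /=; case: eqP => [->|/eqP a0].
  by rewrite IH.
rewrite IH /= ?[RHS]gcdnE ?(negbTE a0) //.
by have := ltn_pmod b (_ : 0 < a); lia.
Qed.
#[global] Hint Resolve PR_gcdn : prdb.

(** * Integers, rationals and Gaussian rationals *)

Definition en_int (z : int) := en ((z < 0)%R, `|z|%N).
Lemma en_int_inj : injective en_int.
Proof.
move=> x y e; have [] : ((x < 0)%R, `|x|%N) = ((y < 0)%R, `|y|%N) by apply: en_inj.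
by lia.
Qed.
#[global] Instance Enc_int : Enc int := {| en := en_int; en_inj := en_int_inj |}.

Section IntPR.
Context {A : Type} {EA : Enc A}.
Implicit Types f g : A -> int.

Lemma PR_int_lt0 f : PR f -> PR (fun x => (f x < 0)%R).
Proof.
move=> [c hc ec]; exists (lft \o c); first exact: computable_comp computable_lft hc.
by move=> a; rewrite /= ec lft_pr.
Qed.

Lemma PR_absz f : PR f -> PR (fun x => `|f x|%N).
Proof.
move=> [c hc ec]; exists (rgt \o c); first exact: computable_comp computable_rgt hc.
by move=> a; rewrite /= ec rgt_pr.
Qed.

Lemma PR_int_code f : PR (fun x => ((f x < 0)%R, `|f x|%N)) -> PR f.
Proof. by []. Qed.

Lemma PR_int_diff (m n : A -> nat) : PR m -> PR n -> PR (fun x => ((m x)%:Z - (n x)%:Z)%R).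
Proof.
move=> hm hn; apply: PR_int_code.
apply: (PR_ext (f := fun x => (m x < n x, (m x - n x) + (n x - m x)))); last by prt.
by move=> x; congr (_, _); lia.
Qed.

Lemma PR_Posz (m : A -> nat) : PR m -> PR (fun x => Posz (m x)).
Proof.
move=> hm; apply: PR_int_code.
by apply: (PR_ext (f := fun x => (false, m x))); last by prt.
Qed.

End IntPR.
#[global] Hint Resolve PR_Posz PR_absz PR_int_diff : prdb.
#[global] Hint Extern 2 (PR (fun _ => @Order.lt _ ?P _ _)) =>
  let T := constr:(Order.Preorder.sort P) in
  let T := eval hnf in T in match T with int => apply PR_int_lt0 end : prdb.

Section IntPR2.
Context {A : Type} {EA : Enc A}.
Implicit Types f g : A -> int.

Definition zpos (z : int) := if (z < 0)%R then 0 else `|z|%N.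
Definition zneg (z : int) := if (z < 0)%R then `|z|%N else 0.
Lemma zposneg z : z = ((zpos z)%:Z - (zneg z)%:Z)%R.
Proof. by rewrite /zpos /zneg; case: ifP; lia. Qed.

Lemma PR_addz f g : PR f -> PR g -> PR (fun x => (f x + g x)%R).
Proof.
move=> hf hg.
apply: (PR_ext (f := fun x => ((zpos (f x) + zpos (g x))%N%:Z - (zneg (f x) + zneg (g x))%N%:Z)%R));
  last by rewrite /zpos /zneg; prt.
by move=> x; rewrite [in RHS](zposneg (f x)) [in RHS](zposneg (g x)) !PoszD; ring.
Qed.

Lemma PR_oppz f : PR f -> PR (fun x => (- f x)%R).
Proof.
move=> hf.
apply: (PR_ext (f := fun x => ((zneg (f x))%:Z - (zpos (f x))%:Z)%R));
  last by rewrite /zpos /zneg; prt.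
by move=> x; rewrite [in RHS](zposneg (f x)) opprB.
Qed.

Lemma PR_mulz f g : PR f -> PR g -> PR (fun x => (f x * g x)%R).
Proof.
move=> hf hg.
apply: (PR_ext (f := fun x => ((zpos (f x) * zpos (g x) + zneg (f x) * zneg (g x))%N%:Z
    - (zpos (f x) * zneg (g x) + zneg (f x) * zpos (g x))%N%:Z)%R));
  last by rewrite /zpos /zneg; prt.
move=> x; rewrite [in RHS](zposneg (f x)) [in RHS](zposneg (g x)).
by rewrite !PoszD !PoszM; ring.
Qed.

Lemma PR_eq_int f g : PR f -> PR g -> PR (fun x => f x == g x).
Proof. exact: PR_eq. Qed.

End IntPR2.
#[global] Hint Extern 2 (PR (fun _ => @eq_op ?T _ _)) =>
  let T := eval hnf in (Equality.sort T) in match T with int => apply PR_eq_int end : prdb.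

(* Ring operations are dispatched on the normal form of their type: trying the
   lemmas in turn makes the unifier unfold one arithmetic into another. *)
#[global] Hint Extern 2 (@PR _ ?B _ _ (fun _ => (_ + _)%R)) =>
  let T := eval hnf in B in match T with int => apply PR_addz end : prdb.
#[global] Hint Extern 2 (@PR _ ?B _ _ (fun _ => (_ * _)%R)) =>
  let T := eval hnf in B in match T with int => apply PR_mulz end : prdb.
#[global] Hint Extern 2 (@PR _ ?B _ _ (fun _ => (- _)%R)) =>
  let T := eval hnf in B in match T with int => apply PR_oppz end : prdb.

Definition en_rat (q : rat) := en (numq q, denq q).
Lemma en_rat_inj : injective en_rat.
Proof.
move=> x y e; have [h1 h2] : (numq x, denq x) = (numq y, denq y) by apply: en_inj.
by rewrite -[x]divq_num_den -[y]divq_num_den h1 h2.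
Qed.
#[global] Instance Enc_rat : Enc rat := {| en := en_rat; en_inj := en_rat_inj |}.

Section RatPR.
Context {A : Type} {EA : Enc A}.

Lemma PR_numq (f : A -> rat) : PR f -> PR (fun x => numq (f x)).
Proof.
move=> [c hc ec]; exists (lft \o c); first exact: computable_comp computable_lft hc.
by move=> a; rewrite /= ec lft_pr.
Qed.

Lemma PR_denq (f : A -> rat) : PR f -> PR (fun x => denq (f x)).
Proof.
move=> [c hc ec]; exists (rgt \o c); first exact: computable_comp computable_rgt hc.
by move=> a; rewrite /= ec rgt_pr.
Qed.

Lemma PR_rat_code (f : A -> rat) : PR (fun x => (numq (f x), denq (f x))) -> PR f.
Proof. by []. Qed.

Definition sgnz (b : bool) (n : nat) : int := if b then (0%N%:Z - n%:Z)%R else (n%:Z - 0%N%:Z)%R.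

Lemma PR_fracq (f g : A -> int) : PR f -> PR g -> PR (fun x => fracq (f x, g x)).
Proof.
move=> hf hg; apply: PR_rat_code.
pose q (f g : int) := `|f| %/ gcdn `|f| `|g|.
apply: (PR_ext (f := fun x =>
  (if g x == 0%R then (0%N%:Z - 0%N%:Z)%R else sgnz ((g x < 0)%R (+) (f x < 0)%R) (q (f x) (g x)),
   if g x == 0%R then (1%N%:Z - 0%N%:Z)%R
   else ((`|g x| %/ gcdn `|f x| `|g x|)%N%:Z - 0%N%:Z)%R))); last by rewrite /sgnz /q; prt.
move=> x; rewrite num_fracq den_fracq /= /sgnz /q; case: eqP => [->|/eqP g0] //=.
rewrite !subr0; congr (_, _).
by case: (_ (+) _); rewrite ?expr1z ?expr0z; ring.
Qed.

End RatPR.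
#[global] Hint Resolve PR_numq PR_denq PR_fracq : prdb.

Section RatPR2.
Context {A : Type} {EA : Enc A}.
Implicit Types f g : A -> rat.

Lemma PR_addq f g : PR f -> PR g -> PR (fun x => (f x + g x)%R).
Proof.
move=> hf hg.
apply: (PR_ext (f := fun x => fracq (numq (f x) * denq (g x) + numq (g x) * denq (f x),
   denq (f x) * denq (g x))%R)); last by prt.
move=> x; rewrite fracqE /= -[in RHS](divq_num_den (f x)) -[in RHS](divq_num_den (g x)).
have := denq_neq0 (f x); have := denq_neq0 (g x).
rewrite -!(intr_eq0 rat) rmorphD !rmorphM /= => h1 h2; field.
by rewrite h1 h2.
Qed.

Lemma PR_mulq f g : PR f -> PR g -> PR (fun x => (f x * g x)%R).
Proof.
move=> hf hg.
apply: (PR_ext (f := fun x => fracq (numq (f x) * numq (g x),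
   denq (f x) * denq (g x))%R)); last by prt.
move=> x; rewrite fracqE /= -[in RHS](divq_num_den (f x)) -[in RHS](divq_num_den (g x)).
by rewrite !rmorphM /= invfM; ring.
Qed.

Lemma PR_oppq f : PR f -> PR (fun x => (- f x)%R).
Proof.
move=> hf.
apply: (PR_ext (f := fun x => fracq (- numq (f x), denq (f x))%R)); last by prt.
move=> x; rewrite fracqE /= -[in RHS](divq_num_den (f x)).
by rewrite rmorphN /= mulNr.
Qed.

Lemma PR_invq f : PR f -> PR (fun x => (f x)^-1%R).
Proof.
move=> hf.
apply: (PR_ext (f := fun x => fracq (denq (f x), numq (f x))%R)); last by prt.
by move=> x; rewrite fracqE /= -[in RHS](divq_num_den (f x)) invfM invrK mulrC.
Qed.

Lemma PR_natq (f : A -> nat) : PR f -> PR (fun x => (f x)%:R%R : rat).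
Proof.
move=> hf.
apply: (PR_ext (f := fun x => fracq ((f x)%:Z, 1)%R)); last by prt.
by move=> x; rewrite fracqE /= divr1.
Qed.

End RatPR2.
#[global] Hint Extern 2 (@PR _ ?B _ _ (fun _ => (_ + _)%R)) =>
  let T := eval hnf in B in match T with rat => apply PR_addq end : prdb.
#[global] Hint Extern 2 (@PR _ ?B _ _ (fun _ => (_ * _)%R)) =>
  let T := eval hnf in B in match T with rat => apply PR_mulq end : prdb.
#[global] Hint Extern 2 (@PR _ ?B _ _ (fun _ => (- _)%R)) =>
  let T := eval hnf in B in match T with rat => apply PR_oppq end : prdb.
#[global] Hint Extern 2 (@PR _ ?B _ _ (fun _ => (_^-1)%R)) =>
  let T := eval hnf in B in match T with rat => apply PR_invq end : prdb.
#[global] Hint Extern 2 (@PR _ ?B _ _ (fun _ => (_%:R)%R)) =>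
  let T := eval hnf in B in match T with rat => apply PR_natq end : prdb.

#[global] Instance PRadd_rat : @PRadd rat Enc_rat.
Proof. by apply: PR_addq; prt. Qed.
Section RatPR3.
Context {A : Type} {EA : Enc A}.
Implicit Types f g : A -> rat.

Lemma PR_leq_rat f g : PR f -> PR g -> PR (fun x => (f x <= g x)%R).
Proof.
move=> hf hg; apply: (PR_ext (f := fun x => ~~ (numq (g x + - f x) < 0)%R)); last by prt.
by move=> x; rewrite numq_lt0 -leNgt subr_ge0.
Qed.

Lemma PR_ltq_rat f g : PR f -> PR g -> PR (fun x => (f x < g x)%R).
Proof.
move=> hf hg; apply: (PR_ext (f := fun x => (numq (f x + - g x) < 0)%R)); last by prt.
by move=> x; rewrite numq_lt0 subr_lt0.
Qed.

Lemma PR_eq_rat f g : PR f -> PR g -> PR (fun x => f x == g x).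
Proof. exact: PR_eq. Qed.

End RatPR3.
#[global] Hint Extern 2 (PR (fun _ => @eq_op ?T _ _)) =>
  let T := eval hnf in (Equality.sort T) in match T with rat => apply PR_eq_rat end : prdb.
#[global] Hint Extern 2 (PR (fun _ => @Order.le _ ?P _ _)) =>
  let T := constr:(Order.Preorder.sort P) in
  let T := eval hnf in T in match T with rat => apply PR_leq_rat end : prdb.
#[global] Hint Extern 2 (PR (fun _ => @Order.lt _ ?P _ _)) =>
  let T := constr:(Order.Preorder.sort P) in
  let T := eval hnf in T in match T with rat => apply PR_ltq_rat end : prdb.

Definition en_cpx (z : gq) := en (complex.Re z, complex.Im z).
Lemma en_cpx_inj : injective en_cpx.
Proof.
move=> [a b] [c d] e.
by have [-> ->] : (a, b) = (c, d) by apply: en_inj.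
Qed.
#[global] Instance Enc_cpx : Enc gq := {| en := en_cpx; en_inj := en_cpx_inj |}.

Section CpxPR.
Context {A : Type} {EA : Enc A}.

Lemma PR_Re (f : A -> gq) : PR f -> PR (fun x => complex.Re (f x)).
Proof.
move=> [c hc ec]; exists (lft \o c); first exact: computable_comp computable_lft hc.
by move=> a; rewrite /= ec lft_pr.
Qed.

Lemma PR_Im (f : A -> gq) : PR f -> PR (fun x => complex.Im (f x)).
Proof.
move=> [c hc ec]; exists (rgt \o c); first exact: computable_comp computable_rgt hc.
by move=> a; rewrite /= ec rgt_pr.
Qed.

Lemma PR_Complex (f g : A -> rat) : PR f -> PR g -> PR (fun x => Complex (f x) (g x)).
Proof. by move=> hf hg; case: (PR_pair hf hg) => c hc ec; exists c. Qed.

End CpxPR.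
#[global] Hint Extern 2 (PR (fun _ => complex.Re _)) => apply PR_Re : prdb.
#[global] Hint Extern 2 (PR (fun _ => complex.Im _)) => apply PR_Im : prdb.
#[global] Hint Extern 2 (PR (fun _ => Complex _ _)) => apply PR_Complex : prdb.

Section CpxPR2.
Context {A : Type} {EA : Enc A}.
Implicit Types f g : A -> gq.

Lemma PR_addc f g : PR f -> PR g -> PR (fun x => (f x + g x)%R).
Proof.
move=> hf hg; apply: (PR_ext (f := fun x => Complex (complex.Re (f x) + complex.Re (g x))%R
  (complex.Im (f x) + complex.Im (g x))%R)); last by prt.
by move=> x; case: (f x) (g x) => a b [c d].
Qed.

Lemma PR_mulc f g : PR f -> PR g -> PR (fun x => (f x * g x)%R).
Proof.
move=> hf hg; apply: (PR_ext (f := fun x => Complex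
  (complex.Re (f x) * complex.Re (g x) + - (complex.Im (f x) * complex.Im (g x)))%R
  (complex.Re (f x) * complex.Im (g x) + complex.Im (f x) * complex.Re (g x))%R)); last by prt.
by move=> x; case: (f x) (g x) => a b [c d].
Qed.

Lemma PR_conjc f : PR f -> PR (fun x => conjc (f x)).
Proof.
move=> hf; apply: (PR_ext (f := fun x => Complex (complex.Re (f x)) (- complex.Im (f x))%R)); last by prt.
by move=> x; case: (f x).
Qed.

Lemma PR_eq_cpx f g : PR f -> PR g -> PR (fun x => f x == g x).
Proof. exact: PR_eq. Qed.

End CpxPR2.
#[global] Hint Extern 2 (PR (fun _ => @eq_op ?T _ _)) =>
  let T := eval hnf in (Equality.sort T) in match T with complex _ => apply PR_eq_cpx end : prdb.
#[global] Hint Extern 2 (@PR _ ?B _ _ (fun _ => (_ + _)%R)) =>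
  let T := eval hnf in B in match T with complex _ => apply PR_addc end : prdb.
#[global] Hint Extern 2 (@PR _ ?B _ _ (fun _ => (_ * _)%R)) =>
  let T := eval hnf in B in match T with complex _ => apply PR_mulc end : prdb.
#[global] Hint Extern 2 (PR (fun _ => conjc _)) => apply PR_conjc : prdb.

#[global] Instance PRadd_cpx : @PRadd gq Enc_cpx.
Proof. by apply: PR_addc; prt. Qed.

(* Stated at each concrete type, so that no unification between different
   presentations of its additive structure is needed. *)
Section SumInstances.
Context {A : Type} {EA : Enc A} (n : A -> nat).

Lemma PR_sum_ord_rat (F : A -> nat -> rat) :
  PR n -> PR (fun p => F p.1 p.2) -> PR (fun x => (\sum_(i < n x) F x i)%R).
Proof. move=> hn hF; exact (@PR_sum_ord A EA rat Enc_rat PRadd_rat n F hn hF). Qed.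

Lemma PR_sum_ord_cpx (F : A -> nat -> gq) :
  PR n -> PR (fun p => F p.1 p.2) -> PR (fun x => (\sum_(i < n x) F x i)%R).
Proof. move=> hn hF; exact (@PR_sum_ord A EA gq Enc_cpx PRadd_cpx n F hn hF). Qed.

Context {B : Type} {EB : Enc B} (l : A -> seq B).

Lemma PR_sum_seq_rat (F : A -> B -> rat) :
  PR l -> PR (fun p => F p.1 p.2) -> PR (fun x => (\sum_(b <- l x) F x b)%R).
Proof. move=> hl hF; exact (@PR_sum_seq A EA rat Enc_rat PRadd_rat B EB l F hl hF). Qed.

Lemma PR_sum_seq_cpx (F : A -> B -> gq) :
  PR l -> PR (fun p => F p.1 p.2) -> PR (fun x => (\sum_(b <- l x) F x b)%R).
Proof. move=> hl hF; exact (@PR_sum_seq A EA gq Enc_cpx PRadd_cpx B EB l F hl hF). Qed.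

End SumInstances.
#[global] Hint Extern 2 (@PR _ ?B _ _ (fun _ => \big[_/_]_(_ <- _) _)) =>
  let T := eval hnf in B in match T with
  | rat => apply PR_sum_seq_rat | complex _ => apply PR_sum_seq_cpx end : prdb.

(** * Decoding *)

(** Allows a search over [A] by running through all numbers; [de] is total and may be anything on
    numbers that are not codes. *)
Class Decodable (A : Type) {EA : Enc A} := {
  de : nat -> A;
  deK : forall a, de (en a) = a;
  PR_de0 : PR de }.

Lemma PR_de (A B : Type) {EA : Enc A} {EB : Enc B} {DA : @Decodable A EA} (f : B -> nat) :
  PR f -> PR (fun x => de (f x) : A).
Proof. by move=> hf; apply: PR_comp => //; exact: PR_de0. Qed.
#[global] Hint Resolve PR_de : prdb.

Lemma PR_lft (A : Type) {EA : Enc A} (f : A -> nat) : PR f -> PR (fun x => lft (f x)).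
Proof. by apply: PR_computable; exact: computable_lft. Qed.
Lemma PR_rgt (A : Type) {EA : Enc A} (f : A -> nat) : PR f -> PR (fun x => rgt (f x)).
Proof. by apply: PR_computable; exact: computable_rgt. Qed.
#[global] Hint Resolve PR_lft PR_rgt : prdb.

#[global] Instance Dec_nat : @Decodable nat _ := {| de := id; deK := fun=> erefl; PR_de0 := PR_id |}.

Lemma PR_posb : PR (fun n => 0 < n). Proof. by prt. Qed.
#[global] Instance Dec_bool : @Decodable bool _ :=
  {| de := fun n => 0 < n; deK := fun b => if b is true then erefl else erefl; PR_de0 := PR_posb |}.

Section DecInstances.
Context {A B : Type} {EA : Enc A} {EB : Enc B} {DA : @Decodable A EA} {DB : @Decodable B EB}.

Definition de_prod n : A * B := (de (lft n), de (rgt n)).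
Lemma de_prodK p : de_prod (en p) = p.
Proof. by case: p => a b; rewrite /de_prod /= /en_prod lft_pr rgt_pr !deK. Qed.
Lemma PR_de_prod : PR de_prod.
Proof. by rewrite /de_prod; prt. Qed.
#[global] Instance Dec_prod : @Decodable (A * B) _ :=
  {| de := de_prod; deK := de_prodK; PR_de0 := PR_de_prod |}.

Definition de_seq_step (p : nat * seq A) :=
  if p.1 is m.+1 then (rgt m, de (lft m) :: p.2) else p.

Lemma de_seq_stepP n (s t : seq A) : size s <= n ->
  (iter n de_seq_step (en s, t)).2 = catrev s t.
Proof.
have nil m u : iter m de_seq_step (0, u) = (0, u) by elim: m => //= m ->.
elim: n s t => [|n IH] [|a s] t //= sn; first by rewrite nil.
by rewrite -iterS iterSr {2}/de_seq_step /= lft_pr rgt_pr deK IH.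
Qed.

Definition de_seq n : seq A := rev (iter n de_seq_step (n, [::])).2.
Lemma de_seqK s : de_seq (en s) = s.
Proof. by rewrite /de_seq (@de_seq_stepP (en s) s [::] (size_le_en s)) catrevE cats0 revK. Qed.
Lemma PR_de_seq : PR de_seq.
Proof. by rewrite /de_seq /de_seq_step; prt. Qed.
#[global] Instance Dec_seq : @Decodable (seq A) _ :=
  {| de := de_seq; deK := de_seqK; PR_de0 := PR_de_seq |}.

End DecInstances.

Definition de_int n := let p := de n : bool * nat in
  ((if p.1 then 0%N else p.2)%:Z - (if p.1 then p.2 else 0%N)%:Z)%R.
Lemma de_intK (z : int) : de_int (en z) = z.
Proof.
rewrite /de_int -[en z]/(en ((z < 0)%R, `|z|%N)) (@deK (bool * nat)) /=.
by case: ltrP; lia.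
Qed.
Lemma PR_de_int : PR de_int.
Proof. by apply: PR_int_diff; prt. Qed.
#[global] Instance Dec_int : @Decodable int _ :=
  {| de := de_int; deK := de_intK; PR_de0 := PR_de_int |}.

Definition de_rat n := let p := de n : int * int in fracq (p.1, p.2).
Lemma de_ratK (q : rat) : de_rat (en q) = q.
Proof.
by rewrite /de_rat -[en q]/(en (numq q, denq q)) (@deK (int * int)) fracqE divq_num_den.
Qed.
Lemma PR_de_rat : PR de_rat.
Proof. by apply: PR_fracq; prt. Qed.
#[global] Instance Dec_rat : @Decodable rat _ :=
  {| de := de_rat; deK := de_ratK; PR_de0 := PR_de_rat |}.

Definition de_cpx n := let p := de n : rat * rat in Complex p.1 p.2.
Lemma de_cpxK (z : gq) : de_cpx (en z) = z.
Proof.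
rewrite /de_cpx -[en z]/(en (complex.Re z, complex.Im z)) (@deK (rat * rat)).
by case: z.
Qed.
Lemma PR_de_cpx : PR de_cpx.
Proof. by apply: PR_Complex; prt. Qed.
#[global] Instance Dec_cpx : @Decodable gq _ :=
  {| de := de_cpx; deK := de_cpxK; PR_de0 := PR_de_cpx |}.

(** * Compilation of counter programs to Turing machines *)

Inductive aop :=
  OInc of nat | ODec of nat | ORead of bool & nat | OWrite of bool | OTest of nat.

Definition do_op (o : aop) (x : cstate) : cstate :=
  let: (s, io) := x in
  match o with
  | OInc r => (upd s r (s r).+1, io)
  | ODec r => (upd s r (s r).-1, io)
  | ORead i r => (upd (upd s r (s r + (chan_in i io != [::]))) r.+1
         (s r.+1 + head false (chan_in i io)), chan_drop i io)
  | OWrite b => (s, chan_write b io)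
  | OTest _ => x
  end.

Definition test_op (o : aop) (x : cstate) : bool :=
  if o is OTest r then x.1 r == 0 else false.

Fixpoint cst (c : cmd) : finType :=
  match c with
  | Seq c1 c2 => (cst c1 + cst c2)%type
  | If _ c1 c2 => option (cst c1 + cst c2)
  | Loop _ c => option (cst c)
  | _ => unit
  end.

(** The states [cst c] are the control points of the flow graph of [c]: one for each primitive and
    one for each test of an [If] or a [Loop]. *)
Fixpoint entry (c : cmd) : cst c :=
  match c with
  | Seq c1 c2 => inl (entry c1)
  | If _ c1 c2 => None
  | Loop _ c => None
  | _ => tt
  end.

Fixpoint op (c : cmd) : cst c -> aop :=
  match c with
  | Inc r => fun _ => OInc r
  | Dec r => fun _ => ODec r
  | Read i r => fun _ => ORead i r
  | Write b => fun _ => OWrite b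
  | Seq c1 c2 => fun q => match q with inl q => op q | inr q => op q end
  | If r c1 c2 => fun q => match q with
      | None => OTest r | Some (inl q) => op q | Some (inr q) => op q end
  | Loop r c => fun q => if q is Some q then op q else OTest r
  end.

(** [None] means that the program is left. In the [Loop] case the exit [None] of the body turns into
    [Some None], which is the loop test. *)
Fixpoint nxt (c : cmd) : cst c -> bool -> option (cst c) :=
  match c with
  | Seq c1 c2 => fun q b => match q with
      | inl q => if nxt q b is Some q' then Some (inl q') else Some (inr (entry c2))
      | inr q => omap inr (nxt q b) end
  | If r c1 c2 => fun q b => match q with
      | None => Some (Some (if b then inr (entry c2) else inl (entry c1)))
      | Some (inl q) => omap (Some \o inl) (nxt q b)
      | Some (inr q) => omap (Some \o inr) (nxt q b) end
  | Loop r c => fun q b => match q with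
      | None => if b then None else Some (Some (entry c))
      | Some q => Some (nxt q b) end
  | _ => fun _ _ => None
  end.

Inductive reach (c : cmd) : nat -> option (cst c) * cstate -> option (cst c) * cstate -> Prop :=
  | Reach0 x : reach 0 x x
  | ReachS n q x y : reach n (nxt q (test_op (op q) x), do_op (op q) x) y ->
      reach n.+1 (Some q, x) y.

Lemma reach_trans c m n x y z : @reach c m x y -> reach n y z -> reach (m + n) x z.
Proof. by elim=> // {}m q s t _ IH h; apply: ReachS; exact: IH. Qed.

(** A run of a subprogram is a run of the whole program when its flow graph embeds; [f] also says
    where the exit of the subprogram leads. *)
Lemma reach_lift c1 c (f : option (cst c1) -> option (cst c)) n x y :
  (forall q, exists2 q', f (Some q) = Some q' &
     op q' = op q /\ forall b, nxt q' b = f (nxt q b)) ->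
  reach n x y -> reach n (f x.1, x.2) (f y.1, y.2).
Proof.
move=> hf; elim=> [ [u s]|{}n q s t _ IH]; first exact: Reach0.
rewrite /=; have [q' -> [ho hn]] := hf q.
by apply: ReachS; rewrite ho hn.
Qed.

Definition lift_seq1 c1 c2 (o : option (cst c1)) : option (cst (Seq c1 c2)) :=
  if o is Some q then Some (inl q) else Some (inr (entry c2)).
Definition lift_seq2 c1 c2 (o : option (cst c2)) : option (cst (Seq c1 c2)) := omap inr o.
Definition lift_if1 r c1 c2 (o : option (cst c1)) : option (cst (If r c1 c2)) :=
  omap (Some \o inl) o.
Definition lift_if2 r c1 c2 (o : option (cst c2)) : option (cst (If r c1 c2)) :=
  omap (Some \o inr) o.
Definition lift_loop r c (o : option (cst c)) : option (cst (Loop r c)) := Some o.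

Lemma reach_seq1 c1 c2 n x y : reach n x y ->
  reach n (@lift_seq1 c1 c2 x.1, x.2) (lift_seq1 c2 y.1, y.2).
Proof. by apply: reach_lift => q; eexists; first by []. Qed.
Lemma reach_seq2 c1 c2 n x y : reach n x y ->
  reach n (@lift_seq2 c1 c2 x.1, x.2) (lift_seq2 c1 y.1, y.2).
Proof. by apply: reach_lift => q; eexists; first by []. Qed.
Lemma reach_if1 r c1 c2 n x y : reach n x y ->
  reach n (@lift_if1 r c1 c2 x.1, x.2) (lift_if1 r c2 y.1, y.2).
Proof. by apply: reach_lift => q; eexists; first by []. Qed.
Lemma reach_if2 r c1 c2 n x y : reach n x y ->
  reach n (@lift_if2 r c1 c2 x.1, x.2) (lift_if2 r c1 y.1, y.2).
Proof. by apply: reach_lift => q; eexists; first by []. Qed.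
Lemma reach_loop r c n x y : reach n x y ->
  reach n (@lift_loop r c x.1, x.2) (lift_loop r y.1, y.2).
Proof. by apply: reach_lift => q; eexists; first by []. Qed.

Lemma exec_reach c s s' : exec c s s' ->
  exists n, reach n (Some (entry c), s) (None, s').
Proof.
elim=> {c s s'} [r s io|r s io|c1 c2 s1 s2 s3 _ [m hm] _ [n hn]
  |r c1 c2 s s' s0 _ [n hn]|r c1 c2 s s' s0 _ [n hn]|r c s s0
  |r c s1 s2 s3 s0 _ [m hm] _ [n hn]|i r s io|b s io].
- by exists 1; apply: ReachS; exact: Reach0.
- by exists 1; apply: ReachS; exact: Reach0.
- by exists (m + n); exact: (reach_trans (reach_seq1 c2 hm) (reach_seq2 c1 hn)).
- by exists n.+1; apply: ReachS; case: s s0 hn => s io /= /negbTE -> hn; exact: (reach_if1 r c2 hn).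
- by exists n.+1; apply: ReachS; case: s s0 hn => s io /= -> hn; exact: (reach_if2 r c1 hn).
- by exists 1; apply: ReachS; case: s s0 => s io /= ->; exact: Reach0.
- exists (m.+1 + n); apply: reach_trans hn; apply: ReachS.
  by case: s1 s0 hm => s io /= /negbTE -> hm; exact: (reach_loop r hm).
- by exists 1; apply: ReachS; exact: Reach0.
- by exists 1; apply: ReachS; exact: Reach0.
Qed.

(** [exec] says nothing about endless runs. Arbitrarily long runs that are still inside the program
    rule out halting, because the machine is deterministic. *)
Definition diverges c x :=
  forall k, exists n q y, k <= n /\ reach n (Some (entry c), x) (Some q, y).

Lemma diverges_seq1 c1 c2 x : diverges c1 x -> diverges (Seq c1 c2) x.
Proof.
move=> h k; have [n [q [y [kn hr]]]] := h k.
by exists n, (inl q), y; split=> //; exact: (reach_seq1 c2 hr).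
Qed.

Lemma diverges_seq2 c1 c2 x x' : exec c1 x x' -> diverges c2 x' -> diverges (Seq c1 c2) x.
Proof.
move=> /exec_reach [m hm] h k; have [n [q [y [kn hr]]]] := h k.
exists (m + n), (inr q), y; split; first by rewrite (leq_trans kn) ?leq_addl.
exact: (reach_trans (reach_seq1 c2 hm) (reach_seq2 c1 hr)).
Qed.

Lemma diverges_loop r c (x : nat -> cstate) :
  (forall i, (x i).1 r != 0) -> (forall i, exec c (x i) (x i.+1)) ->
  diverges (Loop r c) (x 0).
Proof.
move=> x0 xS; elim=> [|k [n [q [y [kn hr]]]]].
  by exists 0, None, (x 0); split=> //; exact: Reach0.
suff H i : exists n, i <= n /\ @reach (Loop r c) n (Some None, x 0) (Some None, x i).
  by have [m [km hm]] := H k.+1; exists m, None, (x k.+1).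
elim: i => [|i [m [im hm]]]; first by exists 0; split=> //; exact: Reach0.
have [j hj] := exec_reach (xS i).
exists (m + j.+1); split; first by lia.
apply: (reach_trans hm); apply: ReachS.
move: (x0 i) hj; case: (x i) => s io /= /negbTE -> hj; exact: (reach_loop r hj).
Qed.

(** * Counters and channels as tapes *)

Definition blank (w : seq symb) := all (pred1 None) w.
(** The value is the distance of the head to the right of a single mark on a tape that is otherwise
    blank. Incrementing is a move to the right, decrementing a move to the left unless the mark is
    scanned, and the zero test reads the mark. *)
Definition counter_tape v (t : tape) :=
  if v is u.+1 then t.1 = rcons (nseq u None) (Some true) /\ blank t.2
  else t.1 = [::] /\ exists2 w, t.2 = Some true :: w & blank w.
Definition input_tape (w : seq bool) (t : tape) :=
  exists2 b, t.2 = map Some w ++ b & blank b.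
Definition output_tape (w : seq bool) (t : tape) :=
  t.1 = rev (map Some w) /\ blank t.2.

Definition tape_act (a : symb * move) (t : tape) := tape_move a.2 (tape_write a.1 t).

Lemma blank_head w : blank w -> head None w = None.
Proof. by case: w => //= s w /andP[/eqP]. Qed.
Lemma blank_behead w : blank w -> blank (behead w).
Proof. by case: w => //= s w /andP[]. Qed.

Lemma counter_read v t : counter_tape v t -> tape_read t = if v is 0 then Some true else None.
Proof.
case: v => [ [_ [w e _]]|v [_ h]]; first by rewrite /tape_read e.
by rewrite /tape_read blank_head.
Qed.

Lemma counter_stay v t : counter_tape v t -> counter_tape v (tape_act (tape_read t, Stay) t).
Proof.
move=> h; rewrite (counter_read h); case: v h => [ [e [w e2 bw]]|v [e h]]; split=> //.
  by exists w; rewrite //= e2.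
by rewrite /= blank_behead.
Qed.

Lemma counter_inc v t : counter_tape v t -> counter_tape v.+1 (tape_act (tape_read t, MoveR) t).
Proof.
move=> h; rewrite (counter_read h); case: v h => [ [e [w e2 bw]]|v [e h]]; split.
- by rewrite /= e.
- by rewrite /= e2.
- by rewrite /= e.
- by rewrite /= blank_behead.
Qed.

Lemma counter_dec v t : counter_tape v t -> counter_tape v.-1
  (tape_act (tape_read t, if tape_read t is Some true then Stay else MoveL) t).
Proof.
case: v => [|v] h; first by have := counter_stay h; rewrite (counter_read h).
rewrite (counter_read h) /=; case: h => e h; case: v e => [|v] /= ->; split=> //=.
- by exists (None :: behead t.2) => //=; exact: blank_behead.
- by rewrite /= blank_behead.
Qed.

Lemma input_read w t : input_tape w t -> tape_read t = ohead w.
Proof. by case: w => [|b w] [u e bu]; rewrite /tape_read e //= blank_head. Qed.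

Lemma input_stay w t : input_tape w t -> input_tape w (tape_act (tape_read t, Stay) t).
Proof.
move=> h; rewrite (input_read h); case: w h => [|b w] [u e bu] /=.
  by exists (None :: behead u) => //=; [rewrite e|exact: blank_behead].
by exists u => //=; rewrite e.
Qed.

Lemma input_next w t : input_tape w t ->
  input_tape (behead w) (tape_act (tape_read t, if w is [::] then Stay else MoveR) t).
Proof.
move=> h; case: w h => [|b w] h; first exact: (input_stay h).
by case: h => u e bu; exists u => //=; rewrite e.
Qed.

Lemma output_stay w t : output_tape w t -> output_tape w (tape_act (tape_read t, Stay) t).
Proof. by case=> e h; split=> //=; rewrite /tape_read blank_head ?blank_behead. Qed.

Lemma output_write w b t : output_tape w t -> output_tape (rcons w b) (tape_act (Some b, MoveR) t).
Proof. by case=> e h; split=> /=; rewrite ?blank_behead // e map_rcons rev_rcons. Qed.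

Lemma output_word w t : output_tape w t -> tape_word t = w.
Proof.
case=> e h; rewrite /tape_word e revK pmap_cat.
have -> : pmap id t.2 = [::].
  by move: h; elim: (t.2) => //= s u IH /andP[/eqP -> /IH].
by rewrite cats0; elim: w {e} => //= b w ->.
Qed.

Definition op_ok K (o : aop) :=
  match o with
  | OInc r | ODec r | OTest r => r < K
  | ORead _ r => r.+1 < K
  | OWrite _ => true
  end.

Fixpoint reg_bound (c : cmd) : nat :=
  match c with
  | Inc r | Dec r => r.+1
  | Read _ r => r.+2
  | Write _ => 0
  | Seq c1 c2 => maxn (reg_bound c1) (reg_bound c2)
  | If r c1 c2 => maxn r.+1 (maxn (reg_bound c1) (reg_bound c2))
  | Loop r c => maxn r.+1 (reg_bound c)
  end.

Lemma op_ok_bound c (q : cst c) K : reg_bound c <= K -> op_ok K (op q).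
Proof.
elim: c q => //= [c1 IH1 c2 IH2|r c1 IH1 c2 IH2|r c IH] q; rewrite !geq_max.
- by case: q => q /andP[h1 h2]; [exact: IH1|exact: IH2].
- by case: q => [ [q|q]|] /and3P[h0 h1 h2]; [exact: IH1|exact: IH2|].
- by case: q => [q|] /andP[h0 h1]; [exact: IH|].
Qed.

Section Machine.
Variable c : cmd.
Let K := reg_bound c.

Definition reg_tape r : 'I_K.+3 := inord (r + 3).
Definition chan_tape (i : bool) : 'I_K.+3 := inord i.
Definition out_tape : 'I_K.+3 := inord 2.

Definition op_move (o : aop) (x : 'I_K.+3 -> symb) (i : 'I_K.+3) : symb * move :=
  match o with
  | OInc r => (x i, if i == reg_tape r then MoveR else Stay)
  | ODec r => (x i, if i == reg_tape r then if x i is Some true then Stay else MoveL else Stay)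
  | ORead k r => (x i,
      if x (chan_tape k) is Some b then
        if (i == chan_tape k) || (i == reg_tape r) || b && (i == reg_tape r.+1) then MoveR
        else Stay
      else Stay)
  | OWrite b => if i == out_tape then (Some b, MoveR) else (x i, Stay)
  | OTest _ => (x i, Stay)
  end.

Definition op_test (o : aop) (x : 'I_K.+3 -> symb) : bool :=
  if o is OTest r then x (reg_tape r) == Some true else false.

(** State [None] is the initial step, which puts the mark on every register tape so that all
    counters read 0; [Some None] halts. *)
Definition machine_delta (q : option (option (cst c))) (x : {ffun 'I_K.+3 -> symb}) :
    option (option (option (cst c)) * ('I_K.+3 -> symb * move)) :=
  match q with
  | None => Some (Some (Some (entry c)),
      fun i : 'I_K.+3 => (if 3 <= i then Some true else x i, Stay))
  | Some None => None
  | Some (Some q) => Some (Some (nxt q (op_test (op q) x)), op_move (op q) x)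
  end.

Definition machine : TM := @MkTM K (option (option (cst c))) None machine_delta.

Definition tapes_rep (x : cstate) (t : 'I_K.+3 -> tape) :=
  [/\ forall r, r < K -> counter_tape (x.1 r) (t (reg_tape r)),
      forall i, input_tape (chan_in i x.2) (t (chan_tape i)) &
      output_tape x.2.2 (t out_tape)].

Lemma reg_tape_eq r r' : r < K -> r' < K -> (reg_tape r == reg_tape r') = (r == r').
Proof. by move=> h h'; rewrite -val_eqE /= !inordK ?eqn_add2r // !addn3. Qed.

Lemma reg_chan r i : r < K -> (reg_tape r == chan_tape i) = false.
Proof. by move=> h; rewrite -val_eqE /= !inordK ?addn3 //; case: i. Qed.

Lemma reg_out r : r < K -> (reg_tape r == out_tape) = false.
Proof. by move=> h; rewrite -val_eqE /= !inordK ?addn3. Qed.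

Lemma chan_out i : (chan_tape i == out_tape) = false.
Proof. by rewrite -val_eqE /= !inordK //; case: i. Qed.

Lemma chan_tape_eq i j : (chan_tape i == chan_tape j) = (i == j).
Proof. by rewrite -val_eqE /= !inordK //; case: i; case: j. Qed.

Lemma step_rep o x (t : 'I_K.+3 -> tape) : op_ok K o -> tapes_rep x t ->
  let y := [ffun i => tape_read (t i)] in
  op_test o y = test_op o x /\ tapes_rep (do_op o x) (fun i => tape_act (op_move o y i) (t i)).
Proof.
case: x => s io ok [hr hi ho] y.
have yE i : y i = tape_read (t i) by rewrite ffunE.
split.
  case: o ok => //= r rK; rewrite yE (counter_read (hr _ rK)) /=.
  by case: (s r).
have hrs r : r < K -> counter_tape (s r) (tape_act (y (reg_tape r), Stay) (t (reg_tape r))).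
  by move=> rK; rewrite yE; apply: counter_stay; exact: hr.
have his i : input_tape (chan_in i io) (tape_act (y (chan_tape i), Stay) (t (chan_tape i))).
  by rewrite yE; apply: input_stay; exact: hi.
have hos : output_tape io.2 (tape_act (y out_tape, Stay) (t out_tape)).
  by rewrite yE; exact: output_stay.
case: o ok => [r|r|k r|b|r] /= ok; split=> /=.
- move=> r' r'K; rewrite reg_tape_eq // /upd; case: eqP => [->|_]; last exact: hrs.
  by rewrite yE; apply: counter_inc; exact: hr.
- by move=> i; rewrite eq_sym reg_chan.
- by rewrite eq_sym reg_out.
- move=> r' r'K; rewrite reg_tape_eq // /upd; case: eqP => [->|_]; last exact: hrs.
  by rewrite !yE; apply: counter_dec; exact: hr.
- by move=> i; rewrite eq_sym reg_chan.
- by rewrite eq_sym reg_out.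
- move=> r' r'K; rewrite [y (chan_tape k)]yE (input_read (hi k)).
  case: (chan_in k io) => [|b w] /=; first by rewrite !addn0 !upd_id; exact: hrs.
  rewrite reg_chan // !reg_tape_eq //= ?(ltnW ok) // /upd addn1.
  case: (eqVneq r' r) => [->|rr'] /=.
    rewrite ifN ?yE; last by lia.
    by apply: counter_inc; apply: hr; lia.
  case: (eqVneq r' r.+1) => [->|r1] /=; rewrite ?andbF ?andbT; last exact: hrs.
  case: b; rewrite ?addn0 ?addn1; last exact: hrs.
  by rewrite yE; apply: counter_inc; apply: hr; lia.
- move=> i; rewrite [y (chan_tape k)]yE (input_read (hi k)).
  have rK : r < K by lia.
  have := input_next (hi k); rewrite -yE.
  case e: (chan_in k io) => [|b w] /= h.
    rewrite (_ : chan_in i (chan_drop k io) = chan_in i io); first exact: his.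
    by case: (i); case: (k) e => /= e; rewrite ?e.
  rewrite chan_tape_eq !(eq_sym (chan_tape i)) !reg_chan // andbF !orbF.
  case: eqP => [->|ik].
    rewrite (_ : chan_in k (chan_drop k io) = w) //.
    by move: e; case: (k) => /= ->.
  rewrite (_ : chan_in i (chan_drop k io) = chan_in i io); first exact: his.
  by move: ik; case: (i); case: (k).
- have rK : r < K by lia.
  have -> : (chan_drop k io).2 = io.2 by case: (k).
  case: (y (chan_tape k)) => [b|] //.
  by rewrite !(eq_sym out_tape) chan_out !reg_out // andbF.
- by move=> r' r'K; rewrite reg_out //; exact: hrs.
- move=> i; rewrite chan_out (_ : chan_in i (chan_write b io) = chan_in i io); first exact: his.
  by case: (i).
- by rewrite eqxx; exact: output_write.
- exact: hrs.
- exact: his.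
- exact: hos.
Qed.

Definition init_state (p y : seq bool) : cstate := (fun=> 0, ((p, y), [::])).

Lemma machine_reach p y n o x :
  reach n (Some (entry c), init_state p y) (o, x) ->
  exists2 t, iter n.+1 (obind (@tm_step machine)) (Some (tm_init machine p y)) = Some (Some o, t)
    & tapes_rep x t.
Proof.
have run m u v : @reach c m u v -> forall t1, tapes_rep u.2 t1 ->
    exists2 t, iter m (obind (@tm_step machine)) (Some (Some u.1, t1)) = Some (Some v.1, t)
      & tapes_rep v.2 t.
  elim=> {m u v} [u|m q s v _ IH] t1 rep; first by exists t1.
  have [et rep'] := step_rep (op_ok_bound q (leqnn _)) rep.
  have [t ht rep2] := IH _ rep'.
  rewrite /= in et; exists t => //; rewrite -ht iterSr; congr (iter m _ _).
  by rewrite /= /tm_step /= -et.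
move=> h; rewrite iterSr /=.
apply: (run _ _ _ h); split=> [r rK|i|].
- rewrite /= ffunE /= inordK ?addn3 //=; split; first by [].
  by exists [::].
- rewrite /= ffunE /= inordK; last by case: i.
  rewrite /input_tape /=; case: i => /=.
    by case: y {h} => [|b y] /=; [exists [:: None]|exists [::]; rewrite ?cats0].
  by case: p {h} => [|b p] /=; [exists [:: None]|exists [::]; rewrite ?cats0].
- by rewrite /= ffunE /= inordK.
Qed.

Lemma machine_halts p y x : exec c (init_state p y) x -> tm_eval machine y p x.2.2.
Proof.
move=> /exec_reach [n /machine_reach [t ht [_ _ rep]]].
exists n.+1, (Some None, t); split=> //.
rewrite -(output_word rep) /tm_output; congr tape_word; congr t.
by apply: val_inj; rewrite /= inordK.
Qed.

Lemma iter_obind_None A (f : A -> option A) n : iter n (obind f) None = None.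
Proof. by elim: n => //= n ->. Qed.

Lemma machine_diverges p y w : diverges c (init_state p y) -> ~ tm_eval machine y p w.
Proof.
move=> dv [k [conf [hk hstop _]]].
have [n [q [z [kn /machine_reach [t ht _]]]]] := dv k.
move: ht; have -> : n.+1 = (n - k) + k.+1 by lia.
by rewrite iterD iterS hk /= hstop iter_obind_None.
Qed.

End Machine.

Lemma tm_eval_inj M y p x x' : tm_eval M y p x -> tm_eval M y p x' -> x = x'.
Proof.
move=> [t [u [hu su <-]]] [t' [u' [hu' su' <-]]].
have step k k' v v' : iter k (obind (@tm_step M)) (Some (tm_init M p y)) = Some v ->
    tm_step v = None -> iter k' (obind (@tm_step M)) (Some (tm_init M p y)) = Some v' -> k' <= k.
  move=> h s h'; rewrite leqNgt; apply/negP => kk.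
  by move: h'; rewrite -(subnK kk) iterD iterS h /= s iter_obind_None.
have e : t = t' by apply/eqP; rewrite eqn_leq (step _ _ _ _ hu su hu') (step _ _ _ _ hu' su' hu).
by move: hu hu'; rewrite e => -> [->].
Qed.

(** * Programs for input, output and unbounded search *)

Definition read_loop i r :=
  Seq (Read i r) (Loop r (Seq (Dec r) (Seq (pr_cmd r.+1) (Seq (Inc r.+1)
    (Seq (drain r.+1 r.+2) (Read i r)))))).

Definition chan_clear (i : bool) (io : channels) : channels :=
  if i then ((io.1.1, [::]), io.2) else (([::], io.1.2), io.2).

(** Register [r] tells whether a bit was read, [r.+1] is that bit, and [r.+2] is the code of the
    list so far. Pairing followed by an increment is [cons] on codes, hence the reversed order. *)
Lemma exec_read_loop i r s io (u : seq bool) :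
  s r = 0 -> s r.+1 = 0 -> s r.+2 = en u -> s r.+3 = 0 ->
  exec (read_loop i r) (s, io)
    (upd s r.+2 (en (catrev (chan_in i io) u)), chan_clear i io).
Proof.
move=> s0 s1 s2 s3; apply: ExSeq; first exact: ExRead.
have [w ew] : exists w, chan_in i io = w by eexists.
elim: w io u s s0 s1 s2 s3 ew => [|b w IH] io u s s0 s1 s2 s3 ew; rewrite ew /=.
  apply: exec_eq; first by apply: ExLoop0; rewrite /=; upd_tac.
  congr (_, _); first by move: s2; rewrite /= => <-; upd_tac.
  by move: ew; case: i; case: io => [ [p y] o] /= ->.
apply: ExLoopS; first by rewrite /=; upd_tac.
  apply: ExSeq; first exact: ExDec.
  apply: ExSeq; first by apply: exec_pr; upd_tac.
  apply: ExSeq; first exact: ExInc.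
  apply: ExSeq; first by apply: exec_drain; lia.
  exact: ExRead.
have -> : chan_clear i io = chan_clear i (chan_drop i io) by case: (i).
have ew' : chan_in i (chan_drop i io) = w by move: ew; case: (i) => /= ->.
apply: exec_eq; first by apply: (IH _ (b :: u)) => //; upd_tac; rewrite /= ?s0 ?s1 ?s2.
by rewrite ew'; congr (_, _); upd_tac.
Qed.

Definition regs2 f z : regs := upd (upd (fun=> 0) 0 f) 1 z.

Definition write_loop :=
  Loop 1 (Seq (Dec 1) (Seq (unp_cmd 1)
    (Seq (If 1 (Seq (Dec 1) (Write true)) (Write false)) (drain 2 1)))).

Lemma exec_write_loop (x : seq bool) inp w :
  exec write_loop (regs2 0 (en x), (inp, w)) (regs2 0 0, (inp, w ++ x)).
Proof.
elim: x w => [|b x IH] w; first by rewrite cats0; exact: ExLoop0.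
have -> : regs2 0 (en (b :: x)) = regs2 0 (pr (en b) (en x)).+1 by [].
move: (en x) IH => m IH.
apply: (@ExLoopS _ _ _ (regs2 0 m, (inp, rcons w b))); [by []| |by rewrite -cat_rcons].
apply: ExSeq; first exact: ExDec.
apply: ExSeq; first exact: exec_unp.
apply: (@ExSeq _ _ _ (upd (regs2 0 0) 2 m, (inp, rcons w b))); last first.
  by apply: exec_eq; [exact: exec_drain|congr (_, _); rewrite /regs2; upd_tac].
set s := (X in exec _ (X, _) _).
have -> : s = upd (regs2 0 b) 2 m.
  by rewrite /s /regs2 /upd /=; apply: funext => i; rewrite lft_pr rgt_pr; upd_tac.
case: b {IH s} => /=.
  apply: ExIfT => //; apply: ExSeq; first exact: ExDec.
  apply: exec_eq; first exact: ExWrite.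
  by congr (_, _); rewrite /regs2; upd_tac.
by apply: ExIfF => //; exact: ExWrite.
Qed.

Section Search.
Variables cinit cN : nat -> cmd.

Definition search_prefix k :=
  Seq (read_loop false 0) (Seq (drain 2 0)
  (Seq (read_loop true 1) (Seq (drain 3 1)
  (Seq (pr_cmd 0) (Seq (drain 0 1) (Seq (cinit 1) (Seq (Inc 0) k))))))).

Definition search_loop :=
  Loop 0 (Seq (Dec 0) (Seq (cN 1) (Seq (drain 1 0) (unp_cmd 0)))).

Definition search_cmd := search_prefix (Seq search_loop write_loop).

Variables finit fN : nat -> nat.
Hypothesis hinit : computes cinit finit.
Hypothesis hN : computes cN fN.

Definition search_start (p y : seq bool) := finit (pr (en (rev p)) (en (rev y))).

(** Stated for an abstract [P] so that one proof serves both [exec] and [diverges]. *)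
Lemma search_prefixP (P : cmd -> cstate -> Prop) p y k :
  (forall c1 c2 x x', exec c1 x x' -> P c2 x' -> P (Seq c1 c2) x) ->
  P k (regs2 1 (search_start p y), ([::], [::], [::])) ->
  P (search_prefix k) (init_state p y).
Proof.
move=> hP hk; rewrite /init_state.
apply: (hP); first exact: (@exec_read_loop _ _ _ _ [::]).
apply: (hP); first exact: exec_drain.
apply: (hP); first exact: (@exec_read_loop _ _ _ _ [::]).
apply: (hP); first exact: exec_drain.
apply: (hP); first exact: exec_pr.
apply: (hP); first exact: exec_drain.
set s := (X in P _ (X, _)).
have -> : s = regs2 0 (pr (en (rev p)) (en (rev y))).
  by rewrite /s /regs2 /chan_clear /= !catrevE !cats0; upd_tac.
apply: (hP); first by apply: hinit => i i1; rewrite /regs2; upd_tac.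
apply: (hP); first exact: ExInc.
by set s' := upd _ _ _; suff -> : s' = regs2 1 (search_start p y) by [];
  rewrite /s' /regs2; upd_tac.
Qed.

Lemma search_step z :
  exec (Seq (Dec 0) (Seq (cN 1) (Seq (drain 1 0) (unp_cmd 0))))
    (regs2 1 z, ([::], [::], [::])) (regs2 (lft (fN z)) (rgt (fN z)), ([::], [::], [::])).
Proof.
apply: ExSeq; first exact: ExDec.
apply: ExSeq; first by apply: hN => i i1; rewrite /regs2; upd_tac.
apply: ExSeq; first exact: exec_drain.
apply: exec_eq; first exact: exec_unp.
by congr (_, _); rewrite /regs2 /=; upd_tac.
Qed.

End Search.

Section SearchStep.
Variable F : (seq bool * seq bool) * nat -> option (seq bool).

(** The first component is the new loop flag, the second the next search state or, on success, the
    code of the output. The inputs are kept reversed, as [read_loop] delivers them. *)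
Definition search_next (z : (seq bool * seq bool) * nat) : nat * nat :=
  match F ((rev z.1.1, rev z.1.2), z.2) with
  | Some x => (0, en x)
  | None => (1, en (z.1, z.2.+1))
  end.

Definition search_code (p y : seq bool) (t : nat) : nat := en ((rev p, rev y), t).

End SearchStep.

(** A partial computable function is an unbounded search over a total one, so [PR] can be confined
    to total functions. *)
Theorem TM_of_PR (F : (seq bool * seq bool) * nat -> option (seq bool)) : PR F ->
  exists M : TM, forall y p x, tm_eval M y p x <->
    exists2 t, F ((p, y), t) = Some x & forall t', t' < t -> F ((p, y), t') = None.
Proof.
move=> hF.
have hN0 : PR (search_next F) by rewrite /search_next; prt.
case: hN0 => fN [cN hN] eN.
have hI0 : PR (fun z : seq bool * seq bool => (z, 0)) by prt.
case: hI0 => fI [cI hI] eI.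
pose st := search_code.
have st0 p y : search_start fI p y = st p y 0 by rewrite /st /search_code -(eI (rev p, rev y)).
have stN p y t : F ((p, y), t) = None ->
    (lft (fN (st p y t)), rgt (fN (st p y t))) = (1, st p y t.+1).
  move=> e; rewrite /st /search_code eN /search_next /= !revK e.
  by rewrite /en /= /en_prod /= lft_pr rgt_pr.
have stS p y t x : F ((p, y), t) = Some x ->
    (lft (fN (st p y t)), rgt (fN (st p y t))) = (0, en x).
  move=> e; rewrite /st /search_code eN /search_next /= !revK e.
  by rewrite /en /= /en_prod /= lft_pr rgt_pr.
pose io0 : channels := (([::], [::]), [::]).
pose body := Seq (Dec 0) (Seq (cN 1) (Seq (drain 1 0) (unp_cmd 0))).
have stepN p y t : F ((p, y), t) = None ->
    exec body (regs2 1 (st p y t), io0) (regs2 1 (st p y t.+1), io0).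
  by move=> e; have := search_step hN (st p y t); case: (stN _ _ _ e) => -> ->.
have stepS p y t x : F ((p, y), t) = Some x ->
    exec body (regs2 1 (st p y t), io0) (regs2 0 (en x), io0).
  by move=> e; have := search_step hN (st p y t); case: (stS _ _ _ _ e) => -> ->.
have halts p y t x : F ((p, y), t) = Some x -> (forall t', t' < t -> F ((p, y), t') = None) ->
    tm_eval (machine (search_cmd cI cN)) y p x.
  move=> e h.
  suff /machine_halts : exec (search_cmd cI cN) (init_state p y) (regs2 0 0, (io0.1, x)) by [].
  apply: (search_prefixP (P := fun k x => exec k x _) hI); first by move=> *; apply: ExSeq; eauto.
  rewrite st0.
  apply: ExSeq; last exact: (exec_write_loop x _ [::]).
  have H k : k <= t -> exec (search_loop cN) (regs2 1 (st p y (t - k)), io0) (regs2 0 (en x), io0).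
    elim: k => [|k IH] kt.
      by rewrite subn0; apply: (ExLoopS _ (stepS _ _ _ _ e)) => //; exact: ExLoop0.
    apply: ExLoopS; [by []|apply: stepN; apply: h; lia|].
    by rewrite (_ : (t - k.+1).+1 = t - k); [apply: IH|]; lia.
  by have := H t (leqnn _); rewrite subnn.
exists (machine (search_cmd cI cN)) => y p x; split; last by move=> [t e h]; exact: halts e h.
move=> ev.
have [[t0 ht0]|none] := pselect (exists t, F ((p, y), t)); last first.
  (* Without any hit the search loop runs for ever, against the assumption that the machine
     halts. *)
  suff dv : diverges (search_cmd cI cN) (init_state p y) by case: (machine_diverges dv ev).
  apply: (search_prefixP (P := diverges) hI); first exact: diverges_seq2.
  apply: diverges_seq1; rewrite st0.
  apply: (@diverges_loop _ _ (fun t => (regs2 1 (st p y t), io0))) => // t.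
  apply: stepN; case e: (F _) => [w|] //; case: none.
  by exists t; rewrite e.
have ex : exists t, F ((p, y), t) : bool by exists t0.
case: (ex_minnP ex) => t ht tmin.
case e: (F ((p, y), t)) ht => [x'|] // _.
have h t' : t' < t -> F ((p, y), t') = None.
  by move=> tt; case e': (F _) => [w|] //; have := tmin t'; rewrite e' => /(_ isT); lia.
exists t => //; rewrite e; congr Some.
exact: (tm_eval_inj (halts _ _ _ _ e h) ev).
Qed.

(** * Running a fixed machine is computable *)

Lemma nth_map_enum_ord (T : Type) n (g : 'I_n -> T) d (i : 'I_n) :
  nth d [seq g j | j <- enum 'I_n] i = g i.
Proof. by rewrite (nth_map i) ?size_enum_ord // nth_ord_enum. Qed.

Section Simulation.
Variable U : TM.
Local Notation K := (tm_work U).+3.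
Local Notation Q := (tm_state U).
Local Notation symbol := (option bool).
Local Notation sim_config := (nat * seq (seq symbol * seq symbol))%type.

Definition move_code (m : move) : nat :=
  match m with MoveL => 0 | Stay => 1 | MoveR => 2 end.

Definition sim_act (a : symbol * nat) (t : seq symbol * seq symbol) : seq symbol * seq symbol :=
  let l := t.1 in let r := a.1 :: behead t.2 in
  if a.2 == 0 then (behead l, head None l :: r)
  else if a.2 == 1 then (l, r) else (a.1 :: l, behead r).

Definition sim_idx := [seq nat_of_ord i | i <- enum 'I_K].

Lemma sim_actE s m t : sim_act (s, move_code m) t = tape_move m (tape_write s t).
Proof. by case: m. Qed.

Definition sim_key (x : Q * {ffun 'I_K -> symb}) : nat * seq symbol :=
  (nat_of_ord (enum_rank x.1), [seq x.2 i | i <- enum 'I_K]).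

Definition sim_value (x : Q * {ffun 'I_K -> symb}) : option (nat * seq (symbol * nat)) :=
  omap (fun a => (nat_of_ord (enum_rank a.1), [seq ((a.2 i).1, move_code (a.2 i).2) | i <- enum 'I_K]))
    (tm_delta x.1 x.2).

Definition sim_table := [seq (sim_key x, sim_value x) | x <- enum {: Q * {ffun 'I_K -> symb}}].

Lemma sim_key_inj : injective sim_key.
Proof.
move=> [q f] [q' f'] [] /val_inj /enum_rank_inj -> /eq_in_map e; congr (_, _).
by apply/ffunP => i; apply: e; rewrite mem_enum.
Qed.

Definition sim_step (c : sim_config) : option sim_config :=
  match lookup sim_table (c.1, [seq head None t.2 | t <- c.2]) with
  | Some (Some a) => Some (a.1,
      [seq sim_act (nth (None, 0) a.2 i) (nth ([::], [::]) c.2 i) | i <- sim_idx])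
  | _ => None
  end.

Definition sim_of (c : tm_config U) : sim_config :=
  (nat_of_ord (enum_rank c.1), [seq c.2 i | i <- enum 'I_K]).

Lemma sim_stepE c : sim_step (sim_of c) = omap sim_of (tm_step c).
Proof.
rewrite /sim_step /= -map_comp.
set f : {ffun 'I_K -> symb} := [ffun i => tape_read (c.2 i)].
have -> : [seq ((fun t => head None t.2) \o c.2) i | i <- enum 'I_K] = [seq f i | i <- enum 'I_K].
  by apply: eq_map => i; rewrite ffunE.
rewrite -[(_, _)]/(sim_key (c.1, f)) (lookup_map _ sim_key_inj) ?mem_enum //.
rewrite /sim_value /tm_step -/f /=; case: (tm_delta c.1 f) => [ [q a]|] //=.
congr (Some (_, _)); rewrite -map_comp; apply: eq_map => i.
by rewrite [LHS]/comp !nth_map_enum_ord sim_actE.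
Qed.

Definition sim_init (p y : seq bool) : sim_config :=
  (nat_of_ord (enum_rank (tm_start U)),
   [seq ([::], [seq Some b | b <- nth [::] [:: p; y] i]) | i <- sim_idx]).

Lemma sim_initE p y : sim_init p y = sim_of (tm_init U p y).
Proof. by rewrite /sim_init /sim_of /= -map_comp. Qed.

Definition run_config (y p : seq bool) (t : nat) : option (tm_config U) :=
  iter t (obind (@tm_step U)) (Some (tm_init U p y)).

Definition sim_run (y p : seq bool) (t : nat) : option sim_config :=
  iter t (fun o => match o with Some c => sim_step c | None => None end) (Some (sim_init p y)).

Lemma sim_runE y p t : sim_run y p t = omap sim_of (run_config y p t).
Proof.
rewrite /sim_run /run_config; elim: t => [|t IH]; first by rewrite /= sim_initE.
by rewrite !iterS IH; case: (iter t _ _) => //= c; rewrite sim_stepE.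
Qed.

(** Succeeds only when [t] is exactly the halting time, since the run is [None] afterwards; a
    program thus yields its output at one [t] only. *)
Definition run_out (y p : seq bool) (t : nat) : option (seq bool) :=
  match sim_run y p t with
  | Some c => match sim_step c with
      | Some _ => None
      | None => let t := nth ([::], [::]) c.2 2 in
          Some (flatten [seq (if s is Some b then [:: b] else [::]) | s <- rev t.1 ++ t.2])
      end
  | None => None
  end.

Lemma PR_run_out0 : PR (fun z : (seq bool * seq bool) * nat => run_out z.1.1 z.1.2 z.2).
Proof.
have hstep : PR sim_step.
  by rewrite /sim_step /sim_act; prt.
have hinit : PR (fun z : seq bool * seq bool => sim_init z.1 z.2).
  by rewrite /sim_init; prt.
have hrun : PR (fun z : (seq bool * seq bool) * nat => sim_run z.1.1 z.1.2 z.2).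
  rewrite /sim_run. prt.
rewrite /run_out. prt.
Qed.

Lemma run_outP y p x : tm_eval U y p x <-> exists t, run_out y p t = Some x.
Proof.
have outE (c : tm_config U) : tm_output c = flatten [seq (if s is Some b then [:: b] else [::]) |
   s <- rev (nth ([::], [::]) (sim_of c).2 2).1 ++ (nth ([::], [::]) (sim_of c).2 2).2].
  rewrite -[2]/(nat_of_ord (@Ordinal K 2 isT)) nth_map_enum_ord.
  rewrite /tm_output /tape_word; move: (rev _ ++ _) => s.
  by elim: s => //= -[b|] s IH; rewrite /= IH.
split=> [ [t [c [h s <-]]]|[t]].
  by exists t; rewrite /run_out sim_runE /run_config h /= sim_stepE s /= outE.
rewrite /run_out sim_runE; case e: (run_config y p t) => [c|] //=.
rewrite sim_stepE; case s: (tm_step c) => [c'|] //= [<-].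
by exists t, c; split=> //; rewrite outE.
Qed.

Lemma run_out_time y p t t' x x' : run_out y p t = Some x -> run_out y p t' = Some x' -> t = t'.
Proof.
have aux k k' z z' : run_out y p k = Some z -> run_out y p k' = Some z' -> k' <= k.
  rewrite /run_out !sim_runE; case e: (run_config y p k) => [c|] //=.
  rewrite sim_stepE; case s: (tm_step c) => [c'|] //= _.
  case e': (run_config y p k') => [c''|] // _; rewrite leqNgt; apply/negP => kk.
  by move: e'; rewrite /run_config -(subnK kk) iterD iterS -/(run_config y p k) e /= s iter_obind_None.
move=> h h'; apply/eqP; rewrite eqn_leq.
by rewrite (aux _ _ _ _ h h') (aux _ _ _ _ h' h).
Qed.

End Simulation.

Lemma PR_run_out (A : Type) {EA : Enc A} U (y p : A -> seq bool) (t : A -> nat) :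
  PR y -> PR p -> PR t -> PR (fun x => run_out U (y x) (p x) (t x)).
Proof. by move=> hy hp ht; apply: (PR_comp3 (PR_run_out0 U)). Qed.
#[global] Hint Resolve PR_run_out : prdb.

(** * Coding theorem *)

Section Coding.
Local Open Scope ring_scope.

(** The binary fraction [0.s]. A word stands for the dyadic interval that starts at [bits_val s] and
    has length [bits_unit s]. *)
Definition bits_val (s : seq bool) : rat := foldr (fun (b : bool) (v : rat) => ((b%:R + v) / 2 : rat)) 0 s.
Definition bits_unit (s : seq bool) : rat := ((2 ^ size s)%N%:R)^-1.

Lemma bits_unit_gt0 s : 0 < bits_unit s.
Proof. by rewrite invr_gt0 ltr0n expn_gt0. Qed.

Lemma bits_unit_cat s t : bits_unit (s ++ t) = bits_unit s * bits_unit t.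
Proof. by rewrite /bits_unit size_cat expnD natrM invfM. Qed.

Lemma bits_val_bound s : 0 <= bits_val s < 1.
Proof.
elim: s => //= b s /andP[h0 h1]; apply/andP; split; first by case: b => /=; lra.
by case: b => /=; lra.
Qed.

Lemma bits_val_cat s t : bits_val (s ++ t) = bits_val s + bits_unit s * bits_val t.
Proof.
elim: s => [|b s IH] /=; first by rewrite /bits_unit invr1 mul1r add0r.
rewrite IH /bits_unit /= expnS natrM invfM; field.
by rewrite pnatr_eq0 expn_eq0.
Qed.

Lemma bits_val_surj L m : (m < 2 ^ L)%N ->
  exists2 s, size s = L & bits_val s = m%:R * bits_unit s.
Proof.
elim: L m => [|L IH] m.
  by rewrite expn0 ltnS leqn0 => /eqP ->; exists [::]; rewrite //= mul0r.
rewrite expnS mul2n -addnn => mL.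
pose b := (2 ^ L <= m)%N; pose m' := (m - b * 2 ^ L)%N.
have mE : m = (b * 2 ^ L + m')%N by rewrite /m' /b; case: leqP => ?; lia.
have [s sL vs] : exists2 s, size s = L & bits_val s = m'%:R * bits_unit s.
  by apply: IH; rewrite /m' /b; case: leqP => ?; lia.
exists (b :: s); rewrite /= ?sL // vs /bits_unit /= sL expnS mE natrD !natrM invfM.
field; by rewrite pnatr_eq0 expn_eq0.
Qed.

Variable q : seq bool -> nat -> option (rat * seq bool).
Hypothesis q_ge0 : forall y j w x, q y j = Some (w, x) -> 0 <= w.

(** A value [Some (w, x)] of [q y j] is a request: some program of weight of order [w] should output
    [x] under condition [y]. *)
Definition weight y j : rat := if q y j is Some p then p.1 else 0.
Definition psum y j : rat := \sum_(i < j) weight y i.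

Lemma weight_ge0 y j : 0 <= weight y j.
Proof. by rewrite /weight; case e: (q y j) => [[w x]|] //; exact: q_ge0 e. Qed.

Lemma psumS y j : psum y j.+1 = psum y j + weight y j.
Proof. by rewrite /psum big_ord_recr. Qed.

Lemma psum_mono y i j : (i <= j)%N -> psum y i <= psum y j.
Proof.
elim: j => [|j IH]; first by rewrite leqn0 => /eqP ->.
rewrite leq_eqVlt ltnS => /orP[/eqP -> //|/IH h].
by rewrite psumS (le_trans h) // lerDl weight_ge0.
Qed.

(* Request [j] owns the interval of length [weight y j] starting at [psum y j]. A
   word with these properties has its dyadic interval inside that interval, so the
   accepted words form a prefix-free set. *)
Definition code_accepts y s j :=
  [&& 2 * bits_unit s <= weight y j, weight y j < 4 * bits_unit s,
      psum y j <= bits_val s & bits_val s < psum y j + bits_unit s].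

Definition decoder (p : (seq bool * seq bool) * nat) : option (seq bool) :=
  if q p.1.2 p.2 is Some r then if code_accepts p.1.2 p.1.1 p.2 then Some r.2 else None
  else None.

(** The dyadic interval of [s ++ t] lies in that of [s], so disjointness of the request intervals
    forces [i = j]. The weight then fixes the length of the word, up to no choice, and [t] is
    empty. *)
Lemma code_accepts_prefix y s t i j :
  code_accepts y s j -> code_accepts y (s ++ t) i -> i = j /\ t = [::].
Proof.
move=> /and4P[u1 u2 v1 v2] /and4P[u1' u2' v1' v2'].
move: v1' v2' u1' u2'; rewrite bits_val_cat bits_unit_cat => v1' v2' u1' u2'.
have /andP[t0 t1] := bits_val_bound t.
have s0 := bits_unit_gt0 s; have tu0 := bits_unit_gt0 t.
have a1 : 0 <= bits_unit s * bits_val t by apply: mulr_ge0 => //; exact: ltW.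
have a2 : bits_unit s * bits_val t < bits_unit s by rewrite gtr_pMr.
have a3 : 0 < bits_unit s * bits_unit t by exact: mulr_gt0.
have ij : i = j.
  apply/eqP; rewrite eqn_leq; apply/andP; split; rewrite leqNgt; apply/negP.
    move=> /(psum_mono y); rewrite psumS; lra.
  move=> /(psum_mono y); rewrite psumS; lra.
split=> //; case: t {t0 t1 a1 a2 tu0 v1' v2'} u1' u2' a3 => // b t u1' u2' a3.
have : bits_unit s * bits_unit (b :: t) * 2 <= bits_unit s.
  rewrite -mulrA ger_pMr // /bits_unit /= expnS natrM invfM mulrAC mulVf // mul1r.
  by rewrite invf_le1 ?ler1n ?expn_gt0 // ltr0n expn_gt0.
by move=> key; exfalso; move: u2'; rewrite ij; lra.
Qed.

Lemma code_accepts_ex y j : (forall n, psum y n <= 1) -> 0 < weight y j ->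
  exists s, code_accepts y s j.
Proof.
move=> s1 w0.
have w1 : weight y j <= 1.
  have := s1 j.+1; rewrite psumS; suff : 0 <= psum y j by lra.
  by have := psum_mono y (leq0n j); rewrite /psum big_ord0.
have ex : exists k, ((2 ^ k)%N%:R)^-1 <= weight y j.
  have wi : 0 < (weight y j)^-1 by rewrite invr_gt0.
  exists (Num.bound (weight y j)^-1).
  rewrite -[leRHS]invrK lef_pV2 ?posrE ?ltr0n ?expn_gt0 //.
  apply: ltW; apply: (lt_trans (archi_boundP (ltW wi))).
  by rewrite ltr_nat ltn_expl.
have [k hk kmin] := ex_minnP ex.
have hk2 : weight y j < 2 * ((2 ^ k)%N%:R)^-1.
  case: k hk kmin => [|k] hk kmin; first by rewrite expn0 invr1; lra.
  have := kmin k; rewrite expnS natrM invfM mulrA divff // mul1r => h.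
  by rewrite ltNge; apply/negP => /h; rewrite ltnn.
(* With the least [k] one has [w / 4 < u <= w / 2]: an interval of length [u] that starts less than
   [u] after the left end still fits into the request interval. *)
pose u : rat := ((2 ^ k.+1)%N%:R)^-1.
have u0 : 0 < u by rewrite invr_gt0 ltr0n expn_gt0.
have uk : ((2 ^ k)%N%:R)^-1 = 2 * u by rewrite /u expnS natrM invfM mulrA divff // mul1r.
have p0 : 0 <= psum y j by have := psum_mono y (leq0n j); rewrite /psum big_ord0.
have [m m1 m2] : exists2 m : nat, psum y j <= m%:R * u & m%:R * u < psum y j + u.
  have exm : exists m : nat, psum y j <= m%:R * u.
    exists (Num.bound (psum y j / u)).
    by rewrite -ler_pdivrMr // ltW // archi_boundP // divr_ge0 // ltW.
  have [m hm mmin] := ex_minnP exm.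
  exists m => //; case: m hm mmin => [|m] hm mmin; first by lra.
  rewrite -natr1 mulrDl mul1r ltrD2r ltNge; apply/negP => /mmin.
  by rewrite ltnn.
(* The bound on the total weight keeps the left end [m u] below 1, so that it has a binary expansion
   of [k.+1] digits. *)
have mlt : (m < 2 ^ k.+1)%N.
  have := s1 j.+1; rewrite psumS -(ltr_nat rat) => h.
  rewrite -(ltr_pM2r u0) /u divff ?pnatr_eq0 ?expn_eq0 // -/u; lra.
have [s sk sv] := bits_val_surj mlt.
exists s; rewrite /code_accepts sv /bits_unit sk -/u m1 m2 -uk hk /=.
by rewrite andbT; lra.
Qed.

End Coding.

Lemma PR_bits_val (A : Type) {EA : Enc A} (f : A -> seq bool) :
  PR f -> PR (fun x => bits_val (f x)).
Proof. by move=> hf; rewrite /bits_val; prt. Qed.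
#[global] Hint Resolve PR_bits_val : prdb.

Lemma PR_bits_unit (A : Type) {EA : Enc A} (f : A -> seq bool) :
  PR f -> PR (fun x => bits_unit (f x)).
Proof. by move=> hf; rewrite /bits_unit; prt. Qed.
#[global] Hint Resolve PR_bits_unit : prdb.

Section CodingPR.
Variable q : seq bool -> nat -> option (rat * seq bool).
Hypothesis hq : PR (fun p => q p.1 p.2).

Lemma PR_weight (A : Type) {EA : Enc A} (y : A -> seq bool) (j : A -> nat) :
  PR y -> PR j -> PR (fun x => weight q (y x) (j x)).
Proof. by move=> hy hj; rewrite /weight; prt. Qed.

Lemma PR_psum (A : Type) {EA : Enc A} (y : A -> seq bool) (j : A -> nat) :
  PR y -> PR j -> PR (fun x => psum q (y x) (j x)).
Proof.
move=> hy hj; rewrite /psum; apply: (PR_sum_ord_rat (F := fun x i => weight q (y x) i)) => //.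
by apply: PR_weight; prt.
Qed.
#[local] Hint Resolve PR_weight PR_psum : prdb.

Lemma PR_decoder : PR (decoder q).
Proof. by rewrite /decoder /code_accepts; prt. Qed.

End CodingPR.

(** Injectivity of [f] makes the weights of different requests for the same output add up. The
    constant [d] counts the prefix [t] that makes [U] simulate the decoder and two bits for the
    factor 4 in [code_accepts]. *)
Lemma coding U (q : seq bool -> nat -> option (rat * seq bool)) : universal_prefix_machine U -> PR (fun p => q p.1 p.2) ->
  (forall y j w x, q y j = Some (w, x) -> 0 <= w)%R ->
  exists d : nat, forall y, (forall n, psum q y n <= 1)%R ->
  exists f : nat -> seq bool,
    (forall j w x, q y j = Some (w, x) -> (0 < w)%R ->
       tm_eval U y (f j) x /\ (w <= (2 ^ d)%N%:R * bits_unit (f j))%R) /\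
    (forall i j, (0 < weight q y i)%R -> (0 < weight q y j)%R -> f i = f j -> i = j).
Proof.
move=> [_ hU] hq q0.
have [T hT] := TM_of_PR (PR_decoder hq).
have decP y s j p : q y j = Some p -> code_accepts q y s j -> tm_eval T y s p.2.
  move=> e a; apply/hT; exists j; first by rewrite /decoder /= e a.
  move=> i ij; rewrite /decoder /=; case: (q y i) => // r; case: ifP => // a'.
  by move: a'; rewrite -[s]cats0 => /(code_accepts_prefix q0 a) []; lia.
have pT : prefix_machine T.
  move=> y p s x x' /hT [j hj _] /hT [i hi _]; move: hj hi; rewrite /decoder /=.
  case: (q y j) => // r; case: ifP => // a _; case: (q y i) => // r'; case: ifP => // a' _.
  by have [] := code_accepts_prefix q0 a a'.
have [t ht] := hU T pT.
exists (size t + 2) => y s1.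
have ex j : exists s, (0 < weight q y j)%R -> code_accepts q y s j.
  have [h|h] := boolP (0 < weight q y j)%R; last by exists [::] => h'; case/negP: h.
  by have [s hs] := code_accepts_ex q0 s1 h; exists s.
have [g hg] := choice ex.
exists (fun j => t ++ g j); split=> [j w x e w0|i j wi wj].
  have wE : weight q y j = w by rewrite /weight e.
  have a : code_accepts q y (g j) j by apply: hg; rewrite wE.
  split; first by apply/ht; exact: (decP _ _ _ _ e a).
  case/and4P: a; rewrite wE => _ h _ _; rewrite bits_unit_cat expnD natrM.
  rewrite (_ : _ * _ = 4%:R * bits_unit (g j))%R ?(ltW h) //.
  by rewrite /bits_unit mulrACA divff ?mul1r // pnatr_eq0 expn_eq0.
move=> /eqP; rewrite eqseq_cat // eqxx /= => /eqP e.
have ai := hg _ wi; have := hg _ wj; rewrite -e -[g i]cats0 => aj.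
by have [] := code_accepts_prefix q0 ai aj.
Qed.

(** * Rational decompositions of positive semidefinite matrices *)

Section Gaussian.
Variable F : realFieldType.
Local Open Scope ring_scope.
Local Notation C := F[i]%C.
Implicit Types (x y z c : C) (r : F).

Lemma conjcD x y : conjc (x + y) = conjc x + conjc y.
Proof. by case: x y => a b [c d]; congr Complex; rewrite /= opprD. Qed.

Lemma conjcM x y : conjc (x * y) = conjc x * conjc y.
Proof. by case: x y => a b [c d]; congr Complex; rewrite /= ?mulrN ?mulNr ?opprK ?opprD //; ring. Qed.

Lemma conjcN x : conjc (- x) = - conjc x.
Proof. by case: x. Qed.

Lemma conjcKr x : conjc (conjc x) = x.
Proof. by case: x => a b; rewrite /conjc /= opprK. Qed.

Lemma conjc0r : conjc (0 : C) = 0.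
Proof. by congr Complex; rewrite oppr0. Qed.

Lemma conjc1r : conjc (1 : C) = 1.
Proof. by congr Complex; rewrite oppr0. Qed.

Lemma conjc_sum (I : Type) (s : seq I) (P : pred I) (f : I -> C) :
  conjc (\sum_(i <- s | P i) f i) = \sum_(i <- s | P i) conjc (f i).
Proof. exact: (big_morph _ conjcD conjc0r). Qed.

Lemma Re_add x y : complex.Re (x + y) = complex.Re x + complex.Re y.
Proof. by case: x y => a b [c d]. Qed.

Lemma Re_sum (I : Type) (s : seq I) (P : pred I) (f : I -> C) :
  complex.Re (\sum_(i <- s | P i) f i) = \sum_(i <- s | P i) complex.Re (f i).
Proof. exact: (big_morph _ Re_add erefl). Qed.

Definition ofR r : C := Complex r 0.

Lemma ofRD r s : ofR (r + s) = ofR r + ofR s.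
Proof. by congr Complex; rewrite addr0. Qed.
Lemma ofRM r s : ofR (r * s) = ofR r * ofR s.
Proof. by congr Complex; ring. Qed.
Lemma ofRN r : ofR (- r) = - ofR r.
Proof. by congr Complex; rewrite oppr0. Qed.
Lemma conjc_ofR r : conjc (ofR r) = ofR r.
Proof. by congr Complex; rewrite oppr0. Qed.
Lemma Re_ofRM r x : complex.Re (ofR r * x) = r * complex.Re x.
Proof. by case: x => a b /=; ring. Qed.

Definition nsq x : F := complex.Re x ^+ 2 + complex.Im x ^+ 2.

Lemma nsq_ge0 x : 0 <= nsq x.
Proof. by rewrite addr_ge0 ?sqr_ge0. Qed.

Lemma mul_conjc x : x * conjc x = ofR (nsq x).
Proof. by case: x => a b; congr Complex; rewrite /nsq /=; ring. Qed.

Lemma nsq_eq0 x : nsq x = 0 -> x = 0.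
Proof.
case: x => a b /eqP; rewrite /nsq /= paddr_eq0 ?sqr_ge0 // !sqrf_eq0.
by move=> /andP[/eqP -> /eqP ->].
Qed.

Lemma nsqM x y : nsq (x * y) = nsq x * nsq y.
Proof. by case: x y => a b [c d]; rewrite /nsq /=; ring. Qed.

Lemma nsq_ofR r : nsq (ofR r) = r ^+ 2.
Proof. by rewrite /nsq /=; ring. Qed.

Section Form.
Variable d : nat.
Implicit Types (u v w : nat -> C) (A : nat -> nat -> C).

(** Matrices are functions on numbers of which only the entries below [d] count, because the
    dimension is itself computed during the search. *)
Definition form A u v : C := \sum_(a < d) \sum_(b < d) conjc (u a) * A a b * v b.
Definition hermitian A := forall a b, (a < d)%N -> (b < d)%N -> A b a = conjc (A a b).
Definition psd_form A := forall v, 0 <= complex.Re (form A v v).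

Definition delta (k : nat) : nat -> C := fun a => (a == k)%:R.

Lemma formDr A u v w c : form A u (fun b => v b + c * w b) = form A u v + c * form A u w.
Proof.
rewrite /form mulr_sumr -big_split; apply: eq_bigr => a _ /=.
by rewrite mulr_sumr -big_split; apply: eq_bigr => b _ /=; ring.
Qed.

Lemma form_conj A u v : hermitian A -> form A v u = conjc (form A u v).
Proof.
move=> hA; rewrite /form exchange_big conjc_sum; apply: eq_bigr => a _.
rewrite conjc_sum; apply: eq_bigr => b _.
by rewrite !conjcM conjcKr (hA a b) //; ring.
Qed.

Lemma form_expand A v w c : hermitian A ->
  form A (fun b => v b + c * w b) (fun b => v b + c * w b) =
  form A v v + c * form A v w + conjc (c * form A v w) + ofR (nsq c) * form A w w.
Proof.
move=> hA; pose x b := v b + c * w b.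
have -> : form A (fun b => v b + c * w b) (fun b => v b + c * w b) =
    form A x v + c * form A x w by rewrite -formDr.
rewrite (form_conj v x hA) (form_conj w x hA).
have xE u : form A u x = form A u v + c * form A u w by rewrite -formDr.
rewrite !xE !conjcD.
rewrite -(form_conj v v hA) (form_conj v w hA) !conjcM conjcKr -(form_conj w w hA) -mul_conjc.
by ring.
Qed.

Lemma sum_delta k (f : nat -> C) : (k < d)%N -> \sum_(a < d) delta k a * f a = f k.
Proof.
move=> kd; rewrite (bigD1 (Ordinal kd)) //= big1 ?addr0 => [|i ik].
  by rewrite /delta eqxx mul1r.
rewrite /delta (_ : (nat_of_ord i == k) = false) ?mul0r //.
by apply/negbTE; move: ik; rewrite -val_eqE.
Qed.

Lemma conjc_delta k a : conjc (delta k a) = delta k a.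
Proof. by rewrite /delta; case: (_ == _); rewrite ?conjc0r ?conjc1r. Qed.

Lemma form_delta_r A u k : (k < d)%N -> form A u (delta k) = \sum_(a < d) conjc (u a) * A a k.
Proof.
move=> kd; apply: eq_bigr => a _.
rewrite -[RHS](sum_delta (fun b => conjc (u a) * A a b) kd).
by apply: eq_bigr => b _; ring.
Qed.

Lemma form_delta A j k : (j < d)%N -> (k < d)%N -> form A (delta j) (delta k) = A j k.
Proof.
move=> jd kd; rewrite form_delta_r // -[RHS](sum_delta (fun a => A a k) jd).
by apply: eq_bigr => a _; rewrite conjc_delta.
Qed.

(** Otherwise the form at [e_j - s A_ij e_i] equals [A_jj - 2 s |A_ij|^2], and the chosen [s] makes
    this negative. *)
Lemma psd_row0 A i j : hermitian A -> psd_form A -> (i < d)%N -> (j < d)%N ->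
  A i i = 0 -> A i j = 0.
Proof.
move=> hA pA id jd Aii.
apply: nsq_eq0; apply/eqP; apply/negPn/negP => c0.
have cp : 0 < nsq (A i j) by rewrite lt0r c0 nsq_ge0.
pose s := (complex.Re (A j j) + 1) / nsq (A i j).
have := pA (fun b => delta j b + (- (ofR s * A i j)) * delta i b).
rewrite form_expand // !form_delta // Aii mulr0 addr0 (hA i j) //.
have -> : - (ofR s * A i j) * conjc (A i j) = ofR (- (complex.Re (A j j) + 1)).
  rewrite mulNr -mulrA mul_conjc -ofRM -ofRN /s; congr (ofR (- _)).
  by rewrite divfK // gt_eqF.
rewrite conjc_ofR !Re_add /=.
have := pA (delta j); rewrite form_delta //.
lra.
Qed.

Lemma herm_diag A k : hermitian A -> (k < d)%N -> A k k = ofR (complex.Re (A k k)).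
Proof.
move=> hA kd; have := hA k k kd kd; case: (A k k) => a b [/eqP].
by rewrite -addr_eq0 -mulr2n mulrn_eq0 /= => /eqP ->.
Qed.

(** Schur complement of the pivot [A k k]. *)
Definition deflate A k : nat -> nat -> C :=
  fun a b => A a b - ofR (complex.Re (A k k))^-1 * (A a k * A k b).

Lemma deflate_herm A k : hermitian A -> (k < d)%N -> hermitian (deflate A k).
Proof.
move=> hA kd a b ad bd; rewrite /deflate conjcD conjcN !conjcM conjc_ofR.
by rewrite (hA a b) // (hA a k) // -(hA k b) //; ring.
Qed.

(** With [c] the form of [A] at [v] and [e_k], the new form at [v] is the form of [A] at
    [v - (conj c / A_kk) e_k]: completing the square. *)
Lemma deflate_psd A k : hermitian A -> psd_form A -> (k < d)%N -> A k k != 0 ->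
  psd_form (deflate A k).
Proof.
move=> hA pA kd A0 v.
set al := complex.Re (A k k).
have al0 : al != 0 by apply: contra A0 => /eqP e; rewrite herm_diag // -/al e.
pose c := form A v (delta k).
have -> : form (deflate A k) v v = form A v v - ofR al^-1 * ofR (nsq c).
  have -> : ofR al^-1 * ofR (nsq c) = \sum_(a < d) \sum_(b < d)
     conjc (v a) * (ofR al^-1 * (A a k * A k b)) * v b.
    rewrite -mul_conjc /c {2}form_delta_r // conjc_sum mulrC -mulrA [X in X * _]form_delta_r //.
    rewrite mulr_suml; apply: eq_bigr => a _.
    rewrite mulr_suml mulr_sumr; apply: eq_bigr => b _.
    by rewrite conjcM conjcKr -(hA b k) //; ring.
  rewrite /form -sumrB; apply: eq_bigr => a _; rewrite -sumrB; apply: eq_bigr => b _.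
  by rewrite /deflate; ring.
have := pA (fun b => v b + (- (ofR al^-1 * conjc c)) * delta k b).
rewrite form_expand // -/c form_delta // [A k k]herm_diag // -/al.
have -> : - (ofR al^-1 * conjc c) * c = - ofR (al^-1 * nsq c).
  by rewrite ofRM -mul_conjc; ring.
rewrite -!ofRM -!ofRN conjc_ofR !Re_add /=.
have -> : nsq (- (ofR al^-1 * conjc c)) = al^-1 ^+ 2 * nsq c.
  by rewrite /nsq; case: (c) => a b /=; ring.
have -> : al^-1 ^+ 2 * nsq c * al = al^-1 * nsq c.
  by rewrite expr2 mulrAC -(mulrA al^-1) mulVf // mulr1.
lra.
Qed.

Lemma deflate_diag A k : hermitian A -> psd_form A -> (k < d)%N -> A k k != 0 ->
  deflate A k k k = 0 /\
  forall a, (a < d)%N -> A a a = 0 -> deflate A k a a = 0.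
Proof.
move=> hA pA kd A0; split; last first.
  by move=> a ad a0; rewrite /deflate a0 (psd_row0 (i := a) (j := k) hA) // mul0r mulr0 subrr.
have al0 : complex.Re (A k k) != 0 by apply: contra A0 => /eqP e; rewrite herm_diag // e.
rewrite /deflate; move: (herm_diag hA kd) al0; move: (complex.Re (A k k)) => al -> al0.
by rewrite -!ofRM mulrA mulVf // mul1r subrr.
Qed.

(** Induction on the number of nonzero diagonal entries: deflation kills the pivot and keeps the
    zeros, and a zero diagonal means a zero matrix. The weights stay apart from the vectors, so no
    square root leaves the field. *)
Lemma psd_decomposition A : hermitian A -> psd_form A ->
  exists2 s : seq (F * (nat -> C)), all (fun p => 0 <= p.1) s &
    forall a b, (a < d)%N -> (b < d)%N ->
      A a b = \sum_(p <- s) ofR p.1 * (p.2 a * conjc (p.2 b)).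
Proof.
have [m hm] : exists m, #|[set i : 'I_d | A i i != 0]| = m by eexists.
elim/ltn_ind: m A hm => m IH A hm hA pA.
have [z|[k]] := set_0Vmem [set i : 'I_d | A i i != 0].
  exists [::] => // a b ad bd; rewrite big_nil; apply: psd_row0 => //.
  by apply/eqP; move/setP/(_ (Ordinal ad)): z; rewrite !inE /= => /negbFE.
rewrite inE => k0; have kd := ltn_ord k.
have [dk dz] := deflate_diag hA pA kd k0.
pose S := [set i : 'I_d | deflate A k i i != 0].
have lt : (#|S| < m)%N.
  rewrite -hm; apply: proper_card; apply/properP; split.
    apply/fintype.subsetP => i; rewrite !inE; apply: contra => /eqP e.
    by apply/eqP; exact: dz.
  by exists k; rewrite !inE ?k0 // dk eqxx.
have [s s0 hs] := IH _ lt _ erefl (deflate_herm hA kd) (deflate_psd hA pA kd k0).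
exists (((complex.Re (A k k))^-1, A^~ k) :: s) => [|a b ad bd].
  rewrite /= s0 andbT invr_ge0.
  by have := pA (delta k); rewrite form_delta.
by rewrite big_cons -hs //= /deflate -(hA b k) //; ring.
Qed.

End Form.
End Gaussian.

(** * Decompositions into rational unit vectors, as checkable certificates *)

Section Certificates.
Local Open Scope ring_scope.

(** For [N = a / b] take [t = u / b] with the least [u] such that [a b <= u^2]. Minimality gives
    [(u - 1)^2 < a b], and [u <= 2 (u - 1)] unless [u = 1]. *)
Lemma sqrt_approx (N : rat) : 0 < N -> exists2 t, 0 < t & N <= t ^+ 2 <= 4 * N.
Proof.
move=> N0; pose a := `|numq N|%N; pose b := `|denq N|%N.
have b0 : (0 < b)%N by rewrite absz_gt0 denq_neq0.
have a0 : (0 < a)%N by rewrite absz_gt0 numq_eq0 gt_eqF.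
have NE : N = a%:R / b%:R.
  rewrite -[LHS]divq_num_den /a /b; congr (_ / _).
    by rewrite natr_absz ger0_norm // numq_ge0 ltW.
  by rewrite natr_absz gtr0_norm // denq_gt0.
have ex : exists u, (a * b <= u ^ 2)%N.
  by exists (a * b)%N; rewrite leq_pmulr // muln_gt0 a0.
have [u hu umin] := ex_minnP ex.
have u0 : (0 < u)%N by case: (u) hu => //; rewrite exp0n // leqn0 muln_eq0; lia.
have hu4 : (u ^ 2 <= 4 * (a * b))%N.
  case: u u0 hu umin => // -[|u] _ hu umin; first by rewrite muln_gt0 /= muln_gt0 a0.
  have : ~~ (a * b <= u.+1 ^ 2)%N by apply/negP => /umin; rewrite ltnn.
  rewrite -ltnNge => h; apply: leq_trans (_ : 4 * u.+1 ^ 2 <= _)%N; last by lia.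
  by rewrite -(expnMn 2 _ 2) leq_exp2r //; lia.
have br : 0 < b%:R :> rat by rewrite ltr0n.
exists (u%:R / b%:R); first by rewrite divr_gt0 // ltr0n.
have -> : (u%:R / b%:R) ^+ 2 = (u ^ 2)%N%:R / (b ^ 2)%N%:R :> rat.
  by rewrite !natrX expr_div_n.
have -> : N = (a * b)%N%:R / (b ^ 2)%N%:R.
  by rewrite NE natrM natrX; field; rewrite gt_eqF.
have b2 : 0 < ((b ^ 2)%N%:R)^-1 :> rat by rewrite invr_gt0 ltr0n expn_gt0 b0.
by rewrite mulrA !ler_pM2r // -natrM !ler_nat hu.
Qed.

Definition vsq d (v : nat -> gq) : rat := \sum_(a < d) nsq (v a).

Lemma vsq_delta0 d : vsq d.+1 (delta _ 0) = 1.
Proof.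
by rewrite /vsq big_ord_recl big1 ?addr0.
Qed.

(* Rational vectors need not have a rational norm. With [N] the squared norm of
   [v] without its first entry, a rational [t] with [N <= t^2 <= 4 N] gives
   [z = (N / t + t) / 2] and [y = (N / t - t) / 2] with [z^2 = y^2 + N], so that
   [v] with first entry replaced by [y] has norm [z]; the rest is a multiple of
   the first basis vector. *)
Lemma unit_split d v : (0 < d)%N -> exists p : (gq * (nat -> gq)) * (gq * (nat -> gq)),
  [/\ vsq d p.1.2 = 1, vsq d p.2.2 = 1,
      forall a, (a < d)%N -> v a = p.1.1 * p.1.2 a + p.2.1 * p.2.2 a &
      nsq p.1.1 + nsq p.2.1 <= 6 * vsq d v].
Proof.
case: d => // d _; pose N := \sum_(i < d) nsq (v i.+1).
have vE : vsq d.+1 v = nsq (v 0%N) + N by rewrite /vsq big_ord_recl.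
have N0 : 0 <= N by apply: sumr_ge0 => i _; exact: nsq_ge0.
have v0 := nsq_ge0 (v 0%N).
have [Np|] := ltrP 0 N; last first.
  move=> Nn; have Nz : N = 0 by apply/eqP; rewrite eq_le Nn.
  exists ((v 0%N, delta _ 0), (0, delta _ 0)); split; rewrite /= ?vsq_delta0 //.
    move=> [_|a ad]; rewrite /delta /= ?mulr1 ?mulr0 ?mul0r ?addr0 //.
    apply: nsq_eq0; apply/eqP; move/eqP: Nz; rewrite psumr_eq0; last by move=> i _; exact: nsq_ge0.
    by move/allP/(_ (Ordinal (ad : a < d)%N)); rewrite mem_index_enum => /(_ isT).
  by rewrite vE Nz /nsq /=; move: v0; rewrite /nsq; lra.
have [t t0 /andP[t1 t2]] := sqrt_approx Np.
pose w := N / t; have wt : w * t = N by rewrite /w divfK // gt_eqF.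
have w0 : 0 < w by rewrite divr_gt0.
have wlet : w <= t by rewrite /w ler_pdivrMr // -expr2.
pose z := (w + t) / 2; pose y := (w - t) / 2.
have zy : z ^+ 2 = y ^+ 2 + N by rewrite /z /y -wt; field.
have z0 : z != 0 by rewrite gt_eqF // /z; lra.
exists ((ofR z, fun a => ofR z^-1 * (if a is 0%N then ofR y else v a)), (v 0%N - ofR y, delta _ 0)).
split; rewrite /= ?vsq_delta0 //.
- have -> : vsq d.+1 (fun a => ofR z^-1 * (if a is 0%N then ofR y else v a)) =
     z^-1 ^+ 2 * (y ^+ 2 + N).
    rewrite /vsq big_ord_recl /= nsqM !nsq_ofR mulrDr mulr_sumr; congr (_ + _).
    by apply: eq_bigr => i _; rewrite nsqM nsq_ofR.
  by rewrite -zy -exprMn mulVf // expr1n.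
- move=> a ad; rewrite mulrA -ofRM divff // mul1r /delta.
  by case: a ad => [|a] _ /=; rewrite ?mulr1 ?mulr0 ?addr0 // addrC subrK.
(* From [0 < w <= t] both [2 |y|] and [z] are at most [t], so [y^2 <= N] and [z^2 <= 4 N]. Hence the
   two coefficients cost at most [4 N + 2 |v_0|^2 + 2 N], which is where 6 comes from. *)
- have y2 : y ^+ 2 <= N.
    have : 4 * y ^+ 2 <= t ^+ 2; last by lra.
    have -> : 4 * y ^+ 2 = (t - w) ^+ 2 by rewrite /y; field.
    by rewrite ler_sqr ?nnegrE; lra.
  have z2 : z ^+ 2 <= 4 * N.
    apply: le_trans t2; rewrite ler_sqr ?nnegrE; rewrite /z; lra.
  have : nsq (v 0%N - ofR y) <= 2 * nsq (v 0%N) + 2 * y ^+ 2.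
    case: (v 0%N) => a b; rewrite /nsq /=.
    by have := sqr_ge0 (a + y); have := sqr_ge0 b; nra.
  by rewrite vE nsq_ofR; lra.
Qed.

(** A weight and a vector that is given as a combination of two unit vectors, each paired with its
    coefficient. *)
Definition item := (rat * ((gq * seq gq) * (gq * seq gq)))%type.

Definition item_vec (it : item) (a : nat) : gq :=
  it.2.1.1 * nth 0 it.2.1.2 a + it.2.2.1 * nth 0 it.2.2.2 a.
Definition unit_seq d (s : seq gq) :=
  (size s == d) && (\sum_(a < d) nsq (nth 0 s a) == 1).
Definition item_ok d (it : item) :=
  [&& 0 <= it.1, unit_seq d it.2.1.2 & unit_seq d it.2.2.2].
Definition item_cost (it : item) : rat := it.1 * (nsq it.2.1.1 + nsq it.2.2.1).

Definition trace_sum d (A : nat -> nat -> gq) : rat := \sum_(a < d) complex.Re (A a a).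

(** The cost has to be checked as well: large coefficients that cancel in [item_vec] would satisfy
    the equations for the entries. *)
Definition certifies d (A : nat -> nat -> gq) (s : seq item) :=
  [&& all (item_ok d) s,
      all (fun a => all (fun b =>
        A a b == \sum_(it <- s) ofR it.1 * (item_vec it a * conjc (item_vec it b)))
        (iota 0 d)) (iota 0 d) &
      \sum_(it <- s) item_cost it <= 6 * trace_sum d A].

Lemma certifiesP d A s : reflect
  [/\ forall it, it \in s -> item_ok d it,
      forall a b, (a < d)%N -> (b < d)%N ->
        A a b = \sum_(it <- s) ofR it.1 * (item_vec it a * conjc (item_vec it b)) &
      \sum_(it <- s) item_cost it <= 6 * trace_sum d A] (certifies d A s).
Proof.
apply: (iffP and3P) => -[h1 h2 h3]; split=> //.
- exact/allP.
- move=> a b ad bd; apply/eqP; move/allP/(_ a): h2.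
  by rewrite mem_iota => /(_ ad)/allP/(_ b); rewrite mem_iota => /(_ bd).
- exact/allP.
- apply/allP => a; rewrite mem_iota => ad; apply/allP => b; rewrite mem_iota => bd.
  by apply/eqP; apply: h2.
Qed.

Lemma certificate_exists d A : (0 < d)%N -> hermitian d A -> psd_form d A ->
  exists s, certifies d A s.
Proof.
move=> d0 hA pA; have [s s0 hs] := psd_decomposition hA pA.
have [g hg] := choice (fun v => unit_split v d0).
pose mk (p : rat * (nat -> gq)) : item := (p.1,
  (((g p.2).1.1, mkseq (g p.2).1.2 d), ((g p.2).2.1, mkseq (g p.2).2.2 d))).
have mkE p a : (a < d)%N -> item_vec (mk p) a = p.2 a.
  by move=> ad; have [_ _ h _] := hg p.2; rewrite /item_vec /= !nth_mkseq // [RHS]h.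
exists [seq mk p | p <- s]; apply/certifiesP; split.
- move=> it /mapP[p ps ->]; have [h1 h2 _ _] := hg p.2.
  rewrite /item_ok /= (allP s0) //= /unit_seq !size_mkseq !eqxx /=.
  rewrite -[X in _ && (_ == X)]h2 -[X in (_ == X) && _]h1.
  by apply/andP; split; apply/eqP/eq_bigr => a _; rewrite nth_mkseq.
- move=> a b ad bd; rewrite big_map hs //; apply: eq_bigr => p _.
  by rewrite !mkE.
rewrite big_map /trace_sum mulr_sumr.
(* The trace is the weighted sum of the squared norms, so the bound of [unit_split] can be summed
   term by term. *)
have -> : \sum_(i < d) 6 * complex.Re (A i i) = \sum_(p <- s) p.1 * (6 * vsq d p.2).
  under eq_bigr do rewrite hs // Re_sum mulr_sumr.
  rewrite exchange_big /=; apply: eq_bigr => p _; rewrite /vsq !mulr_sumr.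
  by apply: eq_bigr => a _; rewrite Re_ofRM mul_conjc /=; ring.
rewrite [X in X <= _]big_seq [X in _ <= X]big_seq; apply: ler_sum => p ps.
by rewrite /item_cost /= ler_wpM2l ?(allP s0) //; have [] := hg p.2.
Qed.

End Certificates.

(** * Transferring a universal matrix to another conditional string *)

#[global] Hint Transparent bitstr : prdb.

Lemma PR_code_nat (A : Type) {EA : Enc A} (f : A -> nat) : PR f -> PR (fun x => code_nat (f x)).
Proof. by move=> hf; rewrite /code_nat; prt. Qed.
#[global] Hint Resolve PR_code_nat : prdb.

Lemma PR_code_pair (A : Type) {EA : Enc A} (f g : A -> seq bool) :
  PR f -> PR g -> PR (fun x => code_pair (f x) (g x)).
Proof. by move=> hf hg; rewrite /code_pair; prt. Qed.
#[global] Hint Resolve PR_code_pair : prdb.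

Lemma PR_code_int (A : Type) {EA : Enc A} (f : A -> int) : PR f -> PR (fun x => code_int (f x)).
Proof. by move=> hf; rewrite /code_int; prt. Qed.
#[global] Hint Resolve PR_code_int : prdb.

Lemma PR_code_ratC (A : Type) {EA : Enc A} (f : A -> gq) :
  PR f -> PR (fun x => code_ratC (f x)).
Proof. by move=> hf; rewrite /code_ratC /code_rat; prt. Qed.
#[global] Hint Resolve PR_code_ratC : prdb.

(** What [code_mx] gives for the column vector with entries [s]. *)
Definition code_vec (s : seq gq) : seq bool :=
  code_nat (size s) ++ code_nat 1 ++ flatten [seq code_ratC z | z <- s].

Lemma PR_code_vec (A : Type) {EA : Enc A} (f : A -> seq gq) :
  PR f -> PR (fun x => code_vec (f x)).
Proof. by move=> hf; rewrite /code_vec; prt. Qed.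
#[global] Hint Resolve PR_code_vec : prdb.

Lemma code_nat_inj m n u v : code_nat m ++ u = code_nat n ++ v -> m = n /\ u = v.
Proof.
rewrite /code_nat; elim: m n => [|m IH] [|n] //=; first by case.
by case=> /IH [-> ->].
Qed.

Lemma code_int_inj a b u v : code_int a ++ u = code_int b ++ v -> a = b /\ u = v.
Proof.
rewrite /code_int /= => -[e1] /code_nat_inj [e2 ->]; split=> //.
by move: e1 e2; case: (a) => n; case: (b) => m //= _; lia.
Qed.

Lemma code_ratC_inj a b u v : code_ratC a ++ u = code_ratC b ++ v -> a = b /\ u = v.
Proof.
rewrite /code_ratC /code_rat -!catA.
move=> /code_int_inj [e1] /code_int_inj [e2] /code_int_inj [e3] /code_int_inj [e4 ->].
split=> //; case: a b e1 e2 e3 e4 => a a' [b b'] /= e1 e2 e3 e4; congr Complex.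
  by rewrite -[a]divq_num_den -[b]divq_num_den e1 e2.
by rewrite -[a']divq_num_den -[b']divq_num_den e3 e4.
Qed.

Lemma code_entries_inj (s t : seq gq) u v : size s = size t ->
  flatten [seq code_ratC z | z <- s] ++ u = flatten [seq code_ratC z | z <- t] ++ v ->
  s = t /\ u = v.
Proof.
have E (f : gq -> seq bool) z r w :
  flatten [seq f x | x <- z :: r] ++ w = f z ++ (flatten [seq f x | x <- r] ++ w) by rewrite /= -catA.
elim: s t => [|a s IH] [|b t] // [st]; rewrite !E => /code_ratC_inj [-> e].
by have [-> ->] := IH _ st e.
Qed.

Lemma code_vec_inj : injective code_vec.
Proof.
move=> s t; rewrite /code_vec => /code_nat_inj [st] /code_nat_inj [_].
rewrite -[flatten _]cats0 -[RHS]cats0 => e.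
by have [] := code_entries_inj st e.
Qed.

Section CertPR.
Local Open Scope ring_scope.
Context {A : Type} {EA : Enc A}.

Lemma PR_nsq (f : A -> gq) : PR f -> PR (fun x => nsq (f x)).
Proof.
move=> hf; apply: (PR_ext (f := fun x => complex.Re (f x) * complex.Re (f x) +
  complex.Im (f x) * complex.Im (f x))); last by prt.
by move=> x; rewrite /nsq !expr2.
Qed.

Lemma PR_ofR (f : A -> rat) : PR f -> PR (fun x => ofR (f x)).
Proof. by move=> hf; rewrite /ofR; prt. Qed.

Lemma PR_item_vec (f : A -> item) (a : A -> nat) : PR f -> PR a ->
  PR (fun x => item_vec (f x) (a x)).
Proof. by move=> hf ha; rewrite /item_vec; prt. Qed.

End CertPR.
#[global] Hint Resolve PR_item_vec : prdb.
#[global] Hint Extern 2 (PR (fun _ => nsq _)) => apply PR_nsq : prdb.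
#[global] Hint Extern 2 (PR (fun _ => ofR _)) => apply PR_ofR : prdb.

Section CertPR2.
Local Open Scope ring_scope.
Context {A : Type} {EA : Enc A}.

Lemma PR_unit_seq (d : A -> nat) (s : A -> seq gq) : PR d -> PR s ->
  PR (fun x => unit_seq (d x) (s x)).
Proof.
move=> hd hs; rewrite /unit_seq.
have h : PR (fun x => \sum_(a < d x) nsq (nth 0 (s x) a)).
  by apply: (PR_sum_ord_rat (F := fun x a => nsq (nth 0 (s x) a))) => //; prt.
prt.
Qed.

End CertPR2.
#[global] Hint Resolve PR_unit_seq : prdb.

Section CertPR3.
Local Open Scope ring_scope.
Context {A : Type} {EA : Enc A}.

Lemma PR_certifies (d : A -> nat) (M : A -> nat -> nat -> gq) (s : A -> seq item) :
  PR d -> PR (fun p => M p.1.1 p.1.2 p.2) -> PR s ->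
  PR (fun x => certifies (d x) (M x) (s x)).
Proof.
move=> hd hM hs.
have ht : PR (fun x => trace_sum (d x) (M x)).
  apply: (PR_sum_ord_rat (F := fun x a => complex.Re (M x a a))) => //.
  prt.
have hi : PR (fun p : A * item => item_ok (d p.1) p.2).
  rewrite /item_ok. prt.
have hc : PR item_cost.
  rewrite /item_cost. prt.
have hv : PR (fun p : (A * nat) * nat => \sum_(it <- s p.1.1)
    ofR it.1 * (item_vec it p.1.2 * conjc (item_vec it p.2))).
  prt.
rewrite /certifies.
prt.
Qed.

End CertPR3.
#[global] Hint Resolve PR_certifies : prdb.

Section TransferMachine.
Local Open Scope ring_scope.
Variable U : TM.
Context {X : Type} {EX : Enc X} {DX : @Decodable X EX}.
Variables (target source : X -> seq bool) (dim sdim gain : X -> nat).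
Variables (mat : X -> seq gq -> nat -> nat -> gq) (loss : nat).
Hypothesis PR_target : PR target.
Hypothesis PR_source : PR source.
Hypothesis PR_dim : PR dim.
Hypothesis PR_sdim : PR sdim.
Hypothesis PR_gain : PR gain.
Hypothesis PR_mat : PR (fun p : ((X * seq gq) * nat) * nat => mat p.1.1.1 p.1.1.2 p.1.2 p.2).

(** The parameter, the output vector of the program, and a certificate for their matrix. The decoder
    sees only the condition [target x], so [x] is guessed and then checked. *)
Definition witness := ((X * seq gq) * seq item)%type.

Definition witness_ok (y o : seq bool) (w : witness) : bool :=
  [&& target w.1.1 == y, code_vec w.1.2 == o, unit_seq (sdim w.1.1) w.1.2 &
      certifies (dim w.1.1) (mat w.1.1 w.1.2) w.2].

Definition valid (y p : seq bool) (t n : nat) : bool :=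
  match run_out U (source (de n : witness).1.1) p t with
  | Some o => witness_ok y o (de n)
  | None => false
  end.

(* The least witness is used, so that each halting program contributes once. *)
Definition least_valid (y p : seq bool) (t n : nat) : bool :=
  valid y p t n && all (fun m => ~~ valid y p t m) (iota 0 n).

Definition item_outs (it : item) : seq (rat * seq gq) :=
  [:: (it.1 * nsq it.2.1.1, it.2.1.2); (it.1 * nsq it.2.2.1, it.2.2.2)].
Definition outs (s : seq item) : seq (rat * seq gq) := flatten [seq item_outs it | it <- s].

(** [gain] is the exponent of the amplification, [2^H(rho)] in the main use; [loss] normalises the
    total weight to at most 1. *)
Definition factor (x : X) (p : seq bool) : rat :=
  (2 ^ gain x)%N%:R / loss.+1%:R * bits_unit p.

Definition out_at (w : witness) (i : nat) : rat * seq gq := nth (0, [::]) (outs w.2) i.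

(** The index codes a program, its halting time, a witness number and a position among the unit
    vectors of the certificate. The test [en J == j] discards numbers that are not codes, which
    would repeat requests. *)
Definition requests (y : seq bool) (j : nat) : option (rat * seq bool) :=
  let J := de j : (seq bool * nat) * (nat * nat) in
  let w := de J.2.1 : witness in
  if [&& en J == j, least_valid y J.1.1 J.1.2 J.2.1 & (J.2.2 < size (outs w.2))%N]
  then Some (factor w.1.1 J.1.1 * (out_at w J.2.2).1, code_vec (out_at w J.2.2).2)
  else None.

Lemma PR_witness_ok : PR (fun p : (seq bool * seq bool) * witness => witness_ok p.1.1 p.1.2 p.2).
Proof.
rewrite /witness_ok.
have h : PR (fun p : (((seq bool * seq bool) * witness) * nat) * nat =>
   mat p.1.1.2.1.1 p.1.1.2.1.2 p.1.2 p.2).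
  have f : PR (fun p : (((seq bool * seq bool) * witness) * nat) * nat =>
    (((p.1.1.2.1.1, p.1.1.2.1.2), p.1.2), p.2)) by prt.
  exact: (PR_comp PR_mat f).
have hc : PR (fun p : (seq bool * seq bool) * witness =>
    certifies (dim p.2.1.1) (mat p.2.1.1 p.2.1.2) p.2.2).
  apply: (PR_certifies (M := fun p : (seq bool * seq bool) * witness => mat p.2.1.1 p.2.1.2)).
  - by prt.
  - exact: h.
  - by prt.
by prt.
Qed.

Lemma PR_valid : PR (fun p : (seq bool * seq bool) * (nat * nat) => valid p.1.1 p.1.2 p.2.1 p.2.2).
Proof.
rewrite /valid; apply: PR_omatch; [by prt| |by prt].
have f : PR (fun p : ((seq bool * seq bool) * (nat * nat)) * seq bool =>
  ((p.1.1.1, p.2), de p.1.2.2 : witness)) by prt.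
exact: (PR_comp PR_witness_ok f).
Qed.

Lemma PR_requests : PR (fun p => requests p.1 p.2).
Proof.
have hv (A : Type) (EA : Enc A) (y p : A -> seq bool) (t n : A -> nat) :
    PR y -> PR p -> PR t -> PR n -> PR (fun x => valid (y x) (p x) (t x) (n x)).
  move=> hy hp ht hn.
  exact: (PR_comp PR_valid (PR_pair (PR_pair hy hp) (PR_pair ht hn))).
have hl (A : Type) (EA : Enc A) (y p : A -> seq bool) (t n : A -> nat) :
    PR y -> PR p -> PR t -> PR n -> PR (fun x => least_valid (y x) (p x) (t x) (n x)).
  move=> hy hp ht hn; rewrite /least_valid; apply: PR_andb; first exact: hv.
  apply: PR_all; last by prt.
  by apply: PR_negb; apply: hv; prt.
rewrite /requests; apply: PR_if; last by prt.
- apply: PR_andb; first by prt.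
  apply: PR_andb; first by apply: hl; prt.
  by rewrite /outs /item_outs; prt.
- rewrite /factor /out_at /outs /item_outs.
  by prt.
Qed.

End TransferMachine.

(** * Sums of nonnegative families *)

Section Esum.
Context {R : realType}.
Local Open Scope ring_scope.
Local Open Scope classical_set_scope.
Local Open Scope ereal_scope.

Lemma esum_subset (T : choiceType) (A B : set T) (f : T -> \bar R) :
  A `<=` B -> \esum_(i in A) f i <= \esum_(i in B) f i.
Proof.
move=> AB; apply: ge_ereal_sup => _ [F [finF FA]] <-.
by apply: ereal_sup_ubound; exists F => //; split=> // x /FA /AB.
Qed.

Lemma esum_support (T : choiceType) (A B : set T) (f : T -> \bar R) :
  (forall i, A i -> 0 <= f i) -> (forall i, A i -> ~ B i -> f i = 0) ->
  \esum_(i in A) f i = \esum_(i in A `&` B) f i.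
Proof.
move=> f0 fB; rewrite (esumID B) // [X in _ + X]esum1 ?adde0 // => i [Ai nBi].
exact: fB.
Qed.

Lemma esum_inj_le (T T' : choiceType) (A : set T) (B : set T') (e : T -> T')
    (f : T' -> \bar R) :
  set_inj A e -> (forall i, A i -> B (e i)) ->
  \esum_(i in A) f (e i) <= \esum_(j in B) f j.
Proof.
move=> ie AB; rewrite -(@esum_image _ _ _ _ _ f ie); apply: esum_subset => _ [i Ai <-].
exact: AB.
Qed.

Lemma esum_ord n (f : nat -> \bar R) : (forall i, (i < n)%N -> 0 <= f i) ->
  \esum_(i in `I_n) f i = \sum_(i < n) f i.
Proof.
move=> f0; rewrite esum_fset //; last by move=> i /set_mem; exact: f0.
by rewrite -fsbig_ord.
Qed.

(** One inequality, proved for every positive factor, is applied to [c] and to [c^-1]. *)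
Lemma esumZ (T : choiceType) (A : set T) (f : T -> \bar R) (c : R) : (0 < c)%R ->
  (forall i, 0 <= f i) -> \esum_(i in A) (c%:E * f i) = c%:E * \esum_(i in A) f i.
Proof.
have le (b : R) (g : T -> \bar R) : (0 < b)%R -> (forall i, 0 <= g i) ->
    \esum_(i in A) (b%:E * g i) <= b%:E * \esum_(i in A) g i.
  move=> b0 g0; apply: ge_ereal_sup => _ [F [finF FA]] <-.
  rewrite -ge0_mule_fsumr // lee_pmul2l ?lte_fin //.
  by apply: esum_ge; exists F.
move=> c0 f0; apply/eqP; rewrite eq_le le //= -lee_pdivlMl //.
have h i : 0 <= c%:E * f i by apply: mule_ge0 => //; rewrite lee_fin ltW.
have ci : (0 < c^-1)%R by rewrite invr_gt0.
apply: le_trans; last exact: (le c^-1%R (fun i => c%:E * f i)%E ci h).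
rewrite le_eqVlt; apply/orP; left; apply/eqP; apply: eq_esum => i _.
by rewrite muleA -EFinM mulVf ?gt_eqF // mul1e.
Qed.

End Esum.

(** * The requests at a fixed condition *)

Section Transfer.
Context {R : realType}.
Local Open Scope ring_scope.
Local Open Scope classical_set_scope.
Variable U : TM.
Context {X : Type} {EX : Enc X} {DX : @Decodable X EX}.
Variables (target source : X -> seq bool) (dim sdim gain : X -> nat).
Variables (mat : X -> seq gq -> nat -> nat -> gq) (loss : nat).
Hypothesis target_inj : injective target.

Local Notation requests := (requests U target source dim sdim gain mat loss).
Local Notation valid := (valid U target source dim sdim mat).
Local Notation least_valid := (least_valid U target source dim sdim mat).
Local Notation factor := (factor gain loss).

(** Vectors are paired with programs because the transfer moves the weight of each program
    separately. *)
Definition halting (y : seq bool) (d : nat) : set (seq gq * seq bool) :=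
  [set k | unit_seq d k.1 /\ tm_eval U y k.2 (code_vec k.1)].

Definition length_weight (p : seq bool) : R := 2 ^- size p.

Lemma length_weightE p : length_weight p = ratr (bits_unit p).
Proof. by rewrite /length_weight /bits_unit fmorphV /= ratr_nat natrX. Qed.

Lemma length_weight_ge0 p : 0 <= length_weight p.
Proof. by rewrite /length_weight invr_ge0 exprn_ge0. Qed.

Variable x : X.
Hypothesis dim_gt0 : (0 < dim x)%N.
Hypothesis mat_psd : forall phi, unit_seq (sdim x) phi ->
  hermitian (dim x) (mat x phi) /\ psd_form (dim x) (mat x phi).

Local Notation src := (halting (source x) (sdim x)).

Lemma least_witness k : src k -> exists tn : nat * nat,
  [/\ least_valid (target x) k.2 tn.1 tn.2, (de tn.2 : witness).1 = (x, k.1) &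
      certifies (dim x) (mat x k.1) (de tn.2 : witness).2].
Proof.
case: k => phi p; case=> u /= /run_outP [t ht].
have [hm pm] := mat_psd u.
have [s hs] := certificate_exists dim_gt0 hm pm.
have ex : exists n, valid (target x) p t n.
  exists (en ((x, phi), s)); rewrite /valid deK /= ht /witness_ok /=.
  by rewrite !eqxx u.
have [n vn nmin] := ex_minnP ex.
exists (t, n); move: (vn); rewrite /valid.
case e: (run_out _ _ _ _) => [r|] //= /and4P[/eqP /target_inj h1 /eqP h2 h3 h4].
have h5 : (de n : witness).1.2 = phi.
  by apply: code_vec_inj; rewrite h2; move: e; rewrite h1 ht; case.
split.
- rewrite /least_valid vn; apply/allP => m; rewrite mem_iota => mn.
  by apply/negP => /nmin; lia.
- by rewrite [LHS]surjective_pairing h1 h5.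
- by rewrite -{1}h1 -h1 -h5.
Qed.

(** Injectivity of [target] makes both witnesses name the same parameter, hence the same run of [p]
    and the same halting time. *)
Lemma least_valid_uniq y p t t' n n' : least_valid y p t n -> least_valid y p t' n' ->
  t = t' /\ n = n'.
Proof.
move=> /andP[v m] /andP[v' m'].
have tt : t = t'.
  move: (v) (v'); rewrite /valid.
  case e: (run_out _ _ _ _) => [r1|] // /and4P[/eqP h _ _ _].
  case e': (run_out _ _ _ _) => [r2|] // /and4P[/eqP h' _ _ _].
  move: e'; have -> : (de n' : witness).1.1 = (de n : witness).1.1.
    by apply: target_inj; rewrite h h'.
  by move=> e'; exact: run_out_time e e'.
split; first exact: tt.
subst t'; apply/eqP; rewrite eqn_leq; apply/andP; split; rewrite leqNgt; apply/negP => lt.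
  by move/allP/(_ n'): m; rewrite mem_iota lt v' => /(_ isT).
by move/allP/(_ n): m'; rewrite mem_iota lt v => /(_ isT).
Qed.

Definition sel (k : seq gq * seq bool) : nat * nat :=
  if pselect (src k) is left h then sval (cid (least_witness h)) else (0, 0).

Lemma selP k : src k ->
  [/\ least_valid (target x) k.2 (sel k).1 (sel k).2, (de (sel k).2 : witness).1 = (x, k.1) &
      certifies (dim x) (mat x k.1) (de (sel k).2 : witness).2].
Proof. by rewrite /sel; case: pselect => // h _; case: cid. Qed.

Definition items k : seq item := (de (sel k).2 : witness).2.

Definition slot (e : (seq gq * seq bool) * nat) : nat :=
  en ((e.1.2, (sel e.1).1), ((sel e.1).2, e.2)).

Definition slots : set ((seq gq * seq bool) * nat) :=
  src `*`` (fun k => `I_(size (outs (items k)))).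

Definition out_of (e : (seq gq * seq bool) * nat) : rat * seq gq :=
  nth (0, [::]) (outs (items e.1)) e.2.

Lemma requests_en y p t n i : requests y (en ((p, t), (n, i))) =
  let w := de n : witness in
  if least_valid y p t n && (i < size (outs w.2))%N
  then Some (factor w.1.1 p * (out_at w i).1, code_vec (out_at w i).2) else None.
Proof. by rewrite /requests deK eqxx. Qed.

Lemma requests_slot e : slots e -> requests (target x) (slot e) =
  Some (factor x e.1.2 * (out_of e).1, code_vec (out_of e).2).
Proof.
case: e => k i [/= /selP [lv e1 _] ik].
rewrite /slot requests_en lv; move: ik; rewrite /items => ->.
by rewrite e1.
Qed.

(** With [slot_inj] this turns sums over request numbers into sums over programs and the vectors of
    their certificates. *)
Lemma requests_slots j r : requests (target x) j = Some r -> exists2 e, slots e & j = slot e.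
Proof.
rewrite /requests; set J := de j; case: ifP => // /and3P[/eqP Jj lv ik] _.
move: (lv) => /andP[v _]; move: v; rewrite /valid.
case e: (run_out _ _ _ _) => [r1|] // /and4P[/eqP /target_inj h1 /eqP h2 h3 h4].
have [k kE] : exists k : seq gq * seq bool, k = ((de J.2.1 : witness).1.2, J.1.1) by eexists.
have sk : src k.
  rewrite kE /halting; split; first by move: h3; rewrite h1.
  by apply/run_outP; exists J.1.2; rewrite h2 -h1.
have [lv' _ _] := selP sk.
rewrite {1}kE in lv'; have [t1 n1] := least_valid_uniq lv lv'.
exists (k, J.2.2); first by split=> //=; rewrite /items -n1.
by rewrite /slot -t1 -n1 -Jj {1}kE; case: (J) => [ [a b] [c d] ].
Qed.

(** The number records the program but not its vector, which is recovered as the output of the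
    program. *)
Lemma slot_inj : set_inj slots slot.
Proof.
move=> [k i] [k' i'] /set_mem [/= sk ik] /set_mem [/= sk' ik'] h.
have := @en_inj _ _ ((k.2, (sel k).1), ((sel k).2, i)) ((k'.2, (sel k').1), ((sel k').2, i')) h.
case=> e1 _ _ e4.
congr (_, _) => //; move: sk sk' e1.
case: k {ik h} => a p; case: k' {ik'} => a' p' [_ /= h] [_ /= h'] pp; subst p'.
by rewrite (code_vec_inj (tm_eval_inj h h')).
Qed.

Lemma outs_cost k : \sum_(i < size (outs (items k))) (out_of (k, nat_of_ord i)).1 =
  \sum_(it <- items k) item_cost it.
Proof.
rewrite /out_of /=; move: (items k) => s.
rewrite -(big_mkord xpredT (fun i => (nth (0, [::]) (outs s) i).1)).
rewrite -(big_nth (0, [::]) xpredT (fun o => o.1)) /outs big_flatten big_map.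
apply: eq_bigr => it _; rewrite !big_cons big_nil /item_cost /=; ring.
Qed.

End Transfer.

(** * Total weight of the requests and the transfer inequality *)

Section TransferBound.
Context {R : realType}.
Local Open Scope ring_scope.
Local Open Scope classical_set_scope.
Variable U : TM.
Context {X : Type} {EX : Enc X} {DX : @Decodable X EX}.
Variables (target source : X -> seq bool) (dim sdim gain : X -> nat).
Variables (mat : X -> seq gq -> nat -> nat -> gq) (loss : nat).
Hypothesis target_inj : injective target.
Local Notation requests := (requests U target source dim sdim gain mat loss).

Lemma certifies_outs d A s i : certifies d A s -> (i < size (outs s))%N ->
  0 <= (nth (0, [::]) (outs s) i).1 /\ unit_seq d (nth (0, [::]) (outs s) i).2.
Proof.
move=> /certifiesP[h _ _] /(mem_nth (0, [::])) /flattenP[l /mapP[it its ->]].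
have /and3P[e0 u1 u2] := h _ its.
by rewrite !inE => /orP[] /eqP -> /=; rewrite mulr_ge0 ?nsq_ge0.
Qed.

Lemma bits_unit_ge0 p : 0 <= bits_unit p.
Proof. exact: ltW (bits_unit_gt0 _). Qed.

Lemma factor_ge0 x p : 0 <= factor gain loss x p.
Proof. by rewrite /factor mulr_ge0 ?bits_unit_ge0 ?divr_ge0. Qed.

Lemma requests_ge0 y j w c : requests y j = Some (w, c) -> 0 <= w.
Proof.
rewrite /requests; case: ifP => // /and3P[_ /andP[v _] sz] [<- _].
move: v; rewrite /valid; case: (run_out _ _ _ _) => // r /and4P[_ _ _ cert].
by rewrite mulr_ge0 ?factor_ge0 //; have [] := certifies_outs cert sz.
Qed.

Variable x : X.
Hypothesis dim_gt0 : (0 < dim x)%N.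
Hypothesis mat_psd : forall phi, unit_seq (sdim x) phi ->
  hermitian (dim x) (mat x phi) /\ psd_form (dim x) (mat x phi).
Local Notation src := (halting U (source x) (sdim x)).
Local Notation items := (items U source target_inj dim_gt0 mat_psd).
Local Notation slot := (slot U source target_inj dim_gt0 mat_psd).
Local Notation slots := (slots U source target_inj dim_gt0 mat_psd).
Local Notation out_of := (out_of U source target_inj dim_gt0 mat_psd).

Definition scale : R := (2 ^+ gain x) / loss.+1%:R.

Lemma scale_ge0 : 0 <= scale.
Proof. by rewrite /scale divr_ge0 ?exprn_ge0. Qed.

Lemma factorE p : ratr (factor gain loss x p) = scale * length_weight p :> R.
Proof.
by rewrite /factor /scale !rmorphM /= fmorphV /= !ratr_nat natrX length_weightE.
Qed.

Lemma items_cert k : src k -> certifies (dim x) (mat x k.1) (items k).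
Proof. by case/(selP target_inj dim_gt0 mat_psd). Qed.

Lemma out_ge0 e : slots e -> 0 <= (out_of e).1 /\ unit_seq (dim x) (out_of e).2.
Proof.
case: e => k i [/= sk ik]; exact: certifies_outs (items_cert sk) ik.
Qed.

Lemma weight_slot e : slots e ->
  weight requests (target x) (slot e) = factor gain loss x e.1.2 * (out_of e).1.
Proof. by move=> /(requests_slot gain loss) h; rewrite /weight h. Qed.

Lemma esum_slots (F : (seq gq * seq bool) -> rat * seq gq -> R) :
  (forall e, slots e -> 0 <= F e.1 (out_of e)) ->
  (\esum_(e in slots) (F e.1 (out_of e))%:E =
   \esum_(k in src) (\sum_(o <- outs (items k)) F k o)%:E)%E.
Proof.
move=> F0; rewrite /slots /=.
rewrite -(esum_esum (a := fun k i => (F k (out_of (k, i)))%:E)); last first.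
  by move=> k i sk ik; rewrite lee_fin; apply: (F0 (k, i)); split.
apply: eq_esum => k sk; rewrite esum_ord; last first.
  by move=> i ik; rewrite lee_fin; apply: (F0 (k, i)); split.
rewrite sumEFin (big_nth (0, [::])) big_mkord.
by [].
Qed.

Hypothesis mass : (\esum_(k in src) (length_weight k.2 *
  (scale * (6 * ratr (trace_sum (dim x) (mat x k.1)))))%:E <= 1)%E.

Definition rweight j : R := ratr (weight requests (target x) j).

Lemma rweight_ge0 j : 0 <= rweight j.
Proof. by rewrite ler0q; apply: weight_ge0; exact: requests_ge0. Qed.

(** [coding] provides words only for requests of positive weight; the others add nothing to the
    sum. *)
Definition positive_slot : set ((seq gq * seq bool) * nat) :=
  [set e | 0 < weight requests (target x) (slot e)].

(** The slots of one program weigh its factor times the cost of its certificate, which is at most 6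
    times the trace; the rest is [mass]. *)
Lemma psum_le1 N : psum requests (target x) N <= 1.
Proof.
pose wt j : \bar R := (rweight j)%:E.
have wt0 j : (0 <= wt j)%E by rewrite lee_fin rweight_ge0.
have : (\esum_(j in [set slot e | e in slots]) wt j <= 1)%E.
  rewrite esum_image; last exact: slot_inj.
  apply: le_trans mass.
  have -> : (\esum_(i in slots) wt (slot i) =
    \esum_(e in slots) (scale * length_weight e.1.2 * ratr (out_of e).1)%:E)%E.
    by apply: eq_esum => e se; rewrite /wt /rweight weight_slot // rmorphM /= factorE.
  rewrite (esum_slots (F := fun k o => scale * length_weight k.2 * ratr o.1)); last first.
    move=> e /out_ge0 [h _]; apply: mulr_ge0; last by rewrite ler0q.
    by apply: mulr_ge0; [exact: scale_ge0|exact: length_weight_ge0].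
  apply: le_esum => k sk; rewrite lee_fin -mulr_sumr mulrCA mulrA ler_wpM2l //.
    by rewrite mulr_ge0 ?scale_ge0 ?length_weight_ge0.
  have /certifiesP[_ _ h] := items_cert sk.
  rewrite -rmorph_sum /= (big_nth (0, [::])) big_mkord.
  move: h; rewrite -(@outs_cost U X EX DX target source dim sdim mat target_inj x dim_gt0 mat_psd k) => h.
  by rewrite -[6]/(6%:R) -(ratr_nat R 6) -rmorphM ler_rat.
move=> h; rewrite -(ler_rat R) rmorph1 -lee_fin.
apply: le_trans h; rewrite /psum rmorph_sum /= -sumEFin -(esum_ord (f := wt)); last by [].
rewrite (esum_support (B := [set slot e | e in slots])) //; last first.
  move=> j _ nj; rewrite /wt /rweight /weight; case e: (requests _ j) => [r|]; last by rewrite rmorph0.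
  by case: nj; have [s hs ->] := requests_slots target_inj dim_gt0 mat_psd e; exists s.
by apply: esum_subset => j [].
Qed.

(** Each slot of positive weight is sent to its unit vector together with its own code word, a
    halting pair at the target condition whose weight is smaller by at most [2^d]. Distinct slots
    have distinct code words, so the sum on the right absorbs them all. *)
Lemma transfer_bound d (f : nat -> seq bool) (g : seq gq -> R) :
  (forall psi, 0 <= g psi) ->
  (forall j w c, requests (target x) j = Some (w, c) -> 0 < w ->
     tm_eval U (target x) (f j) c /\ w <= (2 ^ d)%N%:R * bits_unit (f j)) ->
  (forall i j, 0 < weight requests (target x) i -> 0 < weight requests (target x) j ->
     f i = f j -> i = j) ->
  (\esum_(k in src) (length_weight k.2 * (scale *
      \sum_(o <- outs (items k)) (ratr o.1 * g o.2)))%:E <=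
   (2 ^+ d)%:E * \esum_(k in halting U (target x) (dim x)) (length_weight k.2 * g k.1)%:E)%E.
Proof.
move=> g0 hf finj.
have -> : (\esum_(k in src) (length_weight k.2 * (scale *
      \sum_(o <- outs (items k)) (ratr o.1 * g o.2)))%:E =
    \esum_(e in slots) (ratr (weight requests (target x) (slot e)) * g (out_of e).2)%:E)%E.
  transitivity (\esum_(e in slots) (length_weight e.1.2 * (scale *
     (ratr (out_of e).1 * g (out_of e).2)))%:E)%E.
    rewrite (esum_slots (F := fun k o => length_weight k.2 * (scale * (ratr o.1 * g o.2)))).
      by apply: eq_esum => k sk; congr (_%:E); rewrite !mulr_sumr.
    move=> e /out_ge0 [h _]; apply: mulr_ge0; first exact: length_weight_ge0.
    apply: mulr_ge0; first exact: scale_ge0.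
    by apply: mulr_ge0; rewrite ?ler0q.
  apply: eq_esum => e se; congr (_%:E); rewrite weight_slot // rmorphM /= factorE.
  by ring.
rewrite -esumZ ?exprn_gt0 //; last by move=> k; rewrite lee_fin mulr_ge0 ?length_weight_ge0.
have w0 e : 0 <= weight requests (target x) (slot e).
  by apply: weight_ge0; exact: requests_ge0.
rewrite (esum_support (B := positive_slot)); first last.
- move=> e _ ne; have /eqP -> : weight requests (target x) (slot e) == 0; last by rewrite rmorph0 mul0r.
  by rewrite eq_le w0 andbT leNgt; apply/negP.
- by move=> e _; rewrite lee_fin mulr_ge0 ?ler0q.
have inj : set_inj (slots `&` positive_slot) (fun e => ((out_of e).2, f (slot e))).
  move=> e e' /set_mem [se pe] /set_mem [se' pe'] [_ ff].
  by apply: (slot_inj (mem_set se) (mem_set se')); exact: finj pe pe' ff.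
have into e : (slots `&` positive_slot) e ->
    halting U (target x) (dim x) ((out_of e).2, f (slot e)).
  move=> [se pe]; have [_ u] := out_ge0 se; split=> //=.
  have := hf _ _ _ (requests_slot gain loss se).
  by rewrite -weight_slot // => /(_ pe) [].
have := esum_inj_le (fun k => (2 ^+ d)%:E * (length_weight k.2 * g k.1)%:E)%E inj into.
apply: le_trans.
apply: le_esum => e [se pe]; rewrite -EFinM lee_fin mulrA ler_wpM2r //.
have := hf _ _ _ (requests_slot gain loss se); rewrite -weight_slot // => /(_ pe) [_].
by rewrite -(ler_rat R) rmorphM /= ratr_nat natrX -length_weightE.
Qed.

End TransferBound.

Section TransferTheorem.
Local Open Scope ring_scope.
Local Open Scope classical_set_scope.

(** One decoder serves all parameters, so [d] is chosen before [x]. In the uses below [g psi] is the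
    value [<psi|A|psi>] of a possibly non-elementary [A]. *)
Theorem transfer (R : realType) (U : TM) (hU : universal_prefix_machine U)
    (X : Type) (EX : Enc X) (DX : @Decodable X EX)
    (target source : X -> seq bool) (dim sdim gain : X -> nat)
    (mat : X -> seq gq -> nat -> nat -> gq) (loss : nat) :
  injective target -> PR target -> PR source -> PR dim -> PR sdim -> PR gain ->
  PR (fun p : ((X * seq gq) * nat) * nat => mat p.1.1.1 p.1.1.2 p.1.2 p.2) ->
  exists d : nat, forall x, (0 < dim x)%N ->
  (forall phi, unit_seq (sdim x) phi ->
     hermitian (dim x) (mat x phi) /\ psd_form (dim x) (mat x phi)) ->
  (\esum_(k in halting U (source x) (sdim x)) (@length_weight R k.2 *
     (scale gain loss x * (6 * ratr (trace_sum (dim x) (mat x k.1)))))%:E <= 1)%E ->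
  exists items : seq gq * seq bool -> seq item,
    (forall k, halting U (source x) (sdim x) k -> certifies (dim x) (mat x k.1) (items k)) /\
    forall g : seq gq -> R, (forall psi, 0 <= g psi)%R ->
    (\esum_(k in halting U (source x) (sdim x)) (@length_weight R k.2 * (scale gain loss x *
        \sum_(o <- outs (items k)) (ratr o.1 * g o.2)))%:E <=
     (2 ^+ d)%:E * \esum_(k in halting U (target x) (dim x)) (@length_weight R k.2 * g k.1)%:E)%E.
Proof.
move=> ti h1 h2 h3 h4 h5 h6.
have hq := @PR_requests U X EX DX _ _ _ _ _ _ loss h1 h2 h3 h4 h5 h6.
have [d hd] := coding hU hq (@requests_ge0 U X EX DX target source dim sdim gain mat loss).
exists d => x d0 mp mass.
have [f [f1 f2]] := hd (target x) (psum_le1 ti d0 mp mass).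
exists (items U source ti d0 mp); split.
  by move=> k sk; case: (selP ti d0 mp sk).
by move=> g g0; exact: (transfer_bound ti d0 mp g0 f1 f2).
Qed.

End TransferTheorem.

(** * The trace against a universal matrix *)

Section Kraft.
Context {R : realType}.
Local Open Scope ring_scope.
Local Open Scope classical_set_scope.
Local Notation lw := (@length_weight R).

Definition prefix_free (s : seq (seq bool)) :=
  forall p r, p \in s -> p ++ r \in s -> r = [::].

(** Induction on the maximal length, splitting by the first bit; if the empty word occurs, it is the
    only word. *)
Lemma kraft s : uniq s -> prefix_free s -> \sum_(p <- s) lw p <= 1.
Proof.
have [L hL] : exists L, forall p, p \in s -> (size p <= L)%N.
  exists (\max_(p <- s) size p)%N => p ps; exact: (leq_bigmax_seq (F := size)).
elim: L s hL => [|L IH] s hL us pf.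
all: have [e|ne] := boolP ([::] \in s).
1,3: have -> : s = [:: [::]].
1,3: apply: perm_small_eq => //; apply: uniq_perm => // p; rewrite inE; apply/idP/eqP => [ps|->] //;
  by have := pf [::] p e ps.
1,2: by rewrite big_seq1 /length_weight expr0 invr1.
  case: s us pf ne hL => [|p s] _ _ ne hL; first by rewrite big_nil.
  by have := hL p (mem_head _ _); rewrite leqn0 => /nilP pE; rewrite pE mem_head in ne.
pose sub b := [seq behead p | p <- s & head false p == b].
have mem_sub b p : (p \in sub b) = (b :: p \in s).
  apply/mapP/idP => [[q]|ps]; last by exists (b :: p); rewrite ?mem_filter //= eqxx.
  rewrite mem_filter => /andP[/eqP hb qs] ->.
  by case: q qs hb => [|c q] qs /= hb; [rewrite qs in ne|rewrite -hb].
have usub b : uniq (sub b).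
  rewrite map_inj_in_uniq ?filter_uniq // => p q; rewrite !mem_filter.
  case: p => [|c p]; case: q => [|c' q] //=; rewrite ?(negbTE ne) ?andbF //.
  by move=> /andP[/eqP -> _] /andP[/eqP -> _] ->.
have hsub b : \sum_(p <- sub b) lw p <= 1.
  apply: IH => // [p|p r]; first by rewrite mem_sub => /hL.
  by rewrite !mem_sub => h1 h2; exact: (pf (b :: p) r).
have half p : p \in s -> lw p = 2^-1 * lw (behead p).
  case: p => [|b p] ps; first by rewrite ps in ne.
  by rewrite /length_weight /= exprS invfM.
have -> : \sum_(p <- s) lw p = 2^-1 * (\sum_(p <- sub true) lw p + \sum_(p <- sub false) lw p).
  rewrite (bigID (fun p => head false p)) /= mulrDr; congr (_ + _).
    rewrite big_map big_filter mulr_sumr big_seq_cond [RHS]big_seq_cond.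
    by apply: eq_big => [p|p /andP[ps _]]; [rewrite eqb_id|exact: half].
  rewrite big_map big_filter mulr_sumr big_seq_cond [RHS]big_seq_cond.
  by apply: eq_big => [p|p /andP[ps _]]; [rewrite eqbF_neg|exact: half].
have := hsub true; have := hsub false; lra.
Qed.

Lemma kraft_esum U y : prefix_machine U ->
  (\esum_(p in [set p | exists x, tm_eval U y p x]) (lw p)%:E <= 1)%E.
Proof.
move=> pU; apply: ge_ereal_sup => _ [F [finF FD]] <-.
rewrite fsbig_finite //= sumEFin lee_fin; apply: kraft; first exact: finmap.fset_uniq.
move=> p r; rewrite !in_fset_set // => /set_mem /FD [x hx] /set_mem /FD [x' hx'].
exact: pU hx hx'.
Qed.

End Kraft.

Section Rsum.
Context {R : realType} {T : choiceType}.
Local Open Scope ring_scope.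
Local Open Scope classical_set_scope.
Variable D : set T.
Implicit Types f g : T -> R.

Definition abs_summable f := (\esum_(i in D) (`|f i|)%:E < +oo)%E.

Lemma esum_fin f g : (forall i, 0 <= f i) -> (forall i, D i -> f i <= `|g i|) -> abs_summable g ->
  (\esum_(i in D) (f i)%:E \is a fin_num)%E.
Proof.
move=> f0 fg sg; rewrite ge0_fin_numE; last by apply: esum_ge0 => i _; rewrite lee_fin.
by apply: le_lt_trans sg; apply: le_esum => i Di; rewrite lee_fin fg.
Qed.

(** The positive and negative parts satisfy [p + b = a + n], an identity between nonnegative
    families, whose sums are additive. *)
Lemma rsum_diff f a b : (forall i, 0 <= a i) -> (forall i, 0 <= b i) ->
  (\esum_(i in D) (a i)%:E \is a fin_num)%E -> (\esum_(i in D) (b i)%:E \is a fin_num)%E ->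
  (forall i, D i -> f i = a i - b i) ->
  rsum D f = fine (\esum_(i in D) (a i)%:E)%E - fine (\esum_(i in D) (b i)%:E)%E.
Proof.
move=> a0 b0 fa fb fE.
have le_fin (u v : T -> R) : (forall i, 0 <= u i) -> (forall i, D i -> u i <= v i) ->
    (\esum_(i in D) (v i)%:E \is a fin_num)%E -> (\esum_(i in D) (u i)%:E \is a fin_num)%E.
  move=> u0 uv; rewrite !ge0_fin_numE; last 2 first.
  - by apply: esum_ge0 => i _; rewrite lee_fin.
  - by apply: esum_ge0 => i Di; rewrite lee_fin (le_trans (u0 i)) ?uv.
  by apply: le_lt_trans; apply: le_esum => i Di; rewrite lee_fin uv.
pose p i := Num.max (f i) 0; pose n i := Num.max (- f i) 0.
have p0 i : 0 <= p i by rewrite le_max lexx orbT.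
have n0 i : 0 <= n i by rewrite le_max lexx orbT.
have fp : (\esum_(i in D) (p i)%:E \is a fin_num)%E.
  apply: (le_fin _ a) => // i Di; rewrite /p ge_max a0 andbT fE //.
  by have := b0 i; lra.
have fn : (\esum_(i in D) (n i)%:E \is a fin_num)%E.
  apply: (le_fin _ b) => // i Di; rewrite /n ge_max b0 andbT fE //.
  by have := a0 i; lra.
have e : (\esum_(i in D) (p i)%:E + \esum_(i in D) (b i)%:E =
          \esum_(i in D) (a i)%:E + \esum_(i in D) (n i)%:E)%E.
  rewrite -!esumD; try by move=> i _; rewrite lee_fin.
  apply: eq_esum => i Di; rewrite -!EFinD; congr (_%:E).
  have := fE i Di; rewrite /p /n; case: (leP (f i) 0) => h1; case: (leP (- f i) 0) => h2; lra.
rewrite /rsum -/p -/n.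
move: e; rewrite -(fineK fp) -(fineK fn) -(fineK fa) -(fineK fb) -!EFinD => -[].
by move=> e; rewrite !fineK //; lra.
Qed.

Lemma abs_summableD f g : abs_summable f -> abs_summable g -> abs_summable (fun i => f i + g i).
Proof.
move=> sf sg; apply: le_lt_trans (lte_add_pinfty sf sg).
rewrite -esumD; try by move=> i _; rewrite lee_fin.
by apply: le_esum => i _; rewrite -EFinD lee_fin ler_normD.
Qed.

Lemma abs_summableZ (c : R) f : abs_summable f -> abs_summable (fun i => c * f i).
Proof.
move=> sf; have [->|c0] := eqVneq c 0.
  by rewrite /abs_summable esum1 ?ltry // => i _; rewrite mul0r normr0.
have e : (\esum_(i in D) (`|c * f i|)%:E = (`|c|)%:E * \esum_(i in D) (`|f i|)%:E)%E.
  rewrite -(esumZ D (f := fun i => (`|f i|)%:E)) ?normr_gt0 //.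
  by apply: eq_esum => i _; rewrite normrM EFinM.
by rewrite /abs_summable e lte_mul_pinfty // lee_fin.
Qed.

Definition posp f i := Num.max (f i) 0.
Definition negp f i := Num.max (- f i) 0.

Lemma rsumE f : rsum D f =
  fine (\esum_(i in D) (posp f i)%:E)%E - fine (\esum_(i in D) (negp f i)%:E)%E.
Proof. by []. Qed.

Lemma posp_ge0 f i : 0 <= posp f i. Proof. by rewrite le_max lexx orbT. Qed.
Lemma negp_ge0 f i : 0 <= negp f i. Proof. by rewrite le_max lexx orbT. Qed.
Lemma pospnegp f i : f i = posp f i - negp f i.
Proof. by rewrite /posp /negp; case: (leP (f i) 0); case: (leP (- f i) 0); lra. Qed.
Lemma posp_le f i : posp f i <= `|f i|.
Proof. by rewrite /posp ge_max normr_ge0 andbT ler_norm. Qed.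
Lemma negp_le f i : negp f i <= `|f i|.
Proof. by rewrite /negp ge_max normr_ge0 andbT -normrN ler_norm. Qed.

Lemma esum_fin_add (a b : T -> R) : (forall i, 0 <= a i) -> (forall i, 0 <= b i) ->
  (\esum_(i in D) (a i)%:E \is a fin_num)%E -> (\esum_(i in D) (b i)%:E \is a fin_num)%E ->
  (\esum_(i in D) (a i + b i)%:E \is a fin_num)%E /\
  fine (\esum_(i in D) (a i + b i)%:E)%E =
  fine (\esum_(i in D) (a i)%:E)%E + fine (\esum_(i in D) (b i)%:E)%E.
Proof.
move=> a0 b0 fa fb.
have -> : (\esum_(i in D) (a i + b i)%:E = \esum_(i in D) (a i)%:E + \esum_(i in D) (b i)%:E)%E.
  by rewrite -esumD; try (by move=> i _; rewrite lee_fin); apply: eq_esum => i _; rewrite EFinD.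
by rewrite fin_numD fa fb fineD.
Qed.

Lemma fin_posp f : abs_summable f -> (\esum_(i in D) (posp f i)%:E \is a fin_num)%E.
Proof. by apply: esum_fin => i *; rewrite ?posp_ge0 ?posp_le. Qed.
Lemma fin_negp f : abs_summable f -> (\esum_(i in D) (negp f i)%:E \is a fin_num)%E.
Proof. by apply: esum_fin => i *; rewrite ?negp_ge0 ?negp_le. Qed.

Lemma rsumD f g : abs_summable f -> abs_summable g ->
  rsum D (fun i => f i + g i) = rsum D f + rsum D g.
Proof.
move=> sf sg.
have [f1 e1] := esum_fin_add (posp_ge0 f) (posp_ge0 g) (fin_posp sf) (fin_posp sg).
have [f2 e2] := esum_fin_add (negp_ge0 f) (negp_ge0 g) (fin_negp sf) (fin_negp sg).
rewrite (rsum_diff (a := fun i => posp f i + posp g i) (b := fun i => negp f i + negp g i)) //.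
- by rewrite e1 e2 /rsum /posp /negp; ring.
- by move=> i; rewrite addr_ge0 ?posp_ge0.
- by move=> i; rewrite addr_ge0 ?negp_ge0.
- by move=> i _; rewrite (pospnegp f) (pospnegp g); ring.
Qed.

Lemma rsumN f : abs_summable f -> rsum D (fun i => - f i) = - rsum D f.
Proof.
move=> sf; rewrite (rsum_diff (a := negp f) (b := posp f)).
- by rewrite /rsum /posp /negp opprB.
- exact: negp_ge0.
- exact: posp_ge0.
- exact: fin_negp.
- exact: fin_posp.
- by move=> i _; rewrite {1}(pospnegp f) opprB.
Qed.

Lemma rsumZ (c : R) f : abs_summable f -> rsum D (fun i => c * f i) = c * rsum D f.
Proof.
move=> sf.
have pos (b : R) : 0 < b -> rsum D (fun i => b * f i) = b * rsum D f.
  move=> b0.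
  have e (h : T -> R) : (forall i, 0 <= h i) -> (\esum_(i in D) (b * h i)%:E =
     b%:E * \esum_(i in D) (h i)%:E)%E.
    by move=> h0; rewrite -esumZ //; apply: eq_esum => i _; rewrite EFinM.
  rewrite (rsum_diff (a := fun i => b * posp f i) (b := fun i => b * negp f i)).
  - rewrite !e; [|exact: negp_ge0|exact: posp_ge0].
    by rewrite !fineM //; [rewrite rsumE mulrBr|exact: fin_negp|exact: fin_posp].
  - by move=> i; apply: mulr_ge0; [exact: ltW|exact: posp_ge0].
  - by move=> i; apply: mulr_ge0; [exact: ltW|exact: negp_ge0].
  - by rewrite e ?fin_numM //; [exact: fin_posp|exact: posp_ge0].
  - by rewrite e ?fin_numM //; [exact: fin_negp|exact: negp_ge0].
  - by move=> i _; rewrite -mulrBr -pospnegp.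
have [c0|c0|->] := ltgtP c 0.
- have -> : (fun i => c * f i) = (fun i => - (- c * f i)) by apply: funext => i; rewrite mulNr opprK.
  rewrite rsumN; last exact: abs_summableZ.
  by rewrite pos ?oppr_gt0 // mulNr opprK.
- exact: pos.
- rewrite mul0r /rsum !esum1 ?subrr // => i _; rewrite mul0r ?oppr0 maxxx //.
Qed.

Lemma rsum_sum (I : Type) (s : seq I) (c : I -> R) (f : I -> T -> R) :
  (forall k, abs_summable (f k)) ->
  abs_summable (fun i => \sum_(k <- s) c k * f k i) /\
  rsum D (fun i => \sum_(k <- s) c k * f k i) = \sum_(k <- s) c k * rsum D (f k).
Proof.
move=> sf; elim: s => [|k s [IH1 IH2]].
  have z : (fun i => \sum_(k <- [::]) c k * f k i) = (fun=> 0) by apply: funext => i; rewrite big_nil.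
  rewrite z big_nil; split.
    by rewrite /abs_summable esum1 ?ltry // => i _; rewrite normr0.
  by rewrite /rsum !esum1 ?subrr // => i _; rewrite ?oppr0 maxxx.
have e : (fun i => \sum_(k <- k :: s) c k * f k i) =
    (fun i => c k * f k i + \sum_(k <- s) c k * f k i).
  by apply: funext => i; rewrite big_cons.
rewrite e big_cons; split; first by apply: abs_summableD => //; exact: abs_summableZ.
by rewrite rsumD ?rsumZ ?IH2 //; exact: abs_summableZ.
Qed.

Lemma rsum_ge0 f : (forall i, D i -> 0 <= f i) -> rsum D f = fine (\esum_(i in D) (f i)%:E)%E.
Proof.
move=> f0; rewrite /rsum [X in _ - fine X]esum1 ?subr0.
  by congr fine; apply: eq_esum => i Di; rewrite (max_idPl _) ?f0.
by move=> i Di; rewrite (max_idPr _) // oppr_le0 f0.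
Qed.

End Rsum.

Section UniversalTrace.
Context {R : realType}.
Local Open Scope ring_scope.
Local Open Scope classical_set_scope.
Local Notation C := (R[i]%C).
Local Notation lw := (@length_weight R).

Definition emb (z : gq) : C := Complex (ratr (complex.Re z)) (ratr (complex.Im z)).

Lemma embD x y : emb (x + y) = emb x + emb y.
Proof. by case: x y => a b [c d]; congr Complex; rewrite /= rmorphD. Qed.
Lemma embM x y : emb (x * y) = emb x * emb y.
Proof.
by case: x y => a b [c d]; congr Complex; rewrite /= ?rmorphB ?rmorphD /= !rmorphM.
Qed.
Lemma emb0 : emb 0 = 0. Proof. by congr Complex; rewrite rmorph0. Qed.
Lemma emb_sum (I : Type) (s : seq I) (P : pred I) (f : I -> gq) :
  emb (\sum_(i <- s | P i) f i) = \sum_(i <- s | P i) emb (f i).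
Proof. exact: (big_morph _ embD emb0). Qed.
Lemma emb_conj x : emb (conjc x) = conjc (emb x).
Proof. by case: x => a b; congr Complex; rewrite /= rmorphN. Qed.
Lemma emb_ofR q : emb (ofR q) = ofR (ratr q).
Proof. by congr Complex; rewrite rmorph0. Qed.
Lemma nsq_emb z : nsq (emb z) = ratr (nsq z).
Proof. by rewrite /nsq /= rmorphD !rmorphXn. Qed.

Definition qf d (A : 'M[C]_d) (v : 'cV[C]_d) : R := complex.Re ((adjmx v *m A *m v) 0 0).

Lemma qfE d (A : 'M[C]_d) (v : 'cV[C]_d) :
  qf A v = complex.Re (\sum_i \sum_j conjc (v i 0) * A i j * v j 0).
Proof.
rewrite /qf mxE exchange_big /=; congr complex.Re; apply: eq_bigr => j _.
by rewrite mxE mulr_suml; apply: eq_bigr => i _; rewrite !mxE.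
Qed.

Definition vec d (s : seq gq) : 'cV[gq]_d := \col_(i < d) nth 0 s i.
Definition lst d (v : 'cV[gq]_d) : seq gq := [seq v i 0 | i <- enum 'I_d].

Lemma size_lst d (v : 'cV[gq]_d) : size (lst v) = d.
Proof. by rewrite size_map size_enum_ord. Qed.

Lemma lstK d : cancel (@lst d) (@vec d).
Proof.
move=> v; apply/matrixP => i j; by rewrite mxE ord1 /lst nth_map_enum_ord.
Qed.

Lemma vecK d s : size s = d -> lst (vec d s) = s.
Proof.
move=> sd; apply: (@eq_from_nth _ 0); first by rewrite size_lst.
move=> i; rewrite size_lst => id.
have -> : i = nat_of_ord (Ordinal id) by [].
by rewrite nth_map_enum_ord mxE.
Qed.

Lemma code_mx_lst d (v : 'cV[gq]_d) : code_mx v = code_vec (lst v).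
Proof.
rewrite /code_mx /code_vec size_lst; congr (_ ++ (_ ++ _)).
have e1 : enum 'I_1 = [:: ord0] by apply: (inj_map val_inj); rewrite val_enum_ord.
rewrite /lst e1 -map_comp; elim: (enum 'I_d) => //= i s IH.
by rewrite IH.
Qed.

Lemma vsq_vec d (v : 'cV[gq]_d) : \sum_(a < d) nsq (nth 0 (lst v) a) = \sum_i nsq (v i 0).
Proof. by apply: eq_bigr => i _; rewrite /lst nth_map_enum_ord. Qed.

Lemma pure_stateP n (v : 'cV[gq]_(2 ^ n)) :
  pure_state (elem R v) <-> unit_seq (2 ^ n)%N (lst v).
Proof.
have e : (adjmx (elem R v) *m elem R v) 0 0 = ofR (ratr (\sum_i nsq (v i 0))).
  rewrite mxE -emb_ofR (big_morph _ (@ofRD _) (erefl : ofR 0 = 0)) emb_sum.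
  apply: eq_bigr => i _; rewrite !mxE -/(emb _) -mul_conjc embM emb_conj mulrC //.
rewrite /unit_seq size_lst eqxx /= vsq_vec; split=> [h|/eqP h].
  move: e; rewrite h mxE eqxx => -[] /esym /eqP.
  by rewrite -(rmorph1 (ratr : rat -> R)) (inj_eq (fmorph_inj _)).
apply/matrixP => i j; rewrite !ord1 e h rmorph1 mxE eqxx.
by [].
Qed.

Variable U : TM.
Hypothesis pU : prefix_machine U.
Variables (n : nat) (x : seq bool).
Local Notation Y := (code_pair x (code_nat n)).
Local Notation pure := [set phi : 'cV[gq]_(2 ^ n) | pure_state (elem R phi)].

Definition univ_mass (phi : 'cV[gq]_(2 ^ n)) : R := univ_prob R U (code_mx phi) Y.
Local Notation progs := (fun phi : 'cV[gq]_(2 ^ n) => [set p | tm_eval U Y p (code_mx phi)]).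

Lemma univ_massE phi : ((univ_mass phi)%:E = \esum_(p in progs phi) (lw p)%:E)%E.
Proof.
rewrite /univ_mass /univ_prob fineK // ge0_fin_numE; last first.
  by apply: esum_ge0 => p _; rewrite lee_fin length_weight_ge0.
apply: le_lt_trans (ltry 1); apply: le_trans (kraft_esum Y pU).
by apply: esum_subset => p /= h; exists (code_mx phi).
Qed.

Lemma univ_mass_ge0 phi : 0 <= univ_mass phi.
Proof.
by rewrite -lee_fin univ_massE; apply: esum_ge0 => p _; rewrite lee_fin length_weight_ge0.
Qed.

(** Expands the universal probability of each vector into the programs that output it. *)
Lemma esum_progs (q : 'cV[gq]_(2 ^ n) -> R) : (forall phi, pure phi -> 0 <= q phi) ->
  (\esum_(phi in pure) (univ_mass phi * q phi)%:E =
   \esum_(k in halting U Y (2 ^ n)%N) (lw k.2 * q (vec (2 ^ n)%N k.1))%:E)%E.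
Proof.
move=> q0.
transitivity (\esum_(k in pure `*`` progs) (lw k.2 * q k.1)%:E)%E.
  rewrite -(esum_esum (a := fun phi p => (lw p * q phi)%:E)); last first.
    by move=> phi p hp _; rewrite lee_fin mulr_ge0 ?length_weight_ge0 ?q0.
  apply: eq_esum => phi hp; rewrite mulrC EFinM univ_massE.
  have := q0 _ hp; rewrite le_eqVlt => /predU1P[<-|qp].
    by rewrite mul0e esum1 // => p _; rewrite mulr0.
  rewrite -esumZ //; last by move=> p; rewrite lee_fin length_weight_ge0.
  by apply: eq_esum => p _; rewrite -EFinM mulrC.
pose e (k : 'cV[gq]_(2 ^ n) * seq bool) := (lst k.1, k.2).
rewrite (@reindex_esum _ _ _ (pure `*`` progs) _ e); first by apply: eq_esum => k _; rewrite /e /= lstK.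
split.
- move=> [phi p] [/= h1 h2]; split=> /=; first exact/pure_stateP.
  by rewrite -code_mx_lst.
- move=> [a p] [b r] _ _ [] h ->; congr (_, _).
  by rewrite -[a]lstK h lstK.
- move=> [s p] [/= h1 h2]; have /andP[/eqP sz _] := h1.
  exists (vec (2 ^ n)%N s, p); last by rewrite /e /= vecK.
  split=> /=; first by apply/pure_stateP; rewrite vecK.
  by rewrite code_mx_lst vecK.
Qed.

Lemma esum_halting_le1 y d : (\esum_(k in halting U y d) (lw k.2)%:E <= 1)%E.
Proof.
apply: le_trans (kraft_esum y pU).
have inj : set_inj (halting U y d) (fun k => k.2).
  move=> [a p] [b r] /set_mem [_ /= h] /set_mem [_ /= h'] /= pr; subst r.
  by rewrite (code_vec_inj (tm_eval_inj h h')).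
apply: (esum_inj_le (fun p => (lw p)%:E) inj).
by move=> k [_ h]; exists (code_vec k.1).
Qed.

Lemma univ_mass_sum : (\esum_(phi in pure) (univ_mass phi)%:E <= 1)%E.
Proof.
apply: le_trans (esum_halting_le1 Y (2 ^ n)%N).
rewrite (eq_esum (b := fun phi => (univ_mass phi * 1)%:E)); last by move=> *; rewrite mulr1.
by rewrite (esum_progs (q := fun=> 1)) //; apply: le_esum => k _; rewrite mulr1.
Qed.

Lemma mass_summable (h : 'cV[gq]_(2 ^ n) -> R) : (forall phi, pure phi -> `|h phi| <= 1) ->
  abs_summable pure (fun phi => univ_mass phi * h phi).
Proof.
move=> h1; apply: le_lt_trans (ltry 1); apply: le_trans univ_mass_sum.
apply: le_esum => phi hp; rewrite lee_fin normrM ger0_norm ?univ_mass_ge0 //.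
by rewrite ler_piMr ?univ_mass_ge0 ?h1.
Qed.

Lemma unit_entry (v : C) : nsq v <= 1 -> `|complex.Re v| <= 1 /\ `|complex.Im v| <= 1.
Proof.
case: v => a b; rewrite /nsq /= => h; have a0 := sqr_ge0 a; have b0 := sqr_ge0 b.
by split; rewrite ler_norml; apply/andP; split; nra.
Qed.

Lemma pure_entry (phi : 'cV[gq]_(2 ^ n)) i j : pure phi ->
  let z := (elem R phi *m adjmx (elem R phi)) i j in
  `|complex.Re z| <= 1 /\ `|complex.Im z| <= 1.
Proof.
move=> hp /=; apply: unit_entry.
have -> : (elem R phi *m adjmx (elem R phi)) i j = emb (phi i 0) * conjc (emb (phi j 0)).
  by rewrite mxE big_ord1 !mxE.
rewrite nsqM -emb_conj !nsq_emb.
have nc z : nsq (conjc z) = nsq z :> rat by case: z => a b; rewrite /nsq /= sqrrN.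
rewrite nc; have le1 k : nsq (phi k 0) <= 1.
  have /pure_stateP/andP[_ /eqP] := hp; rewrite vsq_vec => <-.
  by rewrite (bigD1 k) //= lerDl sumr_ge0 // => l _; exact: nsq_ge0.
rewrite -rmorphM -(rmorph1 (ratr : rat -> R)) ler_rat.
by rewrite mulr_ile1 ?nsq_ge0.
Qed.

(** The trace is a finite real combination of the real and imaginary parts of the entries, each an
    absolutely convergent series. Linearity of [rsum] merges them into one series with nonnegative
    terms. *)
Lemma trace_univ (A : 'M[C]_(2 ^ n)) :
  (forall phi, pure phi -> 0 <= qf A (elem R phi)) ->
  (\esum_(k in halting U Y (2 ^ n)%N) (lw k.2 * qf A (elem R (vec (2 ^ n)%N k.1)))%:E
    \is a fin_num)%E /\
  complex.Re (\tr (univ_matrix R U x n *m A)) =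
  fine (\esum_(k in halting U Y (2 ^ n)%N) (lw k.2 * qf A (elem R (vec (2 ^ n)%N k.1)))%:E)%E.
Proof.
move=> A0; rewrite -(esum_progs (q := fun phi => qf A (elem R phi))) //.
pose P (phi : 'cV[gq]_(2 ^ n)) := elem R phi *m adjmx (elem R phi).
pose u (k : ('I_(2 ^ n) * 'I_(2 ^ n)) * bool) phi : R := univ_mass phi *
  (if k.2 then complex.Re (P phi k.1.1 k.1.2) else complex.Im (P phi k.1.1 k.1.2)).
(* The sign comes from the real part of a product, [Re P Re A - Im P Im A]. *)
pose c (k : ('I_(2 ^ n) * 'I_(2 ^ n)) * bool) : R :=
  if k.2 then complex.Re (A k.1.2 k.1.1) else - complex.Im (A k.1.2 k.1.1).
have su k : abs_summable pure (u k).
  by apply: mass_summable => phi hp; have [h1 h2] := pure_entry k.1.1 k.1.2 hp; case: ifP.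
have [sm e] := rsum_sum (index_enum _) c su.
have qE phi : \sum_k c k * u k phi = univ_mass phi * qf A (elem R phi).
  rewrite -(pair_bigA _ (fun ij b => c (ij, b) * u (ij, b) phi)) /=.
  rewrite -(pair_bigA _ (fun i j => \sum_b c ((i, j), b) * u ((i, j), b) phi)) /=.
  rewrite qfE Re_sum mulr_sumr exchange_big /=; apply: eq_bigr => i _.
  rewrite Re_sum mulr_sumr; apply: eq_bigr => j _.
  rewrite big_bool /c /u /P /= mxE big_ord1 !mxE.
  case: (A i j) => a b /=.
  by ring.
have eq : (fun phi => \sum_k c k * u k phi) = (fun phi => univ_mass phi * qf A (elem R phi)).
  by apply: funext => phi; rewrite qE.
rewrite eq in sm e; split.
  have e0 : (\esum_(phi in pure) (univ_mass phi * qf A (elem R phi))%:E =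
      \esum_(phi in pure) (`|univ_mass phi * qf A (elem R phi)|)%:E)%E.
    by apply: eq_esum => phi hp; rewrite ger0_norm // mulr_ge0 ?univ_mass_ge0 ?A0.
  rewrite e0; exact: (esum_fin _ _ sm).
rewrite -rsum_ge0; last by move=> phi hp; rewrite mulr_ge0 ?univ_mass_ge0 ?A0.
rewrite e /mxtrace Re_sum -(pair_bigA _ (fun ij b => c (ij, b) * rsum pure (u (ij, b)))) /=.
rewrite -(pair_bigA _ (fun i j => \sum_b c ((i, j), b) * rsum pure (u ((i, j), b)))) /=.
apply: eq_bigr => i _; rewrite mxE Re_sum; apply: eq_bigr => j _.
rewrite big_bool /c /u /P /= mxE /csum /=.
have reE : (fun phi : 'cV[gq]_(2 ^ n) => complex.Re
   (((univ_prob R U (code_mx phi) Y)%:C%C *: (elem R phi *m adjmx (elem R phi))) i j)) =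
  (fun phi => univ_mass phi * complex.Re ((elem R phi *m adjmx (elem R phi)) i j)).
  by apply: funext => phi; rewrite mxE -/(univ_mass phi); case: (_ i j) => a b /=; ring.
have imE : (fun phi : 'cV[gq]_(2 ^ n) => complex.Im
   (((univ_prob R U (code_mx phi) Y)%:C%C *: (elem R phi *m adjmx (elem R phi))) i j)) =
  (fun phi => univ_mass phi * complex.Im ((elem R phi *m adjmx (elem R phi)) i j)).
  by apply: funext => phi; rewrite mxE -/(univ_mass phi); case: (_ i j) => a b /=; ring.
rewrite reE imE; case: (A j i) => a b /=.
by ring.
Qed.

End UniversalTrace.

(** * Real part of the trace of a product with a certified matrix *)

Section Pairing.
Context {R : realType}.
Local Open Scope ring_scope.
Local Notation C := (R[i]%C).
Local Notation emb := (@emb R).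
Variable d : nat.
Implicit Types (A : 'M[C]_d) (u v : 'cV[C]_d) (M : nat -> nat -> gq).

Definition pairing A M : R :=
  complex.Re (\sum_(a < d) \sum_(b < d) emb (M a b) * A b a).

Lemma qf_ge0 A v : psd A -> 0 <= qf A v.
Proof. by move=> /(_ v); rewrite lecE => /andP[]. Qed.

Lemma adjmxD u v : adjmx (u + v) = adjmx u + adjmx v.
Proof. by apply/matrixP => i j; rewrite !mxE conjcD. Qed.

Lemma adjmxZ c v : adjmx (c *: v) = conjc c *: adjmx v.
Proof. by apply/matrixP => i j; rewrite !mxE conjcM. Qed.

Lemma qfZ A c v : qf A (c *: v) = nsq c * qf A v.
Proof.
rewrite /qf adjmxZ -!scalemxAl -scalemxAr scalerA mxE mulrC [conjc c * c]mulrC mul_conjc.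
by rewrite mulrC Re_ofRM.
Qed.

(** Parallelogram law, with the nonnegative term at [u - v] dropped. It replaces a split vector by
    its two unit vectors at the price of a factor 2. *)
Lemma qf_add A u v : psd A -> qf A (u + v) <= 2 * qf A u + 2 * qf A v.
Proof.
move=> pA; have : 0 <= qf A (u + (-1) *: v) by exact: qf_ge0.
have c1 : conjc (-1 : C) = -1 by rewrite conjcN conjc1r.
have h : qf A (u + v) + qf A (u + (-1) *: v) = 2 * qf A u + 2 * qf A v.
  rewrite /qf !adjmxD adjmxZ c1 !mulmxDl !mulmxDr !scaleN1r !mulNmx !mulmxN opprK.
  rewrite [in RHS](_ : 2 = 1 + 1 :> R) // !mulrDl !mul1r -!Re_add !mxE.
  by congr complex.Re; ring.
by lra.
Qed.

Lemma pairing_certified A M s : certifies d M s ->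
  pairing A M = \sum_(it <- s) ratr it.1 * qf A (\col_i emb (item_vec it i)).
Proof.
move=> /certifiesP[_ h _]; rewrite /pairing.
have -> : \sum_(a < d) \sum_(b < d) emb (M a b) * A b a =
  \sum_(it <- s) \sum_(a < d) \sum_(b < d)
     ofR (ratr it.1) * (conjc (emb (item_vec it b)) * A b a * emb (item_vec it a)).
  rewrite [RHS]exchange_big; apply: eq_bigr => a _; rewrite [RHS]exchange_big; apply: eq_bigr => b _.
  rewrite h // emb_sum mulr_suml; apply: eq_bigr => it _.
  by rewrite !embM emb_conj emb_ofR; ring.
rewrite Re_sum; apply: eq_bigr => it _.
rewrite qfE exchange_big -Re_ofRM; congr complex.Re.
rewrite mulr_sumr; apply: eq_bigr => b _; rewrite mulr_sumr; apply: eq_bigr => a _.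
by rewrite !mxE.
Qed.

Lemma pairing_ge0 A M s : psd A -> certifies d M s -> 0 <= pairing A M.
Proof.
move=> pA cs; rewrite (pairing_certified A cs); rewrite big_seq; apply: sumr_ge0 => it its.
have /certifiesP[h _ _] := cs; have /and3P[e0 _ _] := h _ its.
by rewrite mulr_ge0 ?qf_ge0 // ler0q.
Qed.

Lemma pairing_outs A M s : psd A -> certifies d M s ->
  pairing A M <= 2 * \sum_(o <- outs s) ratr o.1 * qf A (elem R (vec d o.2)).
Proof.
move=> pA cs; rewrite (pairing_certified A cs) /outs big_flatten big_map mulr_sumr.
rewrite big_seq [leRHS]big_seq; apply: ler_sum => it its.
have /certifiesP[h _ _] := cs; have /and3P[e0 _ _] := h _ its.
rewrite /item_outs !big_cons big_nil /= addr0 !rmorphM /=.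
pose q (v : seq gq) := qf A (elem R (vec d v)); rewrite -/(q _) -/(q _).
rewrite [leRHS](_ : _ = ratr it.1 * (2 * (ratr (nsq it.2.1.1) * q it.2.1.2) +
   2 * (ratr (nsq it.2.2.1) * q it.2.2.2))); last by ring.
apply: ler_wpM2l; first by rewrite ler0q.
have -> : \col_(i < d) emb (item_vec it i) = emb it.2.1.1 *: elem R (vec d it.2.1.2) +
     emb it.2.2.1 *: elem R (vec d it.2.2.2).
  by apply/matrixP => i j; rewrite !mxE /item_vec embD !embM.
by apply: le_trans (qf_add _ _ pA) _; rewrite !qfZ !nsq_emb.
Qed.

End Pairing.

(** * Partial traces on a product of two equal spaces *)

Section ProductMatrices.
Local Open Scope ring_scope.

(* The vector [s] of [C^N (x) C^N] is read row by row: [s_(a * N + c)%N] is the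
   coefficient of [e_a (x) e_c]. The first matrix is the partial trace of [s s^*]
   over the first factor, the second one that of [s s^* (1 (x) r)] over the
   second factor. *)
Definition marginal (N : nat) (s : seq gq) (c d : nat) : gq :=
  \sum_(a < N) nth 0 s (a * N + c)%N * conjc (nth 0 s (a * N + d)%N).

Definition contraction (N : nat) (r s : seq gq) (a b : nat) : gq :=
  \sum_(c < N) \sum_(d < N)
    nth 0 s (a * N + c)%N * conjc (nth 0 s (b * N + d)%N) * nth 0 r (d * N + c)%N.

Definition rowmajor (N : nat) (r : seq gq) (a b : nat) : gq := nth 0 r (a * N + b)%N.

Lemma marginal_herm N s : hermitian N (marginal N s).
Proof.
move=> c d _ _; rewrite /marginal conjc_sum; apply: eq_bigr => a _.
by rewrite conjcM conjcKr mulrC.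
Qed.

Lemma marginal_psd N s : psd_form N (marginal N s).
Proof.
move=> v.
have -> : form N (marginal N s) v v =
   \sum_(a < N) ofR (nsq (\sum_(c < N) conjc (v c) * nth 0 s (a * N + c)%N)).
  rewrite /form /marginal.
  transitivity (\sum_(a < N) \sum_(c < N) \sum_(d < N)
    (conjc (v c) * nth 0 s (a * N + c)%N) * conjc (conjc (v d) * nth 0 s (a * N + d)%N)).
    rewrite [RHS]exchange_big; apply: eq_bigr => c _; rewrite [RHS]exchange_big.
    apply: eq_bigr => d _; rewrite mulr_sumr mulr_suml; apply: eq_bigr => a _.
    by rewrite conjcM conjcKr; ring.
  apply: eq_bigr => a _; rewrite -mul_conjc conjc_sum mulr_suml; apply: eq_bigr => c _.
  by rewrite mulr_sumr.
by rewrite Re_sum; apply: sumr_ge0 => a _; exact: nsq_ge0.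
Qed.

Lemma sum_ord_mul (V : nmodType) (N M : nat) (f : nat -> V) :
  \sum_(i < (N * M)%N) f i = \sum_(a < N) \sum_(c < M) f (a * M + c)%N.
Proof.
elim: N => [|N IH]; first by rewrite mul0n !big_ord0.
rewrite big_ord_recr /= -IH mulSn addnC big_split_ord /=; congr (_ + _).
Qed.

Lemma marginal_trace N s : unit_seq (N * N)%N s -> trace_sum N (marginal N s) = 1.
Proof.
move=> /andP[_ /eqP <-]; rewrite (sum_ord_mul N N (fun a => nsq (nth 0 s a))) exchange_big; apply: eq_bigr => c _.
by rewrite Re_sum; apply: eq_bigr => a _; rewrite mul_conjc.
Qed.

Lemma contraction_herm N r s : hermitian N (rowmajor N r) -> hermitian N (contraction N r s).
Proof.
move=> hr a b _ _; rewrite /contraction conjc_sum exchange_big; apply: eq_bigr => d _.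
rewrite conjc_sum; apply: eq_bigr => c _.
rewrite !conjcM conjcKr; have := hr c d (ltn_ord _) (ltn_ord _).
by rewrite /rowmajor => ->; ring.
Qed.

(** The form at [v] is the form of [r] at the vector that contracts the first factor of [s] with the
    conjugate of [v]. *)
Lemma contraction_psd N r s : psd_form N (rowmajor N r) -> psd_form N (contraction N r s).
Proof.
move=> pr v; have := pr (fun c => \sum_(a < N) nth 0 s (a * N + c)%N * conjc (v a)).
congr (0 <= complex.Re _); rewrite /form /contraction.
transitivity (\sum_(d < N) \sum_(c < N) \sum_(b < N) \sum_(a < N)
   conjc (v a) * (nth 0 s (a * N + c)%N * conjc (nth 0 s (b * N + d)%N) * nth 0 r (d * N + c)%N) * v b).
  apply: eq_bigr => d _; apply: eq_bigr => c _.
  rewrite conjc_sum mulr_suml mulr_suml; apply: eq_bigr => b _.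
  rewrite mulr_sumr; apply: eq_bigr => a _; rewrite conjcM conjcKr /rowmajor; ring.
transitivity (\sum_(d < N) \sum_(c < N) \sum_(a < N) \sum_(b < N)
   conjc (v a) * (nth 0 s (a * N + c)%N * conjc (nth 0 s (b * N + d)%N) * nth 0 r (d * N + c)%N) * v b).
  by apply: eq_bigr => d _; apply: eq_bigr => c _; exact: exchange_big.
rewrite exchange_big.
under eq_bigr => c _ do rewrite exchange_big.
rewrite exchange_big; apply: eq_bigr => a _.
transitivity (\sum_(c < N) \sum_(b < N) \sum_(d < N)
   conjc (v a) * (nth 0 s (a * N + c)%N * conjc (nth 0 s (b * N + d)%N) * nth 0 r (d * N + c)%N) * v b).
  by apply: eq_bigr => c _; exact: exchange_big.
rewrite exchange_big; apply: eq_bigr => b _.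
rewrite mulr_sumr mulr_suml; apply: eq_bigr => c _.
by rewrite mulr_sumr mulr_suml.
Qed.

(** Polarisation: the values at [e_i + c e_j] for [c] equal to 1 and to the imaginary unit determine
    both parts of [A j i]. *)
Lemma form_im_hermitian N (A : nat -> nat -> gq) :
  (forall v, complex.Im (form N A v v) = 0) -> hermitian N A.
Proof.
move=> h i j iN jN.
have formDl u v w c : form N A (fun a => u a + c * w a) v = form N A u v + conjc c * form N A w v.
  rewrite /form mulr_sumr -big_split; apply: eq_bigr => a _ /=.
  by rewrite mulr_sumr -big_split; apply: eq_bigr => b _; rewrite conjcD conjcM /=; ring.
have E c : complex.Im (c * A i j + conjc c * A j i) = 0.
  have := h (fun a => delta _ i a + c * delta _ j a).
  rewrite formDr !formDl !form_delta //.
  have := h (delta _ i); have := h (delta _ j); rewrite !form_delta //.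
  move: (A i i) (A j j) (A i j) (A j i) => [x x'] [y y'] [z z'] [t t'] /= -> ->.
  by case: c => c c' /= <-; ring.
have := E 1; have := E (Complex 0 1).
move: (A i j) (A j i) => [z z'] [t t'] /= e1 e2; congr Complex; lra.
Qed.

Lemma form_le_trace N (A : nat -> nat -> gq) (u : nat -> gq) : hermitian N A -> psd_form N A ->
  \sum_(a < N) nsq (u a) = 1 -> complex.Re (form N A u u) <= trace_sum N A.
Proof.
move=> hA pA u1; have [s s0 hs] := psd_decomposition hA pA.
pose dot (v : nat -> gq) := \sum_(a < N) conjc (v a) * u a.
have -> : complex.Re (form N A u u) = \sum_(p <- s) p.1 * nsq (dot p.2).
  have -> : form N A u u = \sum_(p <- s) ofR p.1 * ofR (nsq (dot p.2)).
    transitivity (\sum_(a < N) \sum_(b < N) \sum_(p <- s)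
       ofR p.1 * (conjc (u a) * (p.2 a * conjc (p.2 b)) * u b)).
      apply: eq_bigr => a _; apply: eq_bigr => b _; rewrite hs // mulr_sumr mulr_suml.
      by apply: eq_bigr => p _; ring.
    transitivity (\sum_(p <- s) \sum_(a < N) \sum_(b < N)
       ofR p.1 * (conjc (u a) * (p.2 a * conjc (p.2 b)) * u b)).
      by rewrite [RHS]exchange_big; apply: eq_bigr => a _; rewrite exchange_big.
    apply: eq_bigr => p _; rewrite -mul_conjc mulrC [dot _ * _]mulrC conjc_sum !mulr_suml.
    apply: eq_bigr => a _; rewrite mulr_sumr mulr_suml; apply: eq_bigr => b _.
    by rewrite conjcM conjcKr; ring.
  by rewrite Re_sum; apply: eq_bigr => p _; rewrite Re_ofRM.
have -> : trace_sum N A = \sum_(p <- s) p.1 * vsq N p.2.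
  rewrite /trace_sum; under eq_bigr do rewrite hs // Re_sum.
  rewrite exchange_big; apply: eq_bigr => p _; rewrite /vsq mulr_sumr.
  by apply: eq_bigr => a _; rewrite Re_ofRM mul_conjc.
rewrite big_seq [leRHS]big_seq; apply: ler_sum => p ps; rewrite ler_wpM2l ?(allP s0) //.
(* Cauchy-Schwarz for each term: expanding the form of the identity matrix shows that [p.2] minus
   its projection onto the unit vector [u] has squared norm [vsq N p.2 - nsq (dot p.2)]. *)
pose I (a b : nat) : gq := (a == b)%:R.
have II v w : form N I v w = \sum_(a < N) conjc (v a) * w a.
  apply: eq_bigr => a _; rewrite (bigD1 a) //= /I eqxx mulr1 big1 ?addr0 // => b ba.
  by rewrite eq_sym (_ : (nat_of_ord b == a) = false) ?mulr0 ?mul0r //; apply/negbTE.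
have hI : hermitian N I.
  by move=> a b _ _; rewrite /I eq_sym; case: eqP; rewrite ?conjc0r ?conjc1r.
have fI v : form N I v v = ofR (vsq N v).
  rewrite II /vsq (big_morph _ (@ofRD _) (erefl : ofR 0 = 0)).
  by apply: eq_bigr => a _; rewrite mulrC mul_conjc.
have := form_expand p.2 u (- conjc (dot p.2)) hI.
rewrite !fI (_ : vsq N u = 1) // II -/(dot _) mulNr [conjc _ * _]mulrC mul_conjc.
rewrite conjcN conjc_ofR => /(congr1 (@complex.Re _)); rewrite /= -/(dot _).
have -> : nsq (- conjc (dot p.2)) = nsq (dot p.2).
  by rewrite /nsq; case: (dot _) => x y /=; ring.
have : 0 <= vsq N (fun b => p.2 b + - conjc (dot p.2) * u b).
  by apply: sumr_ge0 => a _; exact: nsq_ge0.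
lra.
Qed.

End ProductMatrices.

(** * From complex matrices to lists of rational entries *)

Section Links.
Context {R : realType}.
Local Open Scope ring_scope.
Local Notation C := (R[i]%C).
Local Notation emb := (@emb R).

Definition entries N (A : 'M[gq]_N) : seq gq := [seq A i j | i <- enum 'I_N, j <- enum 'I_N].

Lemma nth_allpairs (S T V : Type) (f : S -> T -> V) (s : seq S) (t : seq T) x0 y0 z0 a b :
  (a < size s)%N -> (b < size t)%N ->
  nth z0 [seq f x y | x <- s, y <- t] (a * size t + b) = f (nth x0 s a) (nth y0 t b).
Proof.
move=> + bt; elim: s a => // x s IH [|a] /= ha.
  by rewrite nth_cat size_map mul0n add0n bt (nth_map y0).
by rewrite nth_cat size_map mulSn -addnA ltnNge leq_addr /= addKn IH.
Qed.

Lemma rowmajor_entries N (A : 'M[gq]_N) (i j : 'I_N) : rowmajor N (entries A) i j = A i j.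
Proof.
have sz : size (enum 'I_N) = N by rewrite size_enum_ord.
rewrite /rowmajor /entries (_ : (i * N + j = i * size (enum 'I_N) + j)%N); last by rewrite sz.
by rewrite (nth_allpairs _ i j) ?sz // !nth_ord_enum.
Qed.

Lemma code_mx_entries N (A : 'M[gq]_N) :
  code_mx A = code_nat N ++ code_nat N ++ flatten [seq code_ratC z | z <- entries A].
Proof. by rewrite /code_mx /entries map_allpairs. Qed.

Lemma psd_entries N (A : 'M[gq]_N) : psd (elem R A) ->
  hermitian N (rowmajor N (entries A)) /\ psd_form N (rowmajor N (entries A)).
Proof.
move=> pA.
have E v : (adjmx (elem R (\col_(i < N) v (nat_of_ord i))) *m elem R A *m
    elem R (\col_(i < N) v (nat_of_ord i))) 0 0 = emb (form N (rowmajor N (entries A)) v v).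
  rewrite mxE /form exchange_big emb_sum; apply: eq_bigr => j _.
  rewrite mxE mulr_suml emb_sum; apply: eq_bigr => i _.
  by rewrite !mxE rowmajor_entries !embM emb_conj.
have h v : complex.Im (form N (rowmajor N (entries A)) v v) = 0 /\
    0 <= complex.Re (form N (rowmajor N (entries A)) v v).
  have := pA (elem R (\col_(i < N) v (nat_of_ord i))); rewrite E lecE /= => /andP[i0 r0].
  move: i0 r0; rewrite ler0q fmorph_eq0 => /eqP i0 r0.
  by split.
by split=> [|v]; [exact: (form_im_hermitian (fun v => (h v).1))|exact: (h v).2].
Qed.

(** Both sides are [<s|1 (x) A|s>]. Thus the bound from [marginal_transfer] becomes the mass bound
    for the contractions. *)
Lemma pairing_marginal N (A : 'M[gq]_N) s :
  pairing (elem R A) (marginal N s) = ratr (trace_sum N (contraction N (entries A) s)).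
Proof.
have -> : trace_sum N (contraction N (entries A) s) = complex.Re
   (\sum_(c < N) \sum_(d < N) marginal N s c d * A d c).
  rewrite /trace_sum /contraction -Re_sum; congr complex.Re.
  rewrite exchange_big; apply: eq_bigr => c _; rewrite exchange_big; apply: eq_bigr => d _.
  rewrite /marginal mulr_suml; apply: eq_bigr => a _.
  by rewrite -[A d c]rowmajor_entries.
have -> z : ratr (complex.Re z) = complex.Re (emb z) by [].
rewrite emb_sum; congr complex.Re; apply: eq_bigr => c _; rewrite emb_sum.
by apply: eq_bigr => d _; rewrite embM !mxE.
Qed.

Lemma sum_product (n : nat) (V : nmodType) (f : 'I_(2 ^ (n + n)) -> V) (e : (2 ^ n * 2 ^ n = 2 ^ (n + n))%N) :
  \sum_i f i = \sum_a \sum_c f (cast_ord e (mxtens_index (a, c))).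
Proof.
rewrite pair_bigA (reindex (fun p => cast_ord e (mxtens_index p))).
  by apply: eq_bigr => -[].
exists (fun i => mxtens_unindex (cast_ord (esym e) i)) => i _.
  by rewrite cast_ordK mxtens_indexK.
by rewrite mxtens_unindexK cast_ordKV.
Qed.

(** The contraction absorbs the elementary factor and is computable; what remains is a pairing with
    an arbitrary [S], which no machine has to know. *)
Lemma qf_qtens n (S : 'M[C]_(2 ^ n)) (A : 'M[gq]_(2 ^ n)) s :
  qf (qtens S (elem R A)) (elem R (vec (2 ^ (n + n))%N s)) =
  pairing S (contraction (2 ^ n)%N (entries A) s).
Proof.
pose e := esym (expnD 2 n n); pose N := (2 ^ n)%N.
rewrite qfE /pairing; congr complex.Re; rewrite (sum_product _ e).
pose F (a c b d : 'I_N) := emb (nth 0 s (a * N + c)%N * conjc (nth 0 s (b * N + d)%N) *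
  rowmajor N (entries A) d c) * S b a.
transitivity (\sum_(b < N) \sum_(d < N) \sum_(a < N) \sum_(c < N) F a c b d).
  apply: eq_bigr => b _; apply: eq_bigr => d _; rewrite (sum_product _ e).
  apply: eq_bigr => a _; apply: eq_bigr => c _.
  rewrite /qtens castmxE /= !cast_ordK tensmxE !mxE -!/(emb _) /F rowmajor_entries !embM emb_conj.
  have v (x y : 'I_N) : nat_of_ord (cast_ord e (mxtens_index (x, y))) = (x * N + y)%N by [].
  by rewrite !v; ring.
transitivity (\sum_(a < N) \sum_(b < N) \sum_(c < N) \sum_(d < N) F a c b d).
  rewrite [RHS]exchange_big; apply: eq_bigr => b _; rewrite exchange_big.
  by apply: eq_bigr => a _; exact: exchange_big.
apply: eq_bigr => a _; apply: eq_bigr => b _.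
rewrite /contraction emb_sum mulr_suml; apply: eq_bigr => c _.
by rewrite emb_sum mulr_suml.
Qed.

End Links.

(** * The two transfers, to [rho] and to [sigma] *)

Section Applications.
Context {R : realType}.
Local Open Scope ring_scope.
Local Open Scope classical_set_scope.
Local Notation C := (R[i]%C).
Local Notation lw := (@length_weight R).

Lemma PR_marginal (A : Type) {EA : Enc A} (N : A -> nat) (s : A -> seq gq) (c d : A -> nat) :
  PR N -> PR s -> PR c -> PR d -> PR (fun x => marginal (N x) (s x) (c x) (d x)).
Proof.
move=> hN hs hc hd; rewrite /marginal.
apply: (PR_sum_ord_cpx (F := fun x a => nth 0 (s x) (a * N x + c x)%N *
  conjc (nth 0 (s x) (a * N x + d x)%N))) => //.
by prt.
Qed.

Lemma PR_contraction (A : Type) {EA : Enc A} (N : A -> nat) (r s : A -> seq gq) (a b : A -> nat) :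
  PR N -> PR r -> PR s -> PR a -> PR b -> PR (fun x => contraction (N x) (r x) (s x) (a x) (b x)).
Proof.
move=> hN hr hs ha hb; rewrite /contraction.
apply: (PR_sum_ord_cpx (F := fun x c => \sum_(d < N x)
    nth 0 (s x) (a x * N x + c)%N * conjc (nth 0 (s x) (b x * N x + d)%N) *
    nth 0 (r x) (d * N x + c)%N)) => //.
apply: (PR_sum_ord_cpx (F := fun (p : A * nat) d =>
    nth 0 (s p.1) (a p.1 * N p.1 + p.2)%N * conjc (nth 0 (s p.1) (b p.1 * N p.1 + d)%N) *
    nth 0 (r p.1) (d * N p.1 + p.2)%N)); first by prt.
by prt.
Qed.

Lemma code_pair_inj x y x' y' : code_pair x y = code_pair x' y' -> x = x' /\ y = y'.
Proof.
rewrite /code_pair => /code_nat_inj [sz] /eqP.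
by rewrite eqseq_cat // => /andP[/eqP -> /eqP ->].
Qed.

Lemma code_nat_injective : injective code_nat.
Proof. by move=> m n; rewrite -[code_nat m]cats0 -[code_nat n]cats0 => /code_nat_inj []. Qed.

Lemma flatten_codes_inj : injective (fun s : seq gq => flatten [seq code_ratC z | z <- s]).
Proof.
have E z r : flatten [seq code_ratC x | x <- z :: r] =
  code_ratC z ++ flatten [seq code_ratC x | x <- r] by [].
elim=> [|a s IH] [|b t] //; rewrite !E.
by case/code_ratC_inj => -> /IH ->.
Qed.

Variable U : TM.
Hypothesis hU : universal_prefix_machine U.
Let pU : prefix_machine U := hU.1.

(** The quantity [t(A/x)] of the overview. *)
Definition expectation (x : seq bool) n (A : 'M[C]_(2 ^ n)) : R :=
  complex.Re (\tr (univ_matrix R U x n *m A)).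

Lemma expectationE x n (A : 'M[C]_(2 ^ n)) :
  (forall s, unit_seq (2 ^ n)%N s -> 0 <= qf A (elem R (vec (2 ^ n)%N s))) ->
  (\esum_(k in halting U (code_pair x (code_nat n)) (2 ^ n)%N)
     (lw k.2 * qf A (elem R (vec (2 ^ n)%N k.1)))%:E = (expectation x A)%:E)%E.
Proof.
move=> A0; have [|fin e] := trace_univ pU x (A := A); last by rewrite /expectation e fineK.
by move=> phi /pure_stateP /A0; rewrite lstK.
Qed.

Lemma halting_unit y d k : halting U y d k -> unit_seq d k.1.
Proof. by case. Qed.

Lemma unit_square n s : unit_seq (2 ^ (n + n))%N s -> unit_seq (2 ^ n * 2 ^ n)%N s.
Proof. by rewrite expnD. Qed.

Lemma esum_transfer (K : choiceType) (D : set K) (p : K -> R) (a b : K -> R) (c : R) (v : \bar R) :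
  0 < c -> (forall k, 0 <= p k) -> (forall k, D k -> 0 <= b k) ->
  (forall k, D k -> a k <= c * b k) ->
  (\esum_(k in D) (p k * b k)%:E <= v)%E -> (\esum_(k in D) (p k * a k)%:E <= c%:E * v)%E.
Proof.
move=> c0 p0 b0 ab h.
(* [esumZ] wants a family that is nonnegative everywhere, while [b] is so only on [D]. *)
pose b' k := Num.max (b k) 0.
have bE k : D k -> b' k = b k by move=> Dk; rewrite /b' (max_idPl _) ?b0.
apply: (@le_trans _ _ (\esum_(k in D) (c%:E * (p k * b' k)%:E))%E).
  apply: le_esum => k Dk; rewrite -EFinM lee_fin mulrCA ler_wpM2l ?p0 // bE //.
  exact: ab.
rewrite esumZ //; last by move=> k; rewrite lee_fin mulr_ge0 ?p0 // le_max lexx orbT.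
rewrite lee_pmul2l // (le_trans _ h) //; apply: le_esum => k Dk.
by rewrite bE.
Qed.

Lemma outs_ge0 d M l (g : seq gq -> R) : certifies d M l -> (forall psi, 0 <= g psi) ->
  0 <= \sum_(o <- outs l) ratr o.1 * g o.2.
Proof.
move=> hl g0; rewrite (big_nth (0, [::])) big_mkord; apply: sumr_ge0 => i _.
by have [q0 _] := certifies_outs hl (ltn_ord i); rewrite mulr_ge0 ?ler0q.
Qed.

Lemma marginal_transfer : exists d : nat, forall n (B : 'M[C]_(2 ^ n)), psd B ->
  (\esum_(k in halting U (code_pair [::] (code_nat (n + n))) (2 ^ (n + n))%N)
     (lw k.2 * pairing B (marginal (2 ^ n)%N k.1))%:E <=
   (12 * (2 ^+ d * expectation [::] B))%:E)%E.
Proof.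
pose target n : seq bool := code_pair [::] (code_nat n).
pose source n : seq bool := code_pair [::] (code_nat (n + n)).
pose mat n (s : seq gq) := marginal (2 ^ n)%N s.
have ti : injective target by move=> m n /code_pair_inj [_] /code_nat_injective.
have h1 : PR target by rewrite /target; prt.
have h2 : PR source by rewrite /source; prt.
have h3 : PR (fun n : nat => (2 ^ n)%N) by prt.
have h4 : PR (fun n : nat => (2 ^ (n + n))%N) by prt.
have h5 : PR (fun n : nat => 0%N) by prt.
have h6 : PR (fun p : ((nat * seq gq) * nat) * nat => mat p.1.1.1 p.1.1.2 p.1.2 p.2).
  by rewrite /mat; apply: PR_marginal; prt.
(* With [loss] 5 the scale is [1/6], which cancels the 6 of the certificate cost; the marginals have
   trace 1. *)
have [d hd] := transfer R hU _ 5%N ti h1 h2 h3 h4 h5 h6.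
exists d => n B pB.
have [|s _||items [hc hg]] := hd n; first by rewrite expn_gt0.
- by split; [exact: marginal_herm|exact: marginal_psd].
- apply: le_trans (esum_halting_le1 pU (source n) (2 ^ (n + n))%N).
  apply: le_esum => k /halting_unit /unit_square u.
  rewrite /mat marginal_trace // rmorph1 mulr1 /scale expr0 mul1r mulVf ?mulr1 //.
have g0 (v : seq gq) : 0 <= qf B (elem R (vec (2 ^ n)%N v)) by exact: qf_ge0.
have := hg _ g0; rewrite expectationE; last by move=> s _; exact: qf_ge0.
move=> h; rewrite EFinM.
(* [12 = 2 * 6]: the factor of [pairing_outs] and the inverse of the scale. *)
have c12 : 0 < 12 :> R by rewrite ltr0n.
apply: (esum_transfer c12 _ _ _ h).
- by move=> k; exact: length_weight_ge0.
- move=> k sk; apply: mulr_ge0; first exact: scale_ge0.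
  exact: outs_ge0 (hc k sk) g0.
- move=> k sk; apply: le_trans (pairing_outs pB (hc k sk)) _.
  rewrite mulrA ler_wpM2r //; last by rewrite /scale expr0; lra.
  exact: outs_ge0 (hc k sk) g0.
Qed.

Lemma trace_sum_ge0 N M : psd_form N M -> 0 <= trace_sum N M.
Proof.
by move=> pM; apply: sumr_ge0 => a _; have := pM (delta _ a); rewrite form_delta.
Qed.

Lemma trace_sum_eq0 N M a b : hermitian N M -> psd_form N M -> trace_sum N M = 0 ->
  (a < N)%N -> (b < N)%N -> M a b = 0.
Proof.
move=> hM pM t0 aN bN; apply: (psd_row0 hM pM aN bN); rewrite (herm_diag hM aN).
have nn (i : 'I_N) : true -> 0 <= complex.Re (M i i).
  by move=> _; have := pM (delta _ i); rewrite form_delta.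
have /eqP := t0; rewrite /trace_sum psumr_eq0 // => /allP /(_ (Ordinal aN)).
by rewrite mem_index_enum => /(_ isT) /eqP /= ->.
Qed.

Section States.
Variables (n : nat) (S : 'M[C]_(2 ^ n)) (A : 'M[gq]_(2 ^ n)).
Hypotheses (pS : psd S) (pA : psd (elem R A)).
Local Notation N := (2 ^ n)%N.
Let hA : hermitian N (rowmajor N (entries A)) := (psd_entries pA).1.
Let qA : psd_form N (rowmajor N (entries A)) := (psd_entries pA).2.

(** A decomposition of the contraction reduces this to values of [S] at vectors, where positivity of
    [S] applies. *)
Lemma pairing_contraction_ge0 s : 0 <= pairing S (contraction N (entries A) s).
Proof.
have N0 : (0 < N)%N by rewrite expn_gt0.
have [l hl] := certificate_exists N0 (contraction_herm s hA) (contraction_psd s qA).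
exact: pairing_ge0 hl.
Qed.

Lemma expectation_tensor :
  (\esum_(k in halting U (code_pair [::] (code_nat (n + n))) (2 ^ (n + n))%N)
     (lw k.2 * pairing S (contraction N (entries A) k.1))%:E =
   (expectation [::] (qtens S (elem R A)))%:E)%E.
Proof.
rewrite -expectationE; last by move=> s _; rewrite qf_qtens pairing_contraction_ge0.
by apply: eq_esum => k _; rewrite qf_qtens.
Qed.

Lemma qf_elem_le1 s : \tr (elem R A) <= 1 -> unit_seq N s -> qf (elem R A) (elem R (vec N s)) <= 1.
Proof.
move=> tA /andP[_ /eqP u].
have := form_le_trace hA qA u; rewrite -(ler_rat R).
have -> : qf (elem R A) (elem R (vec N s)) = ratr (complex.Re (form N (rowmajor N (entries A)) (nth 0 s) (nth 0 s))).
  rewrite -[RHS]/(complex.Re (@emb R (form _ _ _ _))) qfE /form emb_sum; congr complex.Re.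
  apply: eq_bigr => i _; rewrite emb_sum; apply: eq_bigr => j _.
  by rewrite !mxE !embM emb_conj rowmajor_entries.
move=> h; apply: le_trans h _.
have -> : ratr (trace_sum N (rowmajor N (entries A))) = complex.Re (\tr (elem R A)).
  rewrite /trace_sum -Re_sum -[LHS]/(complex.Re (@emb R _)) emb_sum; congr complex.Re.
  by apply: eq_bigr => i _; rewrite !mxE rowmajor_entries.
by move: tA; rewrite lecE => /andP[].
Qed.

(** Makes the entropy of [rho] nonnegative, so that its code is that of a natural number. *)
Lemma expectation_le1 x : \tr (elem R A) <= 1 -> expectation x (elem R A) <= 1.
Proof.
move=> tA; rewrite -lee_fin -expectationE; last by move=> s _; exact: qf_ge0.
apply: le_trans (esum_halting_le1 pU (code_pair x (code_nat n)) N).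
apply: le_esum => k /halting_unit u; rewrite lee_fin ler_piMr ?length_weight_ge0 //.
exact: qf_elem_le1.
Qed.

(** The case of infinite entropy. By [marginal_transfer], [<s|1 (x) A|s>] vanishes at every vector
    output by a program, so its contraction has trace zero and, being positive, is zero on all its
    entries. *)
Lemma expectation_tensor_eq0 : expectation [::] (elem R A) <= 0 ->
  expectation [::] (qtens S (elem R A)) <= 0.
Proof.
move=> t0; have [d /(_ n _ pA)] := marginal_transfer.
have t0' : 12 * (2 ^+ d * expectation [::] (elem R A)) <= 0.
  by rewrite mulr_ge0_le0 // mulr_ge0_le0.
rewrite -lee_fin in t0'; move=> /le_trans /(_ t0') h.
rewrite -lee_fin -expectation_tensor esum1 // => k sk.
have uk := halting_unit sk.
have hM := contraction_herm k.1 hA; have pM := contraction_psd k.1 qA.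
have l0 : 0 < lw k.2 by rewrite /length_weight invr_gt0 exprn_gt0.
have tr0 : trace_sum N (contraction N (entries A) k.1) = 0.
  apply/eqP; rewrite eq_le trace_sum_ge0 // andbT -(ler_rat R) rmorph0 -pairing_marginal.
  rewrite -(pmulr_rle0 _ l0) -lee_fin.
  pose f (k : seq gq * seq bool) := (lw k.2 * pairing (elem R A) (marginal N k.1))%:E.
  have f0 : (0 <= f k)%E.
    by rewrite /f pairing_marginal lee_fin mulr_ge0 ?length_weight_ge0 // ler0q trace_sum_ge0.
  by apply: le_trans h; rewrite -/(f k) -(esum_set1 f0); apply: esum_subset => _ ->.
rewrite /pairing big1 ?mulr0 // => a _; apply: big1 => b _.
by rewrite (trace_sum_eq0 hM pM tr0) // emb0 mul0r.
Qed.

End States.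

Lemma contraction_transfer : exists d : nat,
  forall n (S : 'M[C]_(2 ^ n)) (A : 'M[gq]_(2 ^ n)) (h : nat), psd S -> psd (elem R A) ->
  2 ^+ h * expectation [::] (elem R A) <= 2 ->
  2 ^+ h * expectation [::] (qtens S (elem R A)) <=
  2 ^+ d * expectation (code_pair (code_mx A) (code_nat h)) S.
Proof.
have [dm hdm] := marginal_transfer.
pose X := (nat * (seq gq * nat))%type.
pose target (x : X) : seq bool := code_pair (code_pair (code_nat (2 ^ x.1) ++ code_nat (2 ^ x.1) ++
  flatten [seq code_ratC z | z <- x.2.1]) (code_nat x.2.2)) (code_nat x.1).
pose source (x : X) : seq bool := code_pair [::] (code_nat (x.1 + x.1)).
pose mat (x : X) (s : seq gq) := contraction (2 ^ x.1)%N x.2.1 s.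
(* The mass is at most [6 * 12 * 2^dm * 2], from the certificates, the marginals and the hypothesis
   on [h], and this is below [2^(8 + dm)]. *)
pose loss := (2 ^ (8 + dm)).-1.
have ti : injective target.
  move=> [n [r h]] [n' [r' h']] /code_pair_inj [/code_pair_inj [e /code_nat_injective /= ->]].
  move=> /code_nat_injective /= nn; subst n'; move: e => /= /code_nat_inj [_] /code_nat_inj [_].
  by move=> /flatten_codes_inj ->.
have h1 : PR target by rewrite /target; prt.
have h2 : PR source by rewrite /source; prt.
have h3 : PR (fun x : X => (2 ^ x.1)%N) by prt.
have h4 : PR (fun x : X => (2 ^ (x.1 + x.1))%N) by prt.
have h5 : PR (fun x : X => x.2.2) by prt.
have h6 : PR (fun p : ((X * seq gq) * nat) * nat => mat p.1.1.1 p.1.1.2 p.1.2 p.2).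
  by rewrite /mat; apply: PR_contraction; prt.
have [d hd] := transfer R hU _ loss ti h1 h2 h3 h4 h5 h6.
have lossE : loss.+1%:R = 2 ^+ (8 + dm) :> R by rewrite /loss prednK ?expn_gt0 // natrX.
(* Undoing the division by [2^(8 + dm)], the factor 2 of [pairing_outs], and the [2^d] of the
   transfer. *)
exists (9 + dm + d)%N => n S A h pS pA th.
have [hA qA] := psd_entries pA.
pose x : X := (n, (entries A, h)).
have sE : scale (fun x : X => x.2.2) loss x = 2 ^+ h / 2 ^+ (8 + dm) :> R.
  by rewrite /scale lossE.
have [|s _||items [hc hg]] := hd x; first by rewrite expn_gt0.
- by split; [exact: contraction_herm|exact: contraction_psd].
- pose c : R := 6 * 2 ^+ h / 2 ^+ (8 + dm).
  have c0 : 0 < c by rewrite /c !mulr_gt0 ?invr_gt0 ?exprn_gt0.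
  have := hdm n _ pA => /(esum_transfer c0).
  move=> /(_ (fun k => scale (fun x : X => x.2.2) loss x *
     (6 * ratr (trace_sum (2 ^ x.1)%N (mat x k.1))))) H.
  apply: le_trans (H _ _ _) _.
  + by move=> k; exact: length_weight_ge0.
  + by move=> k sk; rewrite pairing_marginal ler0q trace_sum_ge0 //; exact: contraction_psd.
  + by move=> k sk; rewrite pairing_marginal sE /c le_eqVlt; apply/orP; left; apply/eqP; ring.
  rewrite -EFinM lee_fin /c.
  have p0 : (0 : R) < 2 ^+ dm by rewrite exprn_gt0.
  rewrite exprD invfM.
  have -> : 6 * 2 ^+ h * ((2 ^+ 8)^-1 * (2 ^+ dm)^-1) *
      (12 * (2 ^+ dm * expectation [::] (elem R A))) =
      72 / 256 * (2 ^+ h * expectation [::] (elem R A)) * (2 ^+ dm / 2 ^+ dm).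
    by rewrite (_ : 2 ^+ 8 = 256 :> R) ?expr2 //; [field; rewrite gt_eqF|ring].
  by rewrite divff ?gt_eqF // mulr1; lra.
have g0 (v : seq gq) : 0 <= qf S (elem R (vec (2 ^ n)%N v)) by exact: qf_ge0.
have := hg _ g0.
have -> : target x = code_pair (code_pair (code_mx A) (code_nat h)) (code_nat n).
  by rewrite /target /= code_mx_entries.
rewrite expectationE; last by move=> s _; exact: qf_ge0.
pose c : R := 2 ^+ (9 + dm) / 2 ^+ h.
have c0 : 0 < c by rewrite /c divr_gt0 ?exprn_gt0.
move=> /(esum_transfer c0) => /(_ (fun k => pairing S (contraction (2 ^ n)%N (entries A) k.1))) H.
have {H} : ((expectation [::] (qtens S (elem R A)))%:E <=
    c%:E * ((2 ^+ d)%:E * (expectation (code_pair (code_mx A) (code_nat h)) S)%:E))%E.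
  rewrite -expectation_tensor //; apply: H.
  - by move=> k; exact: length_weight_ge0.
  - move=> k sk; apply: mulr_ge0; first exact: scale_ge0.
    exact: outs_ge0 (hc k sk) g0.
  - move=> k sk; apply: le_trans (pairing_outs pS (hc k sk)) _.
    rewrite sE /c [(9 + dm)%N]addSn exprS le_eqVlt; apply/orP; left; apply/eqP.
    by field; rewrite !expf_neq0.
rewrite -!EFinM lee_fin => H.
have p0 : (0 : R) < 2 ^+ h by rewrite exprn_gt0.
rewrite -(ler_pM2l p0) in H; apply: le_trans H _.
rewrite /c le_eqVlt; apply/orP; left; apply/eqP; rewrite (exprD _ (9 + dm) d).
by field; rewrite gt_eqF.
Qed.

End Applications.

(** * Logarithms and rounding *)

Lemma ceil_shift (R : realType) (z : int) (d : nat) (x y : R) :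
  (z%:~R + y <= d%:R + x -> (z%:~R : R) + (Num.ceil (- x))%:~R <= (Num.ceil (- y))%:~R + d%:R :> R)%R.
Proof.
move=> h; have := ceil_ge (- y); move: (Num.ceil (- y)) => q qy.
(* The bound for [- x] is an integer, so it passes to the ceiling without loss. *)
have : (Num.ceil (- x) <= q + d%:Z - z)%R.
  by rewrite ceil_le_int intrB intrD -pmulrn; move: h qy; lra.
by rewrite -(ler_int R) intrB intrD -pmulrn; lra.
Qed.

Theorem theorem1 (R : realType) (U : TM) (hU : universal_prefix_machine U) :
  exists c : nat,
    forall (n : nat) (sigma : 'M[R[i]%C]_(2 ^ n)) (rho : 'M[rat[i]%C]_(2 ^ n)),
      semi_density sigma -> semi_density (elem R rho) ->
      (gacs U (elem R rho) [::] +
         gacs U sigma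
           (code_pair (code_mx rho) (code_entropy (gacs U (elem R rho) [::])))
       <= gacs U (qtens sigma (elem R rho)) [::] + (c%:R)%:E)%E.
Proof.
have [d hd] := contraction_transfer (R := R) hU.
exists d => n sigma rho [ps _] [pr tr].
have gE m (A : 'M[R[i]%C]_(2 ^ m)) x : gacs U A x = (if (expectation U x A <= 0)%R then +oo%E
  else ((Num.ceil (- (ln (expectation U x A) / ln 2)))%:~R)%:E) by [].
rewrite (gE _ (qtens _ _)).
have [ts0|ts0] := leP (expectation U [::] (qtens sigma (elem R rho))) 0%R.
  by rewrite addye ?leey.
have te0 : (0 < expectation U [::] (elem R rho))%R.
  rewrite ltNge; apply/negP => /(expectation_tensor_eq0 hU ps pr).
  by rewrite leNgt ts0.
have te1 : (expectation U [::] (elem R rho) <= 1)%R by exact: expectation_le1.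
have l2 : (0 < ln (2 : R))%R by rewrite ln_gt0 // ltr1n.
pose H : int := Num.ceil (- (ln (expectation U [::] (elem R rho)) / ln 2)).
have HE : gacs U (elem R rho) [::] = (H%:~R)%:E by rewrite gE leNgt te0.
have lt0 := ln_le0 te1.
(* [code_entropy] truncates to a natural number, which is exact only for a nonnegative value. *)
have H0 : (0 <= H)%R.
  rewrite ceil_ge0 (lt_le_trans (y := 0%R)) ?ltrN10 // -mulNr.
  by apply: mulr_ge0; [rewrite oppr_ge0|rewrite invr_ge0 ltW].
pose h := `|H|%N.
have hE : (h%:R = H%:~R :> R)%R by rewrite -[in RHS](gez0_abs H0).
have ce : code_entropy (gacs U (elem R rho) [::]) = code_nat h.
  by rewrite HE /code_entropy -hE natrK.
rewrite ce HE.
pose L (x : R) := (ln x / ln 2)%R.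
have LM x y : (0 < x)%R -> (0 < y)%R -> L (x * y)%R = (L x + L y)%R.
  by move=> x0 y0; rewrite /L lnM ?posrE // mulrDl.
have L2 k : L (2 ^+ k)%R = (k%:R)%R.
  by rewrite /L lnXn // -(mulr_natl (ln 2)) mulfK // gt_eqF.
have p2 k : (0 < 2 ^+ k :> R)%R by rewrite exprn_gt0.
have Lle x y : (0 < x)%R -> (x <= y)%R -> (L x <= L y)%R.
  move=> x0 xy; rewrite /L ler_pM2r ?invr_gt0 // ler_ln ?posrE //.
  exact: lt_le_trans xy.
have Hlt : (H%:~R - 1 < - L (expectation U [::] (elem R rho)))%R.
  by have := ceilB1_lt (- L (expectation U [::] (elem R rho))); rewrite -/H intrD.
(* Rounding up adds less than 1 to the exponent, hence the bound 2 instead of 1. *)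
have mass : (2 ^+ h * expectation U [::] (elem R rho) <= 2)%R.
  rewrite leNgt; apply/negP => /ltW /(Lle _ _ (ltr0n _ 2)).
  rewrite LM // L2 hE (_ : L 2 = 1)%R; last by rewrite /L divff // gt_eqF.
  by move: Hlt; lra.
have key := hd n sigma rho h ps pr mass.
have l0 : (0 < 2 ^+ h * expectation U [::] (qtens sigma (elem R rho)))%R by rewrite mulr_gt0.
(* So the conditional entropy of [sigma] is finite as well. *)
have t0 : (0 < expectation U (code_pair (code_mx rho) (code_nat h)) sigma)%R.
  by rewrite -(pmulr_rgt0 _ (p2 d)) (lt_le_trans l0).
have := Lle _ _ l0 key; rewrite !LM // !L2 => Lkey.
rewrite (gE _ sigma) [(expectation _ _ sigma <= 0)%R]leNgt t0 -!EFinD lee_fin.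
by apply: ceil_shift; rewrite -hE.
Qed.
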